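(* Let $F$, $T$ and $V$ be Thompson's groups. (i) Every faithful, minimal action of $F$ on a compact space is topologically free. (ii) Every non-trivial minimal action of $T$ on a compact space is either topologically free or factors onto the standard action of $T$ on the circle $\mathbb{S}^1$. (iii) Every non-trivial minimal action of $V$ on a compact space is either topologically free or factors onto the standard action of $V$ on the Cantor set $\mathcal{C}$.
   Context: Actions are by homeomorphisms and compact spaces are Hausdorff. An action $G\curvearrowright X$ is minimal if every orbit is dense; topologically free if $\mathrm{Fix}(g)$ has empty interior for every non-trivial $g\in G$. An action $G\curvearrowright X$ factors onto $G\curvearrowright Y$ if there exists a continuous $G$-equivariant map from $X$ onto $Y$. Thompson's group $T$ is the group of orientation preserving homeomorphisms of $\mathbb{S}^1=\mathbb{R}/\mathbb{Z}$ which are piecewise linear, with only finitely many breakpoints, all at dyadic rationals, slopes in $2^{\mathbb{Z}}$, and preserving the set of dyadic rationals (as is part of the usual definition). $F$ is the subgroup of $T$ stabilizing $0\in\mathbb{S}^1$. Let $\mathcal{C}=\{0,1\}^{\mathbb{N}}$ with the product topology, and for a finite binary word $w$ let $C_w$ be the cylinder of sequences with prefix $w$. $V$ is the group of homeomorphisms $g$ of $\mathcal{C}$ for which there exist cylinder partitions $\{C_{w_1},\dots,C_{w_n}\}$, $\{C_{z_1},\dots,C_{z_n}\}$ of $\mathcal{C}$ with $g(w_ix)=z_ix$ for every $i$ and every binary sequence $x$. *)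

(* Defs.v *)
From HB Require Import structures.
From mathcomp Require Import all_boot all_order all_algebra.
From mathcomp Require Import archimedean generic_quotient ring_quotient.
From mathcomp Require Import all_classical all_reals all_analysis.

Set Implicit Arguments.
Unset Strict Implicit.
Unset Printing Implicit Defensive.

Import Order.TTheory GRing.Theory Num.Theory.
Import numFieldNormedType.Exports.

Local Open Scope classical_set_scope.
Local Open Scope ring_scope.

(* Self-homeomorphisms of a space. In the group law, g * h is g after h. *)

Record homeo (X : topologicalType) := Homeo {
  homeo_fun :> X -> X;
  homeo_inv : X -> X;
  homeo_funK : cancel homeo_fun homeo_inv;
  homeo_invK : cancel homeo_inv homeo_fun;
  homeo_continuous : continuous homeo_fun;
  homeo_inv_continuous : continuous homeo_inv
}.

Section HomeoGroup.
Variable X : topologicalType.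
Implicit Types f g h : homeo X.

Lemma homeo_ext f g : f =1 g -> f = g.
Proof.
case: f g => [f f' fK f'K cf cf'] [g g' gK g'K cg cg'] /= /funext efg.
rewrite -{}efg in gK g'K cg *.
have efg' : f' = g' by apply/funext => x; rewrite -{1}(g'K x) fK.
rewrite -{}efg' in gK g'K cg' *.
by congr Homeo; exact: Prop_irrelevance.
Qed.

HB.instance Definition _ := gen_eqMixin (homeo X).
HB.instance Definition _ := gen_choiceMixin (homeo X).

Definition homeo_one : homeo X :=
  @Homeo X id id
    (fun=> erefl) (fun=> erefl) (fun=> cvg_id) (fun=> cvg_id).

Lemma homeo_comp_continuous (u v : X -> X) :
  continuous u -> continuous v -> continuous (u \o v).
Proof. by move=> cu cv x; exact: continuous_comp (cv x) (cu (v x)). Qed.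

Definition homeo_mul g h : homeo X :=
  Homeo (can_comp (homeo_funK g) (homeo_funK h))
        (can_comp (homeo_invK h) (homeo_invK g))
        (homeo_comp_continuous (@homeo_continuous _ g) (@homeo_continuous _ h))
        (homeo_comp_continuous (@homeo_inv_continuous _ h)
                               (@homeo_inv_continuous _ g)).

Definition homeo_invg g : homeo X :=
  Homeo (homeo_invK g) (homeo_funK g)
        (@homeo_inv_continuous _ g) (@homeo_continuous _ g).

Lemma homeo_mulA : associative homeo_mul.
Proof. by move=> f g h; exact: homeo_ext. Qed.
Lemma homeo_mul1 : left_id homeo_one homeo_mul.
Proof. by move=> f; exact: homeo_ext. Qed.
Lemma homeo_mulr1 : right_id homeo_one homeo_mul.
Proof. by move=> f; exact: homeo_ext. Qed.
Lemma homeo_mulV : left_inverse homeo_one homeo_invg homeo_mul.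
Proof. by move=> f; apply: homeo_ext => x; exact: homeo_funK. Qed.
Lemma homeo_mulrV : right_inverse homeo_one homeo_invg homeo_mul.
Proof. by move=> f; apply: homeo_ext => x; exact: homeo_invK. Qed.

HB.instance Definition _ := isGroup.Build (homeo X)
  homeo_mulA homeo_mul1 homeo_mulr1 homeo_mulV homeo_mulrV.

Lemma homeo1E x : (1%g : homeo X) x = x. Proof. by []. Qed.
Lemma homeoME g h x : (g * h)%g x = g (h x). Proof. by []. Qed.
Lemma homeoVE g x : (g^-1)%g x = homeo_inv g x. Proof. by []. Qed.

End HomeoGroup.

(* Each [act g] is a homeomorphism, with inverse [act g^-1]. *)
Record action (G : groupType) (X : topologicalType) := Action {
  act :> G -> X -> X;
  act1 : forall x, act 1%g x = x;
  actM : forall g h x, act (g * h)%g x = act g (act h x);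
  act_continuous : forall g, continuous (act g)
}.

Section Actions.
Variables (G : groupType) (X : topologicalType) (a : action G X).

Definition act_orbit (x : X) : set X := range (fun g => a g x).

Definition fixpoints (g : G) : set X := [set x | a g x = x].

Definition minimal := forall x, dense (act_orbit x).

Definition topologically_free :=
  forall g : G, g <> 1%g -> (fixpoints g)^° = set0.

Definition faithful := forall g : G, (forall x, a g x = x) -> g = 1%g.

Definition nontrivial_action := exists g x, a g x <> x.

Definition factors_onto (Y : topologicalType) (b : action G Y) :=
  exists f : X -> Y, [/\ continuous f, (forall y, exists x, f x = y) &
    forall g x, f (a g x) = b g (f x)].

End Actions.

Section Circle.
Variable R : realType.

Definition integer : {pred R} := fun x => x \is a Num.int.

Fact integer_zmod_closed : zmod_closed integer.
Proof. by split; [exact: rpred0 | exact: rpredB]. Qed.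
HB.instance Definition _ :=
  GRing.isZmodClosed.Build R integer integer_zmod_closed.

Definition circle : topologicalType :=
  quotient_topology (Quotient.quot integer).

Definition to_circle (x : R) : circle :=
  (\pi_(quotient_topology (Quotient.quot integer)) x)%qT.

Lemma to_circle_eq x y : to_circle x = to_circle y <-> x - y \is a Num.int.
Proof.
rewrite -[_ \is a _]/(x - y \in integer) Quotient.idealrBE.
by split=> [e|/eqP e]; [apply/eqP; exact: e|exact: e].
Qed.

Lemma to_circle_surj (p : circle) : exists x, to_circle x = p.
Proof.
exists (repr (p : quotient_topology (Quotient.quot integer))); exact: reprK.
Qed.

End Circle.

Section ThompsonT.
Variable R : realType.
Implicit Types (g h : homeo (circle R)) (f : R -> R).

Definition dyadic : set R :=
  [set x | exists (m : int) (n : nat), x = m%:~R / 2 ^+ n].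

Definition dyadic_circle : set (circle R) := to_circle (R:=R) @` dyadic.

(* [f] is a lift of [g] to the universal cover; [g] preserves the orientation
   exactly when it has an increasing lift. *)
Definition increasing_lift g f :=
  [/\ continuous f, {homo f : x y / x < y}, (forall x, f (x + 1) = f x + 1) &
      forall x, g (to_circle x) = to_circle (f x)].

(* [f] is affine, with slope a power of two, on every interval having no point
   of [B] (modulo 1) in its interior. *)
Definition dyadic_affine_off (B : set (circle R)) f :=
  forall a b : R, a < b -> (forall x, a < x < b -> ~ B (to_circle x)) ->
  exists (k : int) (c : R), forall x, a <= x <= b -> f x = 2 ^ k * x + c.

Definition is_thompsonT g := exists (f : R -> R) (B : set (circle R)),
  [/\ increasing_lift g f, finite_set B, B `<=` dyadic_circle,
      dyadic_affine_off B f & g @` dyadic_circle = dyadic_circle].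

Definition thompsonT_pred : {pred homeo (circle R)} :=
  fun g => `[< is_thompsonT g >].

Lemma homeo_image_inv (X : topologicalType) (g : homeo X) (A : set X) :
  g @` A = A -> (g^-1)%g @` A = A.
Proof.
move=> gA; rewrite -[X in _ @` X]gA image_comp.
rewrite (_ : _ \o _ = id) ?image_id//.
by apply/funext => x; exact: homeo_funK.
Qed.

Lemma is_thompsonT1 : is_thompsonT 1%g.
Proof.
exists id, set0; split => //.
- by split => //; move=> x; exact: cvg_id.
- by move=> a b ab _; exists 0, 0 => x _; rewrite expr0z mul1r addr0.
- by rewrite (_ : homeo_fun _ = id)// image_id.
Qed.

Lemma increasing_le f : {homo f : x y / x < y} -> {mono f : x y / x <= y}.
Proof. exact: le_mono. Qed.

Lemma is_thompsonTM g h :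
  is_thompsonT g -> is_thompsonT h -> is_thompsonT (g * h)%g.
Proof.
move=> [f [B [[fc fi f1 fg] finB Bd Ba gd]]].
move=> [f' [B' [[f'c f'i f'1 f'g] finB' B'd B'a hd]]].
have hd' := homeo_image_inv hd.
exists (f \o f'), (B' `|` (h^-1)%g @` B); split.
- split.
  + exact: homeo_comp_continuous.
  + by move=> x y xy; exact/fi/f'i.
  + by move=> x /=; rewrite f'1 f1.
  + by move=> x; rewrite homeoME f'g fg.
- by rewrite finite_setU; split=> //; exact: finite_image.
- move=> x [/B'd//|[y /Bd yd <-]].
  by rewrite -hd'; exists y.
- move=> a b ab abB.
  have [|k' [c' E']] := B'a _ _ ab.
    by move=> x xab Bx; apply: (abB x xab); left.
  have f'm := increasing_le f'i.
  have pos (m : int) : 0 < 2 ^ m :> R by exact: exprz_gt0.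
  have [|k [c E]] := Ba _ _ (f'i _ _ ab).
    move=> y /andP[ay yb] By.
    have ya : f' ((y - c') / 2 ^ k') = y /\ a < (y - c') / 2 ^ k' < b.
      have Ea : f' a = 2 ^ k' * a + c' by apply: E'; rewrite lexx ltW.
      have Eb : f' b = 2 ^ k' * b + c' by apply: E'; rewrite lexx ltW.
      have abm : a < (y - c') / 2 ^ k' < b.
        rewrite ltr_pdivlMr// ltr_pdivrMr// ltrBrDr ltrBlDr.
        by rewrite ![_ * 2 ^ k']mulrC -Ea -Eb ay yb.
      split=> //; rewrite E'; last by move: abm => /andP[/ltW-> /ltW->].
      by rewrite mulrC divfK ?subrK// gt_eqF.
    move: ya => [ya yab]; apply: (abB _ yab); right.
    exists (to_circle y) => //.
    have <- : h (to_circle ((y - c') / 2 ^ k')) = to_circle y.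
      by rewrite f'g ya.
    exact: homeo_funK.
  exists (k + k'), (2 ^ k * c' + c) => x xab /=.
  rewrite E ?f'm// E'// expfzDr ?pnatr_eq0//.
  by rewrite mulrDr mulrA addrA.
- by rewrite -[RHS]gd -[in RHS]hd image_comp.
Qed.

Lemma lift_int g f : increasing_lift g f ->
  forall x (m : int), f (x + m%:~R) = f x + m%:~R.
Proof.
move=> [_ _ f1 _] x m.
have fn y (n : nat) : f (y + n%:R) = f y + n%:R.
  by elim: n => [|n IH]; rewrite ?addr0// -addn1 natrD !addrA f1 IH.
case: m => n; first by rewrite -!pmulrn fn.
rewrite NegzE mulrNz -!pmulrn; apply/eqP.
by rewrite eq_sym subr_eq -fn subrK.
Qed.

Lemma lift_surj g f : increasing_lift g f -> forall y, exists x, f x = y.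
Proof.
move=> fl y; have [fc fi _ _] := fl; have fm := increasing_le fi.
pose m := Num.floor (y - f 0).
have := floor_itv (y - f 0); rewrite -/m => /andP[my ym].
have E k : f k%:~R = f 0 + k%:~R by rewrite -[in LHS](add0r k%:~R) (lift_int fl).
have le : m%:~R <= (m + 1)%:~R :> R by rewrite ler_int lerDl.
have [||x _ <-] := @IVT R f m%:~R (m + 1)%:~R y le; last by exists x.
  by apply: continuous_subspaceT => x; exact: fc.
rewrite minEle maxEle fm le !E; apply/andP; split.
  by rewrite -lerBrDl.
by rewrite -lerBlDl ltW.
Qed.

Lemma is_thompsonTV g : is_thompsonT g -> is_thompsonT (g^-1)%g.
Proof.
move=> [f [B [fl finB Bd Ba gd]]].
have [h hK] := choice (lift_surj fl); have [fc fi f1 fg] := fl.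
have fm := increasing_le fi.
have fI : injective f.
  by move=> x y /eqP; rewrite eq_le !fm -eq_le => /eqP.
have fK : cancel f h by move=> x; apply: fI; rewrite hK.
have hm x y : (h x <= h y) = (x <= y) by rewrite -fm !hK.
have hlt x y : (h x < h y) = (x < y) by rewrite !ltNge hm.
have fh x y : (f x < y) = (x < h y) by rewrite -hlt fK.
have hf x y : (y < f x) = (h y < x) by rewrite -hlt fK.
have hg x : (g^-1)%g (to_circle x) = to_circle (h x).
  by rewrite -{1}(hK x) -fg; exact: homeo_funK.
exists h, (g @` B); split.
- split => //; last 2 first.
  + by move=> x y; rewrite hlt.
  + by move=> x; apply: fI; rewrite hK f1 hK.
  move=> y; apply/cvgrPdist_lt => e e0.
  have yin : y \in `]f (h y - e), f (h y + e)[.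
    by rewrite in_itv /= fh hf ltrBlDr !ltrDl e0.
  near=> z.
  have : z \in `]f (h y - e), f (h y + e)[ by near: z; exact: near_in_itvoo.
  by rewrite in_itv /= fh hf distrC ltr_distl.
- exact: finite_image.
- by move=> _ [x /Bd xd <-]; rewrite -gd; exists x.
- move=> a b ab abB.
  have [||k [c E]] := Ba (h a) (h b); first by rewrite hlt.
    move=> x xab Bx; apply: (abB (f x)); first by rewrite hf fh.
    by exists (to_circle x) => //; rewrite fg.
  exists (- k), (- (2 ^ (- k) * c)) => y yab.
  rewrite -[in RHS](hK y) E ?hm// -mulrBr addrK mulrA -expfzDr ?pnatr_eq0//.
  by rewrite addNr expr0z mul1r.
- exact: homeo_image_inv.
Unshelve. all: by end_near. Qed.

Fact thompsonT_closed : group_closed thompsonT_pred.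
Proof.
split; first exact/asboolP/is_thompsonT1.
move=> g h /asboolP gT /asboolP hT; apply/asboolP.
exact/is_thompsonTM/is_thompsonTV.
Qed.

Record thompsonT := ThompsonT {
  thompsonT_val :> homeo (circle R);
  _ : thompsonT_val \in thompsonT_pred
}.

HB.instance Definition _ := [isSub for thompsonT_val].
HB.instance Definition _ := [Choice of thompsonT by <:].
HB.instance Definition _ :=
  SubChoice_isSubGroup.Build (homeo (circle R)) thompsonT_pred thompsonT
    thompsonT_closed.

Definition circle_action : action thompsonT (circle R) :=
  @Action thompsonT (circle R) (fun g : thompsonT => thompsonT_val g)
    (fun=> erefl) (fun _ _ _ => erefl)
    (fun g : thompsonT => @homeo_continuous _ (thompsonT_val g)).

Definition thompsonF_pred : {pred thompsonT} :=
  fun g : thompsonT => g (to_circle 0) == to_circle 0.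

Fact thompsonF_closed : group_closed thompsonF_pred.
Proof.
split; first exact: eqxx.
move=> g h /eqP g0 /eqP h0; apply/eqP.
rewrite -[LHS]/(g (homeo_inv h (to_circle 0))).
by rewrite -{1}h0 homeo_funK.
Qed.

Record thompsonF := ThompsonF {
  thompsonF_val :> thompsonT;
  _ : thompsonF_val \in thompsonF_pred
}.

HB.instance Definition _ := [isSub for thompsonF_val].
HB.instance Definition _ := [Choice of thompsonF by <:].
HB.instance Definition _ :=
  SubChoice_isSubGroup.Build thompsonT thompsonF_pred thompsonF
    thompsonF_closed.

End ThompsonT.

Definition cylinder (w : seq bool) : set cantor_space :=
  [set x | forall i, (i < size w)%N -> x i = nth false w i].

Definition word_cat (w : seq bool) (x : cantor_space) : cantor_space :=
  fun i => if (i < size w)%N then nth false w i else x (i - size w)%N.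

Definition cylinder_partition (I : Type) (w : I -> seq bool) :=
  trivIset setT (fun i => cylinder (w i)) /\
  \bigcup_i cylinder (w i) = setT.

Definition is_thompsonV (g : homeo cantor_space) :=
  exists n (w z : 'I_n -> seq bool),
    [/\ cylinder_partition w, cylinder_partition z &
        forall i x, g (word_cat (w i) x) = word_cat (z i) x].

Definition thompsonV_pred : {pred homeo cantor_space} :=
  fun g => `[< is_thompsonV g >].

Lemma cylinderP w x : cylinder w x <-> exists y, x = word_cat w y.
Proof.
split=> [xw|[y ->] i iw]; last by rewrite /word_cat iw.
exists (fun i => x (size w + i)%N); apply/funext => i; rewrite /word_cat.
by case: ltnP => iw; [exact: xw | rewrite subnKC].
Qed.

Lemma word_cat_inj w : injective (word_cat w).
Proof.
move=> x y /(congr1 (fun u => u (size w + _)%N)) e; apply/funext => i.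
by have := e i; rewrite /word_cat ltnNge leq_addr /= addKn.
Qed.

Lemma word_cat_cat w z x : word_cat (w ++ z) x = word_cat w (word_cat z x).
Proof.
apply/funext => i; rewrite /word_cat size_cat nth_cat.
case: (ltnP i (size w)) => iw; first by rewrite ltn_addr.
by rewrite subnDA ltn_subLR.
Qed.

Lemma cylinder_cat w z : cylinder (w ++ z) `<=` cylinder w.
Proof.
by move=> x /cylinderP[y ->]; apply/cylinderP; rewrite word_cat_cat; eexists.
Qed.

Lemma cylinder_prefix w z x :
  cylinder w x -> cylinder z x -> prefix w z || prefix z w.
Proof.
move=> xw xz; wlog wz : w z xw xz / (size w <= size z)%N.
  move=> H; have [/H->//|/ltnW zw] := leqP (size w) (size z).
  by rewrite orbC H.
apply/orP; left; rewrite prefixE; apply/eqP.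
apply: (@eq_from_nth _ false); first by rewrite size_takel.
move=> i; rewrite size_takel// => iw.
by rewrite nth_take// -xw// -xz// (leq_trans iw).
Qed.

Lemma is_thompsonV1 : is_thompsonV 1%g.
Proof.
have P : @cylinder_partition 'I_1 (fun=> [::]).
  split; first by move=> i j _ _ _; rewrite [i]ord1 [j]ord1.
  by apply/seteqP; split => // x _; exists ord0.
by exists 1%N, (fun=> [::]), (fun=> [::]).
Qed.

Lemma is_thompsonVV g : is_thompsonV g -> is_thompsonV (g^-1)%g.
Proof.
move=> [n [w [z [Pw Pz E]]]]; exists n, z, w; split=> // i x.
by rewrite -E; exact: homeo_funK.
Qed.

Section Refine.
Variables (I J : Type) (h : cantor_space -> cantor_space).
Variables (u v : J -> seq bool) (w : I -> seq bool).
Hypotheses (Pu : cylinder_partition u) (Pw : cylinder_partition w).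
Hypothesis hE : forall j x, h (word_cat (u j) x) = word_cat (v j) x.

Definition refine_word (p : I * J) := u p.2 ++ drop (size (v p.2)) (w p.1).

Lemma refine_sub p x : prefix (v p.2) (w p.1) || prefix (w p.1) (v p.2) ->
  cylinder (refine_word p) x -> cylinder (u p.2) x /\ cylinder (w p.1) (h x).
Proof.
case: p => i j /= vw xr; split; first exact: cylinder_cat xr.
move: xr => /cylinderP[y]; rewrite /refine_word /= word_cat_cat => ->.
rewrite hE -word_cat_cat; case/orP: vw => /prefixP[t] ->.
  by rewrite drop_size_cat//; apply/cylinderP; eexists.
rewrite drop_oversize ?size_cat ?leq_addr// cats0.
by rewrite word_cat_cat; apply/cylinderP; eexists.
Qed.

Lemma refine_partition (K : Type) (f : K -> I * J) :
  injective f ->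
  (forall k, prefix (v (f k).2) (w (f k).1) || prefix (w (f k).1) (v (f k).2)) ->
  (forall p, prefix (v p.2) (w p.1) || prefix (w p.1) (v p.2) ->
    exists k, f k = p) ->
  cylinder_partition (fun k => refine_word (f k)).
Proof.
move=> fI fP fS; have [tu cu] := Pu; have [tw cw] := Pw; split.
  move=> k l _ _ [x [/(refine_sub (fP k))[xu xw] /(refine_sub (fP l))[xu' xw']]].
  apply: fI; rewrite [f k]surjective_pairing [f l]surjective_pairing.
  by congr pair; [apply: tw => //; exists (h x)|apply: tu => //; exists x].
rewrite -subTset => x _.
have : [set: cantor_space] x by []. rewrite -cu => -[j _ xu].
have : [set: cantor_space] (h x) by []. rewrite -cw => -[i _ xw].
move: (xu) => /cylinderP[y xE].
have xv : cylinder (v j) (h x) by apply/cylinderP; exists y; rewrite xE hE.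
have vw := cylinder_prefix xv xw.
have [k kE] := fS (i, j) vw; exists k => //; rewrite kE /refine_word /=.
apply/cylinderP; case/orP: vw => /prefixP[t tE].
  move: xw => /cylinderP[y']; rewrite xE hE tE word_cat_cat => /word_cat_inj->.
  by exists y'; rewrite drop_size_cat// word_cat_cat.
by exists y; rewrite tE drop_oversize ?cats0// size_cat leq_addr.
Qed.

End Refine.

Lemma is_thompsonVM g h :
  is_thompsonV g -> is_thompsonV h -> is_thompsonV (g * h)%g.
Proof.
move=> [n [w [z [Pw Pz gE]]]] [m [u [v [Pu Pv hE]]]].
pose P := [pred p : 'I_n * 'I_m |
  prefix (v p.2) (w p.1) || prefix (w p.1) (v p.2)].
pose f (k : 'I_#|P|) : 'I_n * 'I_m := enum_val k.
have fI : injective f by exact: enum_val_inj.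
have fP k : P (f k) := enum_valP k.
have fS p : P p -> exists k, f k = p.
  by move=> Pp; exists (enum_rank_in Pp p); rewrite /f enum_rankK_in.
exists #|P|, (fun k => refine_word u v w (f k)).
exists (fun k => refine_word z w v ((f k).2, (f k).1)); split.
- exact: (refine_partition Pu Pw hE).
- have g'E i x : (g^-1)%g (word_cat (z i) x) = word_cat (w i) x.
    by rewrite -gE; exact: homeo_funK.
  apply: (refine_partition Pz Pv g'E (f := fun k => ((f k).2, (f k).1))).
  + move=> k l [e2 e1]; apply: fI.
    by rewrite [f k]surjective_pairing e1 e2 -surjective_pairing.
  + by move=> k; rewrite orbC; exact: fP.
  + move=> [j i]; rewrite orbC => ij; have [k kE] := fS (i, j) ij.
    by exists k; rewrite kE.
- move=> k x; rewrite homeoME; have := fP k; case: (f k) => i j /=.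
  rewrite /refine_word /= word_cat_cat hE -word_cat_cat.
  move=> /orP[] /prefixP[t tE]; rewrite tE.
    rewrite drop_size_cat// -tE gE drop_oversize ?cats0//.
    by rewrite tE size_cat leq_addr.
  rewrite drop_size_cat// drop_oversize ?cats0 ?size_cat ?leq_addr//.
  by rewrite !word_cat_cat gE.
Qed.

Fact thompsonV_closed : group_closed thompsonV_pred.
Proof.
split; first exact/asboolP/is_thompsonV1.
move=> g h /asboolP gT /asboolP hT; apply/asboolP.
exact/is_thompsonVM/is_thompsonVV.
Qed.

Record thompsonV := ThompsonV {
  thompsonV_val :> homeo cantor_space;
  _ : thompsonV_val \in thompsonV_pred
}.

HB.instance Definition _ := [isSub for thompsonV_val].
HB.instance Definition _ := [Choice of thompsonV by <:].
HB.instance Definition _ :=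
  SubChoice_isSubGroup.Build (homeo cantor_space) thompsonV_pred thompsonV
    thompsonV_closed.

Definition cantor_action : action thompsonV cantor_space :=
  @Action thompsonV cantor_space (fun g : thompsonV => thompsonV_val g)
    (fun=> erefl) (fun _ _ _ => erefl)
    (fun g : thompsonV => @homeo_continuous _ (thompsonV_val g)).

(* Main.v *)
Require Import Defs.
From mathcomp Require Import all_boot all_order all_algebra.
From mathcomp Require Import all_classical all_reals all_analysis.
From mathcomp Require Import zify ring lra.

(** Each of the three groups acts on a space [Z] -- the circle, or the Cantor set -- so that
small open sets, called cells below, see a lot of the group: in every cell some element
supported there pushes a smaller cell off itself by all its powers, and finitely many points
can be carried into any cell (for F, provided the point 0 is not one of them). This is
enough for the main step, [nonfree_fixes_commutators]: if the group acts minimally on a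
compact space [X] and the action is not topologically free, then some point of [X] is fixed
by all commutators of elements supported in some cell.

To see this, cover [X] by the interiors of the fixed-point sets of finitely many conjugates
[p] of one nontrivial element. Two recurrence arguments follow. First, place disjoint cells
[W p] whose images under the [p] are disjoint too, and choose commuting elements of infinite
order supported in the [W p] and the [p (W p)]. A uniformly recurrent point for the group of
elements commuting with all of them comes back to one of the fixed-point sets at a bounded
delay; colouring pairs of exponents by the delay and taking a monochromatic rectangle shows
that a nontrivial commutator supported in [p (W p)] fixes a point, and by density any
prescribed point of [X] is fixed by such an element ([local_stabilizers]). Second, use
recurrence for the group of elements that act separately on each of finitely many cells: a
return to the fixed-point set of [p] forces an element to normalize the stabilizer of the
recurrent point inside the rigid stabilizer of the cell of [p], and boundedness of the delay
makes this normalizer of finite index ([stabilized_commutators]). A double commutator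
computation shows that a nontrivial subgroup with a finite index normalizer contains all
commutators supported in a smaller cell ([finite_index_commutators]).

For F, all cells are equivalent and directed, so by compactness one point is fixed by the
commutators of every cell; the set of such points is closed and invariant, hence is [X],
and the action is not faithful ([minimal_faithful_free]).

For T and V, the complements of the neighbourhoods of a base point of [Z] can be compressed
into any cell. Attach to a point [x] of [X] those points [z] of [Z] such that, for every
neighbourhood of [z], the commutators of elements trivial on it fix [x]. Compactness and
minimality attach to every [x] at least one [z]. If some [x] had two, then commutators of
elements trivial on any common nonempty open set would fix [x], hence all of [X] by
minimality; these commutators generate the whole group, so the action would be trivial.
Thus attachment is an equivariant map, continuous because its graph is closed
([free_or_factors]).

It remains to know that T and V are generated by such commutators. V is generated by the
exchanges of two disjoint cylinders, which are commutators ([thompsonV_perfect]). An element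
of T is a product of elements fixing an arc, hence of conjugates of elements supported in a
small interval, which are described by pairs of finite binary trees. Tree rotations all
agree modulo the normal subgroup in question, so that the pentagon relation
[x ^ 2 = x ^ 3] kills them, and rotations bring any tree to a normal form
([thompsonT_perfect]). *)

Set Implicit Arguments.
Unset Strict Implicit.
Unset Printing Implicit Defensive.

Import Order.TTheory GRing.Theory Num.Theory.
Import numFieldNormedType.Exports.

Local Open Scope classical_set_scope.

(** * Compactness, minimality and recurrence *)

Section Compactness.
Variable T : topologicalType.

Lemma compact_directed (I : Type) (D : set I) (F : I -> set T) :
  compact [set: T] -> D !=set0 ->
  (forall i, D i -> closed (F i)) -> (forall i, D i -> F i !=set0) ->
  (forall i j, D i -> D j -> exists2 k, D k & F k `<=` F i `&` F j) ->
  exists x, forall i, D i -> F i x.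
Proof.
move=> cT [i0 Di0] clF F0 dirF.
have PF : ProperFilter (filter_from D F).
  apply: filter_from_proper => //.
  by apply: filter_from_filter; [exists i0 | exact: dirF].
have [|x [_ clx]] := cT _ PF; first by exists i0.
exists x => i Di; apply: (clF i Di) => U Ux.
by apply: clx => //; exists i.
Qed.

(** The subcover is returned as a sequence with a length, because the index type has no
decidable structure and only a bound on indices matters for counting arguments. *)
Lemma compact_finite_cover (K : set T) (I : Type) (U : I -> set T) :
  compact K -> K !=set0 ->
  (forall i, open (U i)) -> (forall x, K x -> exists i, U i x) ->
  exists n (s : nat -> I), forall x, K x -> exists2 k, (k < n)%N & U (s k) x.
Proof.
move=> cK [x0 Kx0] oU cov; apply: contrapT => H.
have [i0 _] := cov x0 Kx0.
pose F (s : nat * (nat -> I)) :=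
  [set x | K x /\ forall k, (k < s.1)%N -> ~ U (s.2 k) x].
have PF : ProperFilter (filter_from setT F).
  apply: filter_from_proper; last first.
    move=> [n s] _; apply: contrapT => F0; apply: H; exists n, s => x Kx.
    apply: contrapT => nU; apply: F0; exists x; split=> // k kn Uk.
    by apply: nU; exists k.
  apply: filter_from_filter; first by exists (0%N, fun=> i0).
  move=> [m s] [n t] _ _.
  exists (m + n, fun k => if (k < m)%N then s k else t (k - m))%N => //.
  move=> x [Kx nU]; split; split=> //= k km.
    by have := nU k; rewrite /= ltn_addr// km => /(_ isT).
  have := nU (m + k)%N; rewrite /= ltn_add2l [(m + k < m)%N]ltnNge leq_addr /= addKn.
  by move=> nt; exact: nt.
have [|x [Kx clx]] := cK _ PF; first by exists (0%N, fun=> i0) => // x [].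
have [i Ui] := cov x Kx.
have [||y [[_ nU] Uy]] := clx (F (1%N, fun=> i)) (U i).
- by exists (1%N, fun=> i).
- by apply: open_nbhs_nbhs; split.
- exact: (nU 0%N) Uy.
Qed.

Lemma near_seq (I : eqType) (S : seq I) (P : I -> T -> Prop) (z : T) :
  (forall i, i \in S -> \forall w \near z, P i w) ->
  \forall w \near z, forall i, i \in S -> P i w.
Proof.
elim: S => [|j S IH] H; first exact: nearW.
have Hj := H j (mem_head _ _).
have HS : \forall w \near z, forall i, i \in S -> P i w.
  by apply: IH => i iS; apply: H; rewrite inE iS orbT.
near=> w => i; rewrite inE => /predU1P[->|]; [near: w|move: i; near: w].
  exact: Hj.
exact: HS.
Unshelve. all: by end_near. Qed.

End Compactness.

Section Action.
Variables (G : groupType) (X : topologicalType) (a : action G X).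
Local Open Scope group_scope.
Implicit Types (g h : G) (x y : X) (U : set X).

Lemma actK g : cancel (a g) (a g^-1).
Proof. by move=> x; rewrite -actM mulVg act1. Qed.

Lemma actVK g : cancel (a g^-1) (a g).
Proof. by move=> x; rewrite -actM mulgV act1. Qed.

Lemma act_inj g : injective (a g). Proof. exact: can_inj (actK g). Qed.

Lemma actV_fix g x : a g x = x -> a g^-1 x = x.
Proof. by move=> gx; rewrite -{1}gx actK. Qed.

Lemma actJ_fix g h x : a (g ^ h) x = x <-> a g (a h x) = a h x.
Proof.
rewrite conjgE 2!actM; split=> [/(congr1 (a h))|->]; first by rewrite actVK.
by rewrite actK.
Qed.

Lemma actX_fix g x n : a g x = x -> a (g ^+ n) x = x.
Proof. by move=> gx; elim: n => [|n IH]; rewrite ?act1// expgS actM IH. Qed.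

Lemma act_open g U : open U -> open (a g @^-1` U).
Proof. by move=> oU; apply: open_comp oU => x _; exact: act_continuous. Qed.

Lemma minimal_closed U : minimal a -> closed U -> U !=set0 ->
  (forall g x, U x -> U (a g x)) -> forall x, U x.
Proof.
move=> am cU [x0 Ux0] inv x; apply: contrapT => nUx.
have [|x1 [nU [g _ gx0]]] := am x0 (~` U) _ (closed_openC cU).
  by exists x.
by apply: nU; rewrite -gx0; exact: inv.
Qed.

Lemma fixpoints_closed g : hausdorff_space X -> closed (fixpoints a g).
Proof.
move=> hX x clx; apply: contrapT => /eqP gx.
move: hX; rewrite open_hausdorff => /(_ _ _ gx).
move=> [[A B] /= [Ax Bx] [oA oB /eqP/seteqP[AB _]]].
have [|y [gy [Ay By]]] := clx ((a g @^-1` A) `&` B).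
  apply: open_nbhs_nbhs; split; first exact/openI/oB/act_open.
  by move: Ax Bx; rewrite !inE.
by apply: (AB y); split => //; move: Ay; rewrite /preimage /= gy.
Qed.

End Action.

Section UniformRecurrence.
Variables (G : groupType) (X : topologicalType) (a : action G X).
Variable L : set G.
Local Open Scope group_scope.
Hypotheses (L1 : L 1) (LM : forall g h, L g -> L h -> L (g * h)).
Hypothesis cX : compact [set: X].

Definition closed_invariant (M : set X) :=
  [/\ closed M, M !=set0 & forall g, L g -> forall x, M x -> M (a g x)].

(** Zorn's lemma for inclusion; the intersection of a chain is nonempty by compactness. *)
Lemma minimal_subset (Y : set X) : closed_invariant Y ->
  exists M, [/\ closed_invariant M, M `<=` Y &
    forall N, closed_invariant N -> N `<=` M -> N = M].
Proof.
move=> Yinv.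
pose P := {M | closed_invariant M /\ M `<=` Y}.
pose R (M N : P) := `[< sval N `<=` sval M >].
have [||||[M [Minv MY]] Mmin] := @Zorn P R.
- by move=> M; exact/asboolP.
- by move=> M N K /asboolP NM /asboolP KN; apply/asboolP; exact: subset_trans NM.
- move=> [M PM] [N PN] /asboolP /= NM /asboolP /= MN.
  by apply: eq_exist; exact/seteqP.
- move=> A totA; have [A0|/set0P/negP] := pselect (A !=set0); last first.
    rewrite negbK => /eqP ->; have YY : Y `<=` Y by [].
    by exists (exist _ Y (conj Yinv YY)).
  have [x Ax] : exists x, forall M, A M -> sval M x.
    apply: compact_directed => //.
    + by move=> [M [[]]].
    + by move=> [M [[]]].
    + move=> M N AM AN; have [/asboolP NM|/asboolP MN] := totA _ _ AM AN.
        by exists N => // x Nx; split => //; exact: NM.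
      by exists M => // x Mx; split => //; exact: MN.
  pose B := [set x | forall M, A M -> sval M x].
  have PB : closed_invariant B /\ B `<=` Y.
    split; last by move=> z Bz; have [M AM] := A0; exact: (proj2 (svalP M) z (Bz M AM)).
    split; [|by exists x|].
    + rewrite (_ : B = \bigcap_(M in A) sval M) //.
      by apply: closed_bigI => -[M [[]]].
    + move=> g Lg z Bz M AM; have [[_ _ Minv] _] := svalP M.
      exact/Minv/Bz.
  by exists (exist _ B PB) => M AM; apply/asboolP => z Bz; exact: Bz.
exists M; split=> // N Ninv NM.
have NY := subset_trans NM MY.
by have /(_ _)/(congr1 sval) := Mmin (exist _ N (conj Ninv NY)); apply; apply/asboolP.
Qed.

(** Take [y] in a minimal closed [L]-invariant subset of the orbit closure of [x]. The
translates of [U i] by [L] cover this compact set, so finitely many elements of [L] bring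
every point of the orbit of [y] back to [U i]. *)
Lemma uniform_recurrence (I : Type) (U : I -> set X) (x : X) :
  (forall i, open (U i)) -> (forall y, exists i, U i y) ->
  exists i y, [/\ U i y, closure [set a g x | g in L] y &
    exists n (c : nat -> G), (forall k, L (c k)) /\
      forall g, L g -> exists2 k, (k < n)%N & U i (a (c k) (a g y))].
Proof.
move=> oU cov.
pose Y z := closure [set a g z | g in L].
have Yinv z : closed_invariant (Y z).
  split; [exact: closed_closure| |].
  - by exists z; apply: subset_closure; exists 1; rewrite ?act1.
  move=> g Lg y Yy U' /= gyU.
  have [|_ [[h Lh <-] Ug]] := Yy (a g @^-1` U').
    exact: (act_continuous (a := a)) gyU.
  by exists (a g (a h z)); split => //; exists (g * h); rewrite ?actM//; exact: LM.
have [M [[cM [y My] Minv] MY Mmin]] := minimal_subset (Yinv x).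
have [i Uy] := cov y; exists i, y; split => //; first exact: MY.
have cptM : compact M by exact: subclosed_compact cX _.
have [||n [s Hs]] := @compact_finite_cover X M {g | L g}
    (fun g => a (sval g) @^-1` U i) cptM (ex_intro _ y My).
- by move=> g; exact: act_open.
- move=> z Mz; have YM : Y z = M.
    apply: Mmin; first exact: Yinv.
    rewrite [X in _ `<=` X](proj1 (closure_id M) cM).
    by apply: closure_subset => _ [g Lg <-]; exact: Minv.
  have : Y z y by rewrite YM.
  move=> /(_ (U i))[|_ [[g Lg <-] Ug]]; first exact: open_nbhs_nbhs.
  by exists (exist _ g Lg).
exists n, (fun k => sval (s k)); split; first by move=> k; case: (s k).
by move=> g Lg; apply: Hs; exact: Minv.
Qed.

End UniformRecurrence.

(** * Rigid stabilizers and cells *)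

Section RigidStabilizers.
Variables (G : groupType) (Z : topologicalType) (b : action G Z).
Local Open Scope group_scope.
Implicit Types (g h : G) (z : Z) (I J : set Z).

Definition rist I : set G := [set g | forall z, ~ I z -> b g z = z].

Lemma rist1 I : rist I 1. Proof. by move=> z _; rewrite act1. Qed.

Lemma ristM I g h : rist I g -> rist I h -> rist I (g * h).
Proof. by move=> gI hI z Iz; rewrite actM hI ?gI. Qed.

Lemma ristV I g : rist I g -> rist I g^-1.
Proof. by move=> gI z Iz; apply: actV_fix; exact: gI. Qed.

Lemma ristX I g n : rist I g -> rist I (g ^+ n).
Proof. by move=> gI z Iz; apply: actX_fix; exact: gI. Qed.

Lemma rist_sub I J : I `<=` J -> rist I `<=` rist J.
Proof. by move=> IJ g gI z Jz; apply: gI => /IJ. Qed.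

Lemma ristJ I J g h :
  rist J g -> (forall z, J (b h z) -> I z) -> rist I (g ^ h).
Proof. by move=> gJ JI z Iz; apply/actJ_fix/gJ => /JI. Qed.

Lemma rist_conj I g h : rist I g -> rist I h -> rist I (g ^ h).
Proof. by move=> gI hI; rewrite conjgE; do 2?apply: ristM; try exact: ristV. Qed.

Lemma rist_commg I g h : rist I g -> rist I h -> rist I [~ g, h].
Proof. by move=> gI hI; apply: ristM; [exact: ristV|exact: rist_conj]. Qed.

Lemma rist_stable I g z : rist I g -> I z -> I (b g z).
Proof.
move=> gI Iz; apply: contrapT => nI; have := gI _ nI => /(act_inj (a := b)) e.
by rewrite e in nI.
Qed.

Hypothesis faithb : faithful b.

Lemma faithful_inj g h : (forall z, b g z = b h z) -> g = h.
Proof.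
move=> e; apply/eqP; rewrite -divg_eq1; apply/eqP/faithb => z.
by rewrite actM e actVK.
Qed.

Lemma rist_commute I J g h : rist I g -> rist J h ->
  (forall z, I z -> J z -> False) -> commute g h.
Proof.
move=> gI hJ IJ; apply: faithful_inj => z; rewrite !actM.
have [Iz|nIz] := pselect (I z).
  rewrite (hJ z); last exact: IJ.
  by rewrite hJ//; apply: IJ; exact: rist_stable.
rewrite (gI z)//; have [Jz|nJz] := pselect (J z); last by rewrite hJ ?gI.
by rewrite gI// => /IJ; apply; exact: rist_stable.
Qed.

Lemma moves_point g : g <> 1 -> exists z, b g z <> z.
Proof.
by move=> g1; apply: contrapT => /forallNP H; apply/g1/faithb => z; exact: contrapT.
Qed.

End RigidStabilizers.

(** The small open sets on which the group acts richly. All of them live in an invariant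
domain, which is the whole space for T and V and the complement of the global fixed point
for F. The last field provides elements of infinite order, in a form that also makes the
translates of a cell pairwise disjoint. *)
Record cell_system (G : groupType) (Z : topologicalType) (b : action G Z)
    (D : set Z) (cell : set (set Z)) : Prop := CellSystem {
  cell_open : forall B, cell B -> open B;
  cell_sub : forall B, cell B -> B `<=` D;
  cell_neq0 : forall B, cell B -> B !=set0;
  cell_base : forall U, open U -> U !=set0 -> exists2 B, cell B & B `<=` U;
  cell_domain : forall g z, D z -> D (b g z);
  cell_shift : forall J, cell J -> exists u I, [/\ rist b J u, cell I, I `<=` J &
    forall n z, I z -> ~ I (b (u ^+ n.+1)%g z)]
}.

Definition squeezing (G : groupType) (Z : topologicalType) (b : action G Z)
    (D : set Z) (cell : set (set Z)) :=
  forall (S : seq Z) W, cell W -> (forall z, z \in S -> D z) ->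
    exists g, forall z, z \in S -> W (b g z).

Lemma pigeonhole_ord (T : finType) (f : 'I_#|T|.+1 -> T) :
  exists i j : 'I_#|T|.+1, (i < j)%N /\ f i = f j.
Proof.
have : ~~ injectiveb f by apply/injectiveP => /leq_card; rewrite card_ord ltnn.
move=> /injectivePn[i [j ij e]]; wlog lt : i j ij e / (i < j)%N.
  move=> H; case: (ltngtP i j) => [|lt|/val_inj eij]; first exact: H.
    by apply: (H j i) => //; rewrite eq_sym.
  by rewrite eij eqxx in ij.
by exists i, j.
Qed.

Lemma infinite_pigeonhole (T : finType) (f : nat -> T) :
  exists m n, (m < n)%N /\ f m = f n.
Proof. by have [i [j ?]] := pigeonhole_ord (fun i : 'I_#|T|.+1 => f i); exists i, j. Qed.

(** Two rows of the array that coincide on the first columns, then two such columns of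
one of these rows that carry the same colour. *)
Lemma monochromatic_rectangle (T : finType) (f : nat -> nat -> T) :
  exists m m' n n', [/\ (m < m')%N, (n < n')%N &
    [/\ f m n' = f m n, f m' n = f m n & f m' n' = f m n]].
Proof.
pose row m := [ffun n : 'I_#|T|.+1 => f m n].
have [m [m' [mm' rowE]]] := infinite_pigeonhole row.
have E (n : 'I_#|T|.+1) : f m' n = f m n.
  by have := congr1 (fun r : {ffun _} => r n) rowE; rewrite !ffunE.
have [i [j [ij e]]] := pigeonhole_ord (fun i : 'I_#|T|.+1 => f m i).
by exists m, m', i, j; split=> //; split; rewrite ?E.
Qed.

(** * Placing points and cells in general position *)

Section CellAvoidance.
Variables (G : groupType) (Z : topologicalType) (b : action G Z).
Variables (D : set Z) (cell : set (set Z)).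
Local Open Scope group_scope.
Hypotheses (faithb : faithful b) (hZ : hausdorff_space Z).
Hypothesis B : cell_system b D cell.

Lemma hausdorff_separate (s t : Z) : s <> t -> exists U V,
  [/\ open U, open V, U s, V t & forall z, U z -> V z -> False].
Proof.
move=> /eqP st; have := hZ; rewrite open_hausdorff => /(_ _ _ st).
move=> [[U V] /= [Us Vt] [oU oV /eqP/seteqP[UV _]]]; exists U, V.
by rewrite !inE in Us Vt; split=> // z Uz Vz; apply: (UV z).
Qed.

(** A point of [S] can be avoided by moving a subcell off itself, since it then misses the
subcell or its image. *)
Lemma cell_avoid J (S : seq Z) : cell J -> exists2 z, J z & z \notin S.
Proof.
move=> bJ; suff [J' bJ' [sub avoid]] : exists2 J', cell J' &
    J' `<=` J /\ forall s, s \in S -> ~ J' s.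
  have [z J'z] := cell_neq0 B bJ'; exists z; first exact: sub.
  by apply/negP => /avoid.
elim: S => [|s S [J' bJ' [sub avoid]]]; first by exists J => //; split.
have [u [I [uJ bI IJ sh]]] := cell_shift B bJ'.
have [Is|nIs] := pselect (I s); last first.
  exists I => //; split; first exact: subset_trans sub.
  by move=> t; rewrite inE => /orP[/eqP->//|/avoid nt It]; exact/nt/IJ.
have [z Iz] := cell_neq0 B bI.
have [||J'' bJ'' sub''] := cell_base B (U := b u^-1 @^-1` I).
- exact: (act_open b _ (cell_open B bI)).
- by exists (b u z); rewrite /preimage /= actK.
have J''J' : J'' `<=` J'.
  move=> t /sub'' /= It; rewrite -(actVK b u t).
  exact/(rist_stable uJ)/IJ.
exists J'' => //; split; first exact: subset_trans sub.
move=> t; rewrite inE => /orP[/eqP-> /sub'' /= Iu|/avoid nt /J''J'//].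
by apply: (sh 0%N _ Iu); rewrite expg1 actVK.
Qed.

Lemma moved_cell g U : open U -> (exists2 z, U z & b g z <> z) ->
  exists2 J, cell J & J `<=` U /\ forall z, J z -> ~ J (b g z).
Proof.
move=> oU [z Uz gz]; have [V [W [oV oW Vz Wgz VW]]] := hausdorff_separate (nesym gz).
have [||J bJ sub] := cell_base B (U := U `&` V `&` b g @^-1` W).
- by apply: openI; [exact: openI | exact: act_open].
- by exists z.
exists J => //; split; first by move=> t /sub[[]].
by move=> t /sub[_ Wt] /sub[[_ Vt] _]; exact: VW Wt.
Qed.

(** One point [z p] for each element of the list, chosen one after the other: each is moved
by its own element and avoids the finitely many translates of the previous ones. *)
Lemma separated_points (z0 : Z) (P Q : seq G) : (forall p, p \in P -> p <> 1) ->
  exists z : G -> Z, forall p, p \in P ->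
    [/\ D (z p), b p (z p) <> z p & forall p', p' \in P -> p <> p' ->
      forall q q', q \in Q -> q' \in Q -> b q (z p) <> b q' (z p')].
Proof.
elim: P => [|r P IH] P1; first by exists (fun=> z0).
have [p pP|z zP] := IH; first by apply: P1; rewrite inE pP orbT.
have [rP|rP] := boolP (r \in P).
  have memr p : (p \in r :: P) = (p \in P) by rewrite inE; case: eqP => [->|].
  exists z => p; rewrite memr => pP; have [zD zm zd] := zP p pP.
  by split=> // p'; rewrite memr; exact: zd.
have [||J bJ Jm] := cell_base B (U := ~` fixpoints b r).
- exact/closed_openC/fixpoints_closed.
- by apply: (moves_point faithb); apply: P1; rewrite inE eqxx.
pose T := [seq (y, p) | y <- [seq (q, q') | q <- Q, q' <- Q], p <- P].
have [w Jw wS] :=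
  cell_avoid [seq b x.1.1^-1 (b x.1.2 (z x.2)) | x <- T] bJ.
have wE p q q' : p \in P -> q \in Q -> q' \in Q -> b q w <> b q' (z p).
  move=> pP qQ q'Q e; move/negP: wS; apply; rewrite -(actK b q w) e.
  by apply: (map_f (fun x => b x.1.1^-1 (b x.1.2 (z x.2))) (x := ((q, q'), p)));
    rewrite !allpairs_f.
exists (fun p => if p == r then w else z p) => p; rewrite inE => /predU1P[->|pP].
  rewrite eqxx; split; [exact: (cell_sub B bJ)|exact: Jm|].
  move=> p'; rewrite inE => /predU1P[->//|p'P _ q q' qQ q'Q].
  by case: eqP p'P rP => [-> ->|_ p'P _] //; exact: wE.
have pr : p <> r by move=> e; move: pP rP; rewrite e => ->.
rewrite (introF eqP pr); have [zD zm zd] := zP p pP; split=> //.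
move=> p'; rewrite inE => /predU1P[->|p'P] pp' q q' qQ q'Q.
  by rewrite eqxx => /esym; exact: wE.
by case: eqP p'P rP => [-> ->|_ p'P _] //; exact: zd.
Qed.

Lemma separated_nbhds (P Q : seq G) (z : G -> Z) :
  exists O : G -> set Z, [/\ forall p, open (O p), forall p, O p (z p) &
    forall p p' q q', p \in P -> p' \in P -> q \in Q -> q' \in Q ->
      b q (z p) <> b q' (z p') ->
      forall w w', O p w -> O p' w' -> b q w <> b q' w'].
Proof.
have sepE (st : Z * Z) : exists UV : set Z * set Z, st.1 <> st.2 ->
    [/\ open UV.1, open UV.2, UV.1 st.1, UV.2 st.2 &
      forall z, UV.1 z -> UV.2 z -> False].
  have [e|ne] := pselect (st.1 = st.2); first by exists (set0, set0).
  by have [U [V UV]] := hausdorff_separate ne; exists (U, V).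
have [sep sepP] := choice sepE.
pose N p := [set w | forall p', p' \in P -> forall q, q \in Q ->
  forall q', q' \in Q -> b q (z p) <> b q' (z p') ->
    (sep (b q (z p), b q' (z p'))).1 (b q w) /\
    (sep (b q' (z p'), b q (z p))).2 (b q w)].
exists (fun p => (N p)°); split.
- by move=> p; exact: open_interior.
- move=> p; apply: near_seq => p' p'P; apply: near_seq => q qQ.
  apply: near_seq => q' q'Q.
  have [e|ne] := pselect (b q (z p) = b q' (z p')); first exact: nearW.
  have [/= o1 _ h1 _ _] := sepP (b q (z p), b q' (z p')) ne.
  have [/= _ o2 _ h2 _] := sepP (b q' (z p'), b q (z p)) (nesym ne).
  have : nbhs (z p) (b q @^-1` (sep (b q (z p), b q' (z p'))).1
      `&` b q @^-1` (sep (b q' (z p'), b q (z p))).2).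
    by apply: open_nbhs_nbhs; split => //; apply: openI; exact: act_open.
  by apply: filterS => w [].
- move=> p p' q q' pP p'P qQ q'Q ne w w' /interior_subset Nw /interior_subset Nw' e.
  have [s1 _] := Nw _ p'P _ qQ _ q'Q ne.
  have [_ s2] := Nw' _ pP _ q'Q _ qQ (nesym ne).
  have [/= _ _ _ _] := sepP (b q (z p), b q' (z p')) ne.
  by move=> /(_ _ s1); rewrite e; exact.
Qed.

End CellAvoidance.

(** * Stabilizers normalized by a finite index subgroup *)

Section CommutatorLemma.
Variables (G : groupType) (Z : topologicalType) (b : action G Z).
Variables (D : set Z) (cell : set (set Z)).
Local Open Scope group_scope.
Hypotheses (faithb : faithful b) (hZ : hausdorff_space Z).
Hypothesis B : cell_system b D cell.

(** Perturbing the entries of a commutator by elements with disjoint supports. *)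
Lemma commg_disjoint (g h g' h' : G) :
  commute g' g -> commute g' h -> commute g' h' -> commute h' g -> commute h' h ->
  [~ g * g', h * h'] = [~ g, h].
Proof.
move=> g'g g'h g'h' h'g h'h.
have fixJ (x y : G) : commute x y -> x ^ y = x.
  by move=> xy; rewrite conjgE xy mulKg.
have ghh' : commute h' (g ^ h).
  by rewrite conjgE; apply: commuteM; [exact: commuteV|exact: commuteM].
have gh' : commute g' [~ g, h].
  rewrite /commg conjgE.
  by do ![apply: commuteM|apply: commuteV].
rewrite [LHS]commgEl conjMg conjgM conjgM.
rewrite (fixJ (g ^ h) h'); last exact/commute_sym.
rewrite (fixJ g' h) // (fixJ g' h') // invgM mulgA -(mulgA g'^-1).
rewrite -commgEl -mulgA -[_ * g'](gh') mulKg //.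
Qed.

Lemma finite_index_power (n : nat) (e : nat -> G) (K : set G) (u : nat -> G) :
  (forall g h, K g -> K h -> K (g^-1 * h)) ->
  (forall j, exists2 k, (k < n)%N & K (e k * u j)) ->
  exists j j', (j < j')%N /\ K ((u j)^-1 * u j').
Proof.
move=> Kd fin.
have [f fP] := choice (fun j => match fin j with
  ex_intro2 k kn Kk => ex_intro (fun k : 'I_n => K (e k * u j)) (Ordinal kn) Kk end).
have [j [j' [jj' ff]]] := infinite_pigeonhole f; exists j, j'; split=> //.
have := Kd _ _ (fP j) (fP j'); rewrite -ff invgM -mulgA mulKg; exact.
Qed.

(** Let [K] normalize [N] and have finite index in the rigid stabilizer of [W], and let [q] be
a nontrivial element of [N]. If [J] is a cell that [q] moves off itself, the commutator of
[g] and [h] in [K], both supported in [J], equals that of [r^-1] and [h], where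
[r = g ^ q^-1 * g^-1] is in [N], because [g ^ q^-1] lives off [J]; hence it is in [N]. To
reach elements outside [K], multiply them by conjugates of their inverses under powers of a
shift of [J]: for suitable powers the products are in [K], and the added factors have
disjoint supports, so the commutator does not change. *)
Lemma finite_index_commutators (W : set Z) (N K : set G) (q : G) n (e : nat -> G) :
  cell W -> (forall g h, N g -> N h -> N (g * h)) ->
  (forall g, N g -> N g^-1) -> N q -> q <> 1 -> rist b W q ->
  K `<=` rist b W -> (forall g h, K g -> K h -> K (g^-1 * h)) ->
  (forall g h, N g -> K h -> N (g ^ h)) ->
  (forall g, rist b W g -> exists2 k, (k < n)%N & K (e k * g)) ->
  exists2 I, cell I & forall g h, rist b I g -> rist b I h -> N [~ g, h].
Proof.
move=> cW NM NV Nq q1 qW KW Kd NJ fin.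
have [k0 _ Kk0] := fin 1 (@rist1 _ _ b W).
have K1 : K 1 by rewrite -(mulVg (e k0 * 1)); exact: Kd.
have KV g : K g -> K g^-1 by move=> Kg; rewrite -[g^-1]mulg1; exact: Kd.
have KM g h : K g -> K h -> K (g * h).
  by move=> Kg Kh; rewrite -[g]invgK; apply: Kd => //; exact: KV.
have KX g m : K g -> K (g ^+ m).
  by move=> Kg; elim: m => [|m IH]; rewrite ?expg0// expgS; exact: KM.
have [z qz] := moves_point faithb q1.
have Wz : W z by apply: contrapT => nWz; exact: (qz (qW z nWz)).
have [J cJ [JW qJ]] := moved_cell hZ B (cell_open B cW) (ex_intro2 _ _ z Wz qz).
(* the double commutator; the factor supported off [J] cancels *)
have comN g h : K g -> rist b J g -> K h -> rist b J h -> N [~ g, h].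
  move=> Kg gJ Kh hJ.
  have g'com x : rist b J x -> commute (g ^ q^-1) x.
    move=> xJ; apply: (@rist_commute _ _ _ faithb (b q^-1 @^-1` J) J) => //.
      by apply: ristJ gJ _.
    by move=> w /qJ; rewrite actVK.
  have Nr : N (g ^ q^-1 * g^-1).
    have -> : g ^ q^-1 * g^-1 = q * (q^-1 ^ g^-1) by rewrite !conjgE !invgK !mulgA.
    by apply: NM => //; apply: NJ; [exact: NV|exact: KV].
  have := NM _ _ Nr (NJ _ _ (NV _ Nr) Kh).
  rewrite invgM invgK conjMg.
  have -> : (g ^ q^-1)^-1 ^ h = (g ^ q^-1)^-1.
    rewrite conjVg; congr (_^-1); rewrite conjgE g'com ?mulKg//.
  rewrite mulgA -(mulgA (g ^ q^-1)) -[g^-1 * _]commgEl.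
  have -> : g ^ q^-1 * [~ g, h] = [~ g, h] * g ^ q^-1.
    by apply: g'com; exact: rist_commg.
  by rewrite mulgK.
have [u [I [uJ cI IJ sh]]] := cell_shift B cJ.
have [r r0 Kv] : exists2 r, (0 < r)%N & K (u ^+ r).
  have [|j [j' [jj' Kj]]] := @finite_index_power n e K (fun j => u ^+ j) Kd.
    by move=> j; apply: fin; apply: ristX; exact: rist_sub uJ.
  exists (j' - j)%N; rewrite ?subn_gt0//.
  move: Kj; rewrite -{1}(subnK (ltnW jj')) addnC expgnDr mulKg; exact.
pose v := u ^+ r.
have vJ : rist b J v by exact: ristX.
have vsh t w : (0 < t)%N -> I w -> ~ I (b (v ^+ t) w).
  move=> t0; rewrite /v -expgnA; have := muln_gt0 r t; rewrite r0 t0.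
  by case: (r * t)%N => // m _; exact: sh.
have riJ : rist b I `<=` rist b J by exact: rist_sub.
pose cj t x := x ^ (v ^- t).
have cjJ t x : rist b I x -> rist b J (cj t x).
  by move=> /riJ xJ; apply: rist_conj => //; apply/ristV/ristX.
have cjcom s t x y : (s < t)%N -> rist b I x -> rist b I y ->
    commute (cj s x) (cj t y).
  move=> st xI yI.
  apply: (@rist_commute _ _ _ faithb (b (v ^- s) @^-1` I) (b (v ^- t) @^-1` I)).
  - by apply: ristJ xI _.
  - by apply: ristJ yI _.
  - move=> w /= Is It; apply: (vsh (t - s)%N _ _ It); rewrite ?subn_gt0//.
    rewrite -actM (_ : _ * _ = v ^- s)//.
    by rewrite -{2}(subnK (ltnW st)) addnC expgnDr invgM mulVKg.
(* exponents divisible by [s.+1] force the new exponent to exceed [s] *)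
have twist s x : rist b I x -> exists t, (s < t)%N /\ K (x^-1 * cj t x).
  move=> xI.
  have [|j [j' [jj' Kj]]] :=
    @finite_index_power n e K (fun j => cj (s.+1 * j)%N x) Kd.
    by move=> j; apply: fin; apply: rist_sub JW _ _; exact: cjJ.
  exists (s.+1 * (j' - j))%N; split.
    by rewrite leq_pmulr ?subn_gt0.
  have := KM _ _ (KV _ (KX _ (s.+1 * j)%N Kv)) (KM _ _ Kj (KX _ (s.+1 * j)%N Kv)).
  rewrite -/v -conjgE conjMg conjVg /cj -!conjgM mulVg conjg1.
  rewrite (_ : v ^- _ * _ = v ^- (s.+1 * (j' - j)))//.
  rewrite -{1}(subnK (ltnW jj')) mulnDr addnC expgnDr invgM mulgVK //.
exists I => // g h gI hI.
have [s [s0 Ks]] := twist 0%N _ (ristV gI).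
have [t [st Kt]] := twist s _ (ristV hI).
rewrite !invgK in Ks Kt.
have cj0 x : cj 0%N x = x by rewrite /cj expg0 invg1 conjg1.
have cj0com m x y : (0 < m)%N -> rist b I x -> rist b I y -> commute (cj m x) y.
  by move=> m0 xI yI; apply: commute_sym; rewrite -[y]cj0; exact: cjcom.
rewrite -(@commg_disjoint g h (cj s g^-1) (cj t h^-1)).
- by apply: comN => //; apply: ristM; try exact: riJ; apply: cjJ; exact: ristV.
- by apply: cj0com => //; exact: ristV.
- by apply: cj0com => //; exact: ristV.
- by apply: cjcom => //; exact: ristV.
- by apply: cj0com => //; [exact: leq_trans st|exact: ristV].
- by apply: cj0com => //; [exact: leq_trans st|exact: ristV].
Qed.

End CommutatorLemma.

(** * Commutators fixing a point of a non-free minimal action *)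

Section FixedCommutators.
Variables (G : groupType) (Z : topologicalType) (b : action G Z).
Variables (D : set Z) (cell : set (set Z)).
Local Open Scope group_scope.
Hypotheses (faithb : faithful b) (hZ : hausdorff_space Z).
Hypothesis B : cell_system b D cell.

Variables (X : topologicalType) (a : action G X) (P : seq G).
Hypothesis cX : compact [set: X].
Hypothesis covP : forall x, exists2 p, p \in P & (fixpoints a p)° x.

(** [P] lists the conjugates whose fixed-point sets cover [X]; this is the form in which
uniform recurrence is used. *)
Let recurrent_fixpoints (L : set G) : L 1 -> (forall g h, L g -> L h -> L (g * h)) -> forall x,
  exists2 p, p \in P & exists y, [/\ (fixpoints a p)° y,
    closure [set a g x | g in L] y &
    exists n (c : nat -> G), (forall k, L (c k)) /\
      forall g, L g ->
        exists2 k, (k < n)%N & (fixpoints a p)° (a (c k) (a g y))].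
Proof.
move=> L1 LM x.
have [||[p pP] [y H]] := uniform_recurrence a L1 LM cX
    (U := fun p : {p | p \in P} => (fixpoints a (sval p))°) x.
- by move=> p; exact: open_interior.
- by move=> z; have [p pP Fz] := covP z; exists (exist _ p pP).
- by exists p => //; exists y.
Qed.

(** Let [A] be supported in [W p] and [C] in [p (W p)], both of infinite order. For commuting
elements a point [v] such that [v], [A v], [C v] and [A C v] are all fixed by [p] is also
fixed by the commutator of [A ^ p^-1] and [C], since [A] and its conjugate by [p] act in
the same way on [v] and [C v]. Now [A ^ p^-1] lives in [p (W p)] together with [C], and the
choice of [A] and [C] makes the commutator nontrivial. The four conditions come from a
monochromatic rectangle of return times, and they are open, so they pass from the recurrent
point to a point of the orbit of [x]. *)
Lemma local_stabilizers (W : G -> set Z) :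
  (forall p, p \in P -> cell (W p)) ->
  (forall p q z, p \in P -> q \in P -> W p z -> W q z -> p = q) ->
  (forall p q z, p \in P -> q \in P -> W p z -> ~ W q (b q^-1 z)) ->
  (forall p q z, p \in P -> q \in P ->
     W p (b p^-1 z) -> W q (b q^-1 z) -> p = q) ->
  forall x, exists2 p, p \in P & exists g,
    [/\ g <> 1, rist b (b p^-1 @^-1` W p) g & a g x = x].
Proof.
move=> cW disj1 disj2 disj3 x.
have H p : exists uv : G * G, p \in P -> exists I, [/\ rist b (W p) uv.1,
    rist b I uv.2, I `<=` W p,
    (forall n z, I z -> ~ I (b (uv.1 ^+ n.+1) z)) &
    forall n, exists2 z, I z & b (uv.2 ^+ n.+1) z <> z].
  have [pP|_] := boolP (p \in P); last by exists (1, 1).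
  have [u [I [uW cI IW sh]]] := cell_shift B (cW p pP).
  have [v [I' [vI cI' I'I sh']]] := cell_shift B cI.
  exists (u, v) => _; exists I; split => // n.
  have [z I'z] := cell_neq0 B cI'; exists z; first exact: I'I.
  by move=> vz; apply: (sh' n z I'z); rewrite vz.
have [uv uvP] := choice H.
pose al p := (uv p).1; pose be p := (uv p).2 ^ p^-1.
pose pW p := b p^-1 @^-1` W p.
have alR p : p \in P -> rist b (W p) (al p) by move=> /uvP[I []].
have beR p : p \in P -> rist b (pW p) (be p).
  move=> /uvP[I [_ vI IW _ _]]; apply: ristJ (rist_sub IW vI) _.
  by move=> z.
(* the elements along which recurrence is used; they preserve all the cells involved *)
pose L := [set g | forall p, p \in P -> [/\ commute g (al p), commute g (be p) &
  forall z, pW p (b g z) -> pW p z]].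
have L1 : L 1.
  move=> p pP; split; [exact/commute_sym/commute1|exact/commute_sym/commute1|].
  by move=> z; rewrite act1.
have LM g h : L g -> L h -> L (g * h).
  move=> Lg Lh p pP; have [g1 g2 g3] := Lg p pP; have [h1 h2 h3] := Lh p pP; split.
  - by apply/commute_sym/commuteM; exact/commute_sym.
  - by apply/commute_sym/commuteM; exact/commute_sym.
  - by move=> z; rewrite actM => /g3/h3.
have stab I g (J : set Z) : rist b I g -> (forall z, I z -> J z -> False) ->
    forall z, J (b g z) -> J z.
  move=> gI IJ z; have [Iz|nIz] := pselect (I z); last by rewrite gI.
  by move=> /IJ[]; exact: rist_stable.
have Lal p : p \in P -> L (al p).
  move=> pP q qP; split.
  - have [->//|/eqP pq] := eqVneq p q.
    by apply: (rist_commute faithb (alR p pP) (alR q qP)) => z Wp /(disj1 _ _ _ pP qP Wp).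
  - by apply: (rist_commute faithb (alR p pP) (beR q qP)) => z /(disj2 _ _ _ pP qP).
  - by apply: stab (alR p pP) _ => z /(disj2 _ _ _ pP qP).
have Lbe p : p \in P -> L (be p).
  move=> pP q qP; split.
  - by apply: (rist_commute faithb (beR p pP) (alR q qP)) => z Wp /(disj2 _ _ _ qP pP).
  - have [->//|/eqP pq] := eqVneq p q.
    by apply: (rist_commute faithb (beR p pP) (beR q qP)) => z Wp /(disj3 _ _ _ pP qP Wp).
  - have [<-|/eqP pq] := eqVneq p q.
      move=> z; have [//|nz] := pselect (pW p z); by rewrite (beR p pP).
    by apply: stab (beR p pP) _ => z Wp /(disj3 _ _ _ pP qP Wp).
have LX g n : L g -> L (g ^+ n).
  by move=> Lg; elim: n => [|n IH]; rewrite ?expg0// expgS; exact: LM.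
(* colour a pair of exponents by the element bringing the point back *)
have [p pP [y [_ cly [n [c [Lc fin]]]]]] := recurrent_fixpoints L1 LM x.
have [I [uW vI IW sh mv]] := uvP p pP.
have finE (st : nat * nat) : exists k : 'I_n,
    (fixpoints a p)° (a (c k) (a (al p ^+ st.1 * be p ^+ st.2) y)).
  have [|k kn Fk] := fin (al p ^+ st.1 * be p ^+ st.2).
    by apply: (LM); apply: LX; [exact: Lal|exact: Lbe].
  by exists (Ordinal kn).
have [f fP] := choice finE.
have [s [s' [t [t' [ss' tt' [E1 E2 E3]]]]]] :=
  monochromatic_rectangle (fun s t => f (s, t)).
pose k := c (f (s, t)).
pose A := al p ^+ (s' - s); pose C := be p ^+ (t' - t).
have kA i : commute k (al p ^+ i) by apply: commuteX; have [] := Lc (f (s, t)) p pP.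
have kC i : commute k (be p ^+ i) by apply: commuteX; have [_] := Lc (f (s, t)) p pP.
have AC i j : commute (al p ^+ i) (be p ^+ j).
  by apply: commuteX2; have [] := Lal p pP p pP.
pose w := k * (al p ^+ s * be p ^+ t).
have wE : [/\ (fixpoints a p)° (a w y), (fixpoints a p)° (a A (a w y)),
    (fixpoints a p)° (a C (a w y)) & (fixpoints a p)° (a (A * C) (a w y))].
  have Aw : A * w = k * (al p ^+ s' * be p ^+ t).
    rewrite /w mulgA -(kA (s' - s)%N) -mulgA (mulgA A) -expgnDr.
    by rewrite subnK// ltnW.
  have Cw i : C * (k * (al p ^+ i * be p ^+ t)) = k * (al p ^+ i * be p ^+ t').
    rewrite mulgA -(kC (t' - t)%N) -mulgA (mulgA C) -(AC i (t' - t)%N).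
    by rewrite -mulgA -expgnDr subnK// ltnW.
  have ACw : A * C * w = k * (al p ^+ s' * be p ^+ t').
    by rewrite (AC (s' - s)%N (t' - t)%N) -mulgA Aw Cw.
  rewrite -!actM Aw ACw Cw; split; rewrite actM.
  - exact: (fP (s, t)).
  - by have := fP (s', t); rewrite /= E2.
  - by have := fP (s, t'); rewrite /= E1.
  - by have := fP (s', t'); rewrite /= E3.
pose N := (fixpoints a p)° `&` a A @^-1` (fixpoints a p)°
  `&` a C @^-1` (fixpoints a p)° `&` a (A * C) @^-1` (fixpoints a p)°.
have oN : open N by do 3?apply: openI; try apply: act_open; exact: open_interior.
have Lw : L w.
  by apply: (LM); [exact: Lc|apply: (LM); apply: LX; [exact: Lal|exact: Lbe]].
have Nwy : nbhs y (a w @^-1` N).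
  apply: open_nbhs_nbhs; split; first exact: act_open.
  by have [? ? ? ?] := wE.
have [_ [[g Lg <-] [[[/interior_subset N1 /interior_subset N2]
  /interior_subset N3] /interior_subset N4]]] := cly _ Nwy.
pose A' := A ^ p^-1.
have fA' v : fixpoints a p v -> fixpoints a p (a A v) -> a A' v = a A v.
  by move=> pv pAv; rewrite /A' conjgE invgK 2!actM (actV_fix pv) [LHS]pAv.
have qfix : a [~ A', C] (a w (a g x)) = a w (a g x).
  set v := a w (a g x) in N1 N2 N3 N4 *.
  suff e : a (A' * C) v = a (C * A') v.
    by rewrite commgEl conjgE mulgA -invgM actM e actK.
  rewrite (actM a A') (actM a C) (fA' v) // (fA' (a C v)) //; last by rewrite -actM.
  by rewrite -!actM (AC (s' - s)%N (t' - t)%N).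
exists p => //; exists ([~ A', C] ^ (w * g)); split.
- move=> /eqP; rewrite conjg_eq1 => /commgP.
  rewrite /A' /C /be -conjXg => /(congr1 (conjg^~ p)) /=.
  rewrite (conjMg (A ^ _)) (conjMg (_ ^+ _ ^ _)) -!conjgM mulVg !conjg1 => e.
  have := mv (t' - t).-1; rewrite prednK ?subn_gt0// => -[z Iz]; apply.
  have nI : ~ I (b A z).
    by have := sh (s' - s).-1 z Iz; rewrite prednK ?subn_gt0.
  apply: (act_inj (a := b) (g := A)); rewrite -!actM e !actM.
  by apply: ristX nI; exact: vI.
- apply: (@ristJ _ _ b (pW p) (pW p)); last first.
    by have [_ _] := LM _ _ Lw Lg p pP; exact.
  have A'R : rist b (pW p) A'.
    by apply: ristJ (ristX _ (alR p pP)) _ => z.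
  have CR : rist b (pW p) C by apply: ristX; exact: beR.
  exact: rist_commg.
- by apply/actJ_fix; rewrite actM.
Qed.

(** Let [g] act on each [W p] like an element [d] supported there, and let it bring the
recurrent point [y] to a fixed point of [p]. Then [g y = p g p^-1 y], and [p g p^-1] as well
as [d^-1 g] commute with everything supported in [W p]. So [d y] is the image of [y] under
an element commuting with the rigid stabilizer of [W p], which gives [y] and [d y] the same
stabilizer there. Bounded return times turn this into a normalizer of finite index. *)
Lemma stabilized_commutators (W : G -> set Z) (x : X) :
  (forall p, p \in P -> cell (W p)) ->
  (forall p q z, p \in P -> q \in P -> W p z -> W q z -> p = q) ->
  (forall p q z, p \in P -> q \in P -> W p z -> ~ W q (b p^-1 z)) ->
  (forall p, p \in P -> forall x, exists g,
     [/\ g <> 1, rist b (W p) g & a g x = x]) ->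
  exists y I, cell I /\
    forall g h, rist b I g -> rist b I h -> a [~ g, h] y = y.
Proof.
move=> cW disj1 disj2 loc.
pose L := [set g | (forall z, (forall p, p \in P -> ~ W p z) -> b g z = z) /\
  forall p, p \in P -> exists2 d, rist b (W p) d & forall z, W p z -> b g z = b d z].
have ristL p : p \in P -> rist b (W p) `<=` L.
  move=> pP g gW; split=> [z nz|q qP]; first exact/gW/nz.
  have [<-|/eqP pq] := eqVneq p q; first by exists g.
  exists 1; first exact: rist1.
  by move=> z Wq; rewrite act1; apply: gW => Wp; exact/pq/(disj1 _ _ _ pP qP Wp).
have L1 : L 1.
  split=> [z|p pP]; rewrite ?act1//; exists 1; [exact: rist1|by []].
have LM g h : L g -> L h -> L (g * h).
  move=> [g0 gL] [h0 hL]; split=> [z nz|p pP]; first by rewrite actM h0 ?g0.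
  have [d dW gd] := gL p pP; have [e eW he] := hL p pP.
  exists (d * e); first exact: ristM.
  by move=> z Wz; rewrite !actM he// gd//; exact: rist_stable.
have [p pP [y [Fy _ [n [c [Lc fin]]]]]] := recurrent_fixpoints L1 LM x.
have py : a p y = y := interior_subset Fy.
pose N := [set g | rist b (W p) g /\ a g y = y].
pose K := [set d | rist b (W p) d /\ forall g, rist b (W p) g -> a g y = y ->
  a (g ^ d) y = y /\ a (g ^ d^-1) y = y].
(* a return to the fixed points of [p] puts the restriction of [g] to [W p] in [K] *)
have retK g d : L g -> rist b (W p) d -> (forall z, W p z -> b g z = b d z) ->
    a p (a g y) = a g y -> K d.
  move=> [g0 _] dW gd pgy; split=> // h hW hy.
  pose e := d^-1 * g.
  pose f := g ^ p^-1.
  have eR : rist b (~` W p) e.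
    by move=> z /contrapT Wz; rewrite actM gd// actK.
  have eC x' : rist b (W p) x' -> commute e x'.
    by move=> x'W; apply: (rist_commute faithb eR x'W) => z.
  have fR : rist b [set z | exists2 q, q \in P & W q (b p^-1 z)] f.
    by move=> z nz; apply/actJ_fix/g0 => q qP Wq; apply: nz; exists q.
  have fC x' : rist b (W p) x' -> commute f x'.
    move=> x'W; apply: (rist_commute faithb fR x'W) => z [q qP Wq] Wz.
    exact: disj2 Wz Wq.
  have fy : a f y = a d (a e y).
    rewrite -actM /e mulVKg /f conjgE invgK 2!actM (actV_fix py).
    by rewrite pgy.
  clearbody e f; split; apply/actJ_fix.
  - have dyE : a d y = a (e^-1 * f) y.
      by rewrite actM fy -[a d (a e y)]actM -(eC d dW) actM actK.
    have com : commute h (e^-1 * f).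
      by apply: commuteM; [apply: commuteV|]; apply: commute_sym; auto.
    by rewrite dyE -actM com actM hy.
  - have dyE : a d^-1 y = a (f^-1 * e) y.
      apply: (act_inj (a := a) (g := d)); rewrite actVK (actM a f^-1).
      by rewrite -(actM a d) (commuteV (commute_sym (fC d dW))) actM -fy actK.
    have com : commute h (f^-1 * e).
      by apply: commuteM; [apply: commuteV|]; apply: commute_sym; auto.
    by rewrite dyE -actM com actM hy.
have cE k : exists d, rist b (W p) d /\ forall z, W p z -> b (c k) z = b d z.
  by have [_ /(_ p pP)[d dW cd]] := Lc k; exists d.
have [d dP] := choice cE.
have [q [q1 qW qy]] := loc p pP y.
have [||||||I cI IP] := @finite_index_commutators _ _ _ _ _ faithb hZ B
  (W p) N K q n d (cW p pP) _ _ (conj qW qy) q1 qW.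
- by move=> g h [gW gy] [hW hy]; split; [exact: ristM|rewrite actM hy].
- by move=> g [gW gy]; split; [exact: ristV|exact: actV_fix].
- by move=> g [].
- move=> g h [gW gN] [hW hN]; split; first by apply: ristM => //; exact: ristV.
  move=> u uW uy; rewrite invgM invgK !conjgM; split.
    have [_ e] := gN u uW uy.
    by have [] := hN (u ^ g^-1) (rist_conj uW (ristV gW)) e.
  have [_ e] := hN u uW uy.
  by have [] := gN (u ^ h^-1) (rist_conj uW (ristV hW)) e.
- move=> g h [gW gy] [hW hN]; split; first exact: rist_conj.
  by have [] := hN g gW gy.
- move=> g gW; have [k kn Fk] := fin g (ristL p pP g gW); exists k => //.
  have [dW cd] := dP k.
  apply: (retK (c k * g)).
  + by apply: LM => //; exact: ristL gW.
  + exact: ristM.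
  + by move=> z Wz; rewrite !actM cd//; exact: rist_stable.
  + by rewrite actM; exact: (interior_subset Fk).
by exists y, I; split => // g h gI hI; have [_] := IP g h gI hI.
Qed.

End FixedCommutators.

Section NonFree.
Variables (G : groupType) (Z : topologicalType) (b : action G Z).
Variables (D : set Z) (cell : set (set Z)).
Local Open Scope group_scope.
Hypotheses (faithb : faithful b) (hZ : hausdorff_space Z).
Hypotheses (B : cell_system b D cell) (sq : squeezing b D cell).
Variables (X : topologicalType) (a : action G X).
Hypotheses (cX : compact [set: X]) (mina : minimal a).

(** The cells [W] and the smaller ones [W'] are disjoint from each other and from their
images under [P]; in addition an element [g q] carries all the images [p (W' p)] into [W q].
Since [local_stabilizers] does not tell which [p] occurs, it is applied to [W'] and to a
translate of the given point, and the result is conjugated by [g q] into the rigid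
stabilizer of [W q]. *)
Theorem nonfree_fixes_commutators : ~ topologically_free a ->
  exists y I, cell I /\
    forall g h, rist b I g -> rist b I h -> a [~ g, h] y = y.
Proof.
move=> /existsNP[g0 /not_implyP[g01 /eqP/set0P[x0 Fx0]]].
have [||n [s Hs]] := @compact_finite_cover X setT G
    (fun h => a h @^-1` (fixpoints a g0)°) cX (ex_intro _ x0 I).
- by move=> h; apply: act_open; exact: open_interior.
- move=> x _; have [|y [Fy [h _ hx]]] := mina x _ (open_interior (fixpoints a g0)).
    by exists x0.
  by exists h; rewrite /preimage /= hx.
pose P := [seq g0 ^ s k | k <- iota 0 n].
have P1 p : p \in P -> p <> 1.
  by move=> /mapP[k _ ->] /eqP; rewrite conjg_eq1 => /eqP.
have covP x : exists2 p, p \in P & (fixpoints a p)° x.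
  have [k kn Fk] := Hs x I; exists (g0 ^ s k).
    by apply/mapP; exists k => //; rewrite mem_iota.
  apply: filterS (_ : nbhs x (a (s k) @^-1` (fixpoints a g0)°)).
    by move=> y /= /interior_subset Fy; apply/actJ_fix.
  by apply: open_nbhs_nbhs; split => //; apply: act_open; exact: open_interior.
have [p0 p0P _] := covP x0.
have [z0 _] := moves_point faithb (P1 p0 p0P).
have [z zP] := separated_points faithb hZ B z0 (1 :: P) P1.
have zne p p' q q' : p \in P -> p' \in P -> q \in 1 :: P -> q' \in 1 :: P ->
    p <> p' -> b q (z p) <> b q' (z p').
  by move=> pP p'P qQ q'Q pp'; have [_ _] := zP p pP; exact.
have zmv p : p \in P -> b p (z p) <> z p by move=> pP; have [] := zP p pP.
have [V0 [oO Oz Osep]] := separated_nbhds b hZ P (1 :: P) z.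
have Q1 : 1 \in 1 :: P by rewrite inE eqxx.
have QP p : p \in P -> p \in 1 :: P by rewrite inE orbC => ->.
have disj p q w : p \in P -> q \in P -> V0 p w -> V0 q w -> p = q.
  move=> pP qP Ow Ow'; apply: contrapT => pq.
  by apply: (Osep p q 1 1 pP qP Q1 Q1 (zne _ _ _ _ pP qP Q1 Q1 pq) _ _ Ow Ow').
have disjV p q r w : p \in P -> q \in P -> r \in P -> (r = p \/ r = q) ->
    V0 p w -> ~ V0 q (b r^-1 w).
  move=> pP qP rP rpq Op Oq.
  have ne : b 1 (z p) <> b r (z q).
    have [e|/eqP pq] := eqVneq p q; last by apply: zne (QP _ rP) pq.
    by rewrite act1 => /esym; case: rpq => ->; rewrite ?e; apply: zmv.
  by apply: (Osep p q 1 r pP qP Q1 (QP _ rP) ne _ _ Op Oq); rewrite act1 actVK.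
have cWE p : exists W, cell W /\ W `<=` V0 p.
  have [|W cW WO] := cell_base B (oO p); first by exists (z p).
  by exists W.
have [W WP] := choice cWE.
have gE q : exists g, forall p, p \in P -> W q (b g (b p (z p))).
  have [|h hP] := sq (S := [seq b p (z p) | p <- P]) (WP q).1.
    by move=> _ /mapP[p pP ->]; apply: (cell_domain B); have [] := zP p pP.
  by exists h => p pP; apply/hP/(map_f (fun p => b p (z p))).
have [g gP] := choice gE.
have cW'E p : exists V, p \in P -> [/\ cell V, V `<=` V0 p &
    forall w, V w -> forall q, q \in P -> W q (b (g q) (b p w))].
  have [pP|_] := boolP (p \in P); last by exists set0.
  pose V := V0 p `&` [set w | forall q, q \in P -> W q (b (g q) (b p w))].
  have Vz : nbhs (z p) V.
    apply: filterI; first exact: open_nbhs_nbhs.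
    apply: near_seq => q qP; apply: open_nbhs_nbhs.
    split; last exact: gP.
    apply: (act_open b p (U := b (g q) @^-1` W q)).
    by apply: act_open; exact: (cell_open B (WP q).1).
  have [||V' cV' V'V] := cell_base B (U := V°); first exact: open_interior.
    by exists (z p).
  exists V' => _; split=> // w /V'V/interior_subset[] //.
have [W' W'P] := choice cW'E.
have VO p : p \in P -> W' p `<=` V0 p by move=> /W'P[].
apply: (@stabilized_commutators _ _ _ _ _ faithb hZ B X a P cX covP W x0).
- by move=> p _; have [] := WP p.
- move=> p q w pP qP /(WP p).2 Ow /(WP q).2; exact: disj pP qP Ow.
- move=> p q w pP qP /(WP p).2 Ow /(WP q).2; apply: disjV Ow => //; by left.
- move=> q qP x.
  have [||||p pP [h [h1 hR hx]]] := local_stabilizers faithb B cX covP (W := W') _ _ _ _ (a (g q)^-1 x).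
  + by move=> p /W'P[].
  + by move=> p r w pP rP /(VO p pP) Ow /(VO r rP); exact: disj Ow.
  + move=> p r w pP rP /(VO p pP) Ow /(VO r rP).
    by apply: disjV Ow => //; right.
  + move=> p r w pP rP /(VO p pP) Ow /(VO r rP) Ow'.
    apply: contrapT => pr; have := zne _ _ _ _ pP rP (QP _ pP) (QP _ rP) pr.
    by move=> /(Osep _ _ _ _ pP rP (QP _ pP) (QP _ rP))/(_ _ _ Ow Ow'); rewrite !actVK.
  exists (h ^ (g q)^-1); split.
  + by move=> /eqP; rewrite conjg_eq1 => /eqP.
  + apply: ristJ hR _ => w /= W'w; have [_ _ /(_ _ W'w q qP)] := W'P p pP.
    by rewrite !actVK.
  + exact/actJ_fix.
Qed.
End NonFree.

(** * From fixed commutators to freeness or a factor map *)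

Section CommutatorFixedSets.
Variables (G : groupType) (Z : topologicalType) (b : action G Z).
Variables (X : topologicalType) (a : action G X).
Local Open Scope group_scope.

Definition comm_fix (I : set Z) : set X :=
  [set x | forall g h, rist b I g -> rist b I h -> a [~ g, h] x = x].

Lemma comm_fix_closed I : hausdorff_space X -> closed (comm_fix I).
Proof.
move=> hX; rewrite (_ : comm_fix I = \bigcap_(u in [set u : G * G |
    rist b I u.1 /\ rist b I u.2]) fixpoints a [~ u.1, u.2]).
  by apply: closed_bigI => u _; exact: fixpoints_closed.
apply/seteqP; split=> [x Hx [g h] [/= gI hI]|x Hx g h gI hI]; first exact: Hx.
exact: (Hx (g, h)).
Qed.

Lemma comm_fix_sub I J : J `<=` I -> comm_fix I `<=` comm_fix J.
Proof. by move=> JI x Hx g h gJ hJ; apply: Hx; exact: rist_sub JI _ _. Qed.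

Lemma comm_fix_act k I J x : (forall z, J z -> I (b k^-1 z)) ->
  comm_fix I x -> comm_fix J (a k x).
Proof.
move=> JI Hx g h gJ hJ; apply/actJ_fix; rewrite conjRg; apply: Hx.
  by apply: ristJ gJ _ => z /JI; rewrite actK.
by apply: ristJ hJ _ => z /JI; rewrite actK.
Qed.

End CommutatorFixedSets.

Section Unfaithful.
Variables (G : groupType) (Z : topologicalType) (b : action G Z).
Variables (D : set Z) (cell : set (set Z)).
Local Open Scope group_scope.
Hypotheses (faithb : faithful b) (hZ : hausdorff_space Z).
Hypotheses (B : cell_system b D cell) (sq : squeezing b D cell).
Variables (X : topologicalType) (a : action G X).
Hypotheses (cX : compact [set: X]) (hX : hausdorff_space X).

(** A shift and a shift of the subcell that it displaces do not commute. *)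
Lemma cell_noncommutative J : cell J ->
  exists u v, [/\ rist b J u, rist b J v & [~ u, v] <> 1].
Proof.
move=> cJ; have [u [I [uJ cI IJ sh]]] := cell_shift B cJ.
have [v [I' [vI cI' I'I sh']]] := cell_shift B cI.
exists u, v; split=> //; first exact: rist_sub IJ _ vI.
move=> /eqP/commgP uv; have [z I'z] := cell_neq0 B cI'.
have Iz := I'I _ I'z.
have vuz : b v (b u z) = b u z by apply: vI; have := sh 0%N z Iz; rewrite expg1.
have vz : b v z = z.
  by apply: (act_inj (a := b) (g := u)); rewrite -actM uv actM.
by apply: (sh' 0%N z I'z); rewrite expg1 vz.
Qed.

(** Transitivity on cells and directedness give, by compactness, a point fixed by the
commutators of every cell. Such points form a closed invariant set. *)
Lemma minimal_faithful_free :
  (forall I J, cell I -> cell J -> exists g, forall z, J z -> I (b g z)) ->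
  (forall I J, cell I -> cell J -> exists2 K, cell K & I `|` J `<=` K) ->
  (forall g I, cell I -> exists2 J, cell J & forall z, I (b g z) -> J z) ->
  faithful a -> minimal a -> topologically_free a.
Proof.
move=> trans dir inv faitha mina; apply: contrapT => nfree.
have [y [I [cI Iy]]] := nonfree_fixes_commutators faithb hZ B sq cX mina nfree.
have [x Hx] : exists x, forall J, cell J -> comm_fix b a J x.
  apply: compact_directed => //; first by exists I.
  - by move=> J _; exact: comm_fix_closed.
  - move=> J cJ; have [g gJ] := trans I J cI cJ; exists (a g^-1 y).
    by apply: comm_fix_act Iy => z; rewrite invgK; exact: gJ.
  - move=> J K cJ cK; have [M cM sub] := dir J K cJ cK; exists M => // z Mz.
    by split; apply: comm_fix_sub Mz => t ?; apply: sub; [left|right].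
pose Y := \bigcap_(J in cell) comm_fix b a J.
have YT : forall x, Y x.
  apply: (@minimal_closed _ _ a Y mina).
  - by apply: closed_bigI => J _; exact: comm_fix_closed.
  - by exists x.
  - move=> g z Yz J cJ; have [K cK KJ] := inv g J cJ.
    apply: comm_fix_act (Yz K cK) => t Jt; apply: KJ.
    by rewrite actVK.
have [u [v [uI vI]]] := cell_noncommutative cI; apply.
by apply: faitha => z; exact: (YT z I cI u v).
Qed.

End Unfaithful.

(** A strong form of simplicity: commutators of elements that are trivial on a common
nonempty open set generate the whole group, as a normal subgroup. The identity is such a
commutator, which is why it is not listed. *)
Definition locally_perfect (G : groupType) (Z : topologicalType) (b : action G Z) :=
  forall S : set G,
  (forall g h, S g -> S h -> S (g * h)%g) -> (forall g, S g -> S g^-1%g) ->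
  (forall g h, S g -> S (g ^ h)%g) ->
  (forall U, open U -> U !=set0 -> forall g h,
    rist b (~` U) g -> rist b (~` U) h -> S [~ g, h]%g) ->
  forall g, S g.

Section Factor.
Variables (G : groupType) (Z : topologicalType) (b : action G Z).
Variables (cell : set (set Z)) (z0 : Z).
Local Open Scope group_scope.
Hypotheses (faithb : faithful b) (hZ : hausdorff_space Z) (cZ : compact [set: Z]).
Hypotheses (B : cell_system b setT cell).
Hypothesis orb : forall W, cell W -> exists g, W (b g z0).
Hypothesis compress : forall U W, open U -> U z0 -> cell W ->
  exists g, forall z, ~ U z -> W (b g z).
Hypothesis spread : forall z z' U, z <> z' -> open U -> U !=set0 ->
  exists V g h, [/\ open V, V z', rist b (~` V) g, rist b (~` V) h &
    U (b [~ g, h] z)].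
Hypothesis perfect : locally_perfect b.

(** Move the base point into a cell avoiding the given points; compressing the complement
of that cell moves these points. *)
Lemma compress_squeezing : squeezing b setT cell.
Proof.
move=> S W cW _.
have [J cJ _] : exists2 J, cell J & J `<=` setT.
  by apply: (cell_base B openT); exists z0.
have [W' cW' W'S] : exists2 J', cell J' & forall z, z \in S -> ~ J' z.
  have [z Jz zS] := cell_avoid B S cJ.
  have [||J' cJ' sub] := cell_base B (U := ~` [set` S]).
  - apply: closed_openC; apply: (iffLR accessible_finite_set_closed); last exact: finite_seq.
    exact: hausdorff_accessible.
  - by exists z; apply/negP.
  by exists J' => // t tS /sub; exact.
have [g W'g] := orb cW'.
have [||h hP] := @compress (b g @^-1` W') W _ _ cW.
- by apply: act_open; exact: (cell_open B cW').
- by [].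
exists (h * g^-1) => z zS; rewrite actM; apply: hP; rewrite /preimage /= actVK.
exact: W'S.
Qed.

Variables (X : topologicalType) (a : action G X).
Hypotheses (cX : compact [set: X]) (hX : hausdorff_space X).
Hypotheses (mina : minimal a) (nonta : nontrivial_action a).

(** The graph of the factor map to be constructed. *)
Definition attached x z := forall U, open U -> U z -> comm_fix b a (~` U) x.

Lemma attached_act g x z : attached x z -> attached (a g x) (b g z).
Proof.
move=> xz U oU Ugz; apply: comm_fix_act (xz (b g @^-1` U) (act_open b g oU) Ugz).
by move=> t nUt Ut; apply: nUt; rewrite -(actVK b g t).
Qed.

Lemma attached_base : ~ topologically_free a -> exists x, attached x z0.
Proof.
move=> nfree.
have [y [I [cI Iy]]] :=
  nonfree_fixes_commutators faithb hZ B compress_squeezing cX mina nfree.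
have [||||x Hx] := @compact_directed X _ [set U : set Z | open U /\ U z0]
  (fun U => comm_fix b a (~` U)) cX _ _ _ _.
- by exists setT; split => //; exact: openT.
- by move=> U _; exact: comm_fix_closed.
- move=> U [oU Uz0]; have [g gU] := compress oU Uz0 cI; exists (a g^-1 y).
  by apply: comm_fix_act Iy => z; rewrite invgK; exact: gU.
- move=> U V [oU Uz0] [oV Vz0]; exists (U `&` V).
    by split => //; exact: openI.
  by move=> z Hz; split; apply: comm_fix_sub Hz => t nUt [].
- by exists x => U oU Uz0; exact: Hx.
Qed.

(** Otherwise [Z] is covered by finitely many open sets [U] such that [x] is not fixed by
the commutators of elements trivial on [U]. This persists on a neighbourhood of [x], which
the orbit of [x0] meets; but every point of that orbit has an attached point. *)
Lemma attached_exists x0 : attached x0 z0 -> forall x, exists z, attached x z.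
Proof.
move=> x0z0 x; apply: contrapT => /forallNP nx.
have H z : exists U, [/\ open U, U z & ~ comm_fix b a (~` U) x].
  have /existsNP[U /not_implyP[oU /not_implyP[Uz nU]]] := nx z.
  by exists U.
have [U UP] := choice H.
have [||n [s Hs]] := @compact_finite_cover Z setT Z U cZ (ex_intro _ z0 I).
- by move=> z; have [] := UP z.
- by move=> z _; exists z; have [] := UP z.
pose N := [set y | forall k, k \in iota 0 n -> ~ comm_fix b a (~` U (s k)) y].
have Nx : nbhs x N.
  apply: near_seq => k _; apply: open_nbhs_nbhs; split; last by have [] := UP (s k).
  by apply: closed_openC; exact: comm_fix_closed.
have [|y [/interior_subset Ny [g _ gx0]]] := mina x0 _ (open_interior N).
  by exists x; exact: Nx.
have [k kn Uk] := Hs (b g z0) I.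
apply: (Ny k); first by rewrite mem_iota.
by rewrite -gx0; apply: (attached_act x0z0) => //; have [] := UP (s k).
Qed.

(** With a second attached point [z'], a commutator of elements trivial near [z'] fixes [x]
and moves [z] into any prescribed open set [U], so that [x] is fixed by the commutators of
elements trivial on [U], whatever [U] is. *)
Lemma attached_unique x z z' : attached x z -> attached x z' -> z = z'.
Proof.
move=> xz xz'; apply: contrapT => zz'.
pose Y := \bigcap_(U in [set U : set Z | open U /\ U !=set0]) comm_fix b a (~` U).
have Yx : Y x.
  move=> U [oU U0]; have [V [g [h [oV Vz' gV hV Uz]]]] := spread zz' oU U0.
  have := attached_act (g := [~ g, h]) xz.
  by rewrite (xz' V oV Vz' g h gV hV); exact.
have YT : forall x, Y x.
  apply: (@minimal_closed _ _ a Y mina).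
  - by apply: closed_bigI => J _; exact: comm_fix_closed.
  - by exists x.
  - move=> g t Yt U [oU [w Uw]].
    apply: (@comm_fix_act _ _ b _ a g (~` (b g @^-1` U))).
      by move=> v nUv Uv; apply: nUv; rewrite -(actVK b g v).
    apply: Yt; split; first exact: act_open.
    by exists (b g^-1 w); rewrite /preimage /= actVK.
have [g [t]] := nonta; apply; move: t.
have P := perfect; rewrite /locally_perfect in P.
apply: (P [set g | forall t, a g t = t]).
- by move=> h k Sh Sk t; rewrite actM Sk Sh.
- by move=> h Sh t; apply: actV_fix.
- by move=> h k Sh t; apply/actJ_fix.
- by move=> U oU U0 h k hU kU t; exact: (YT t U (conj oU U0)).
Qed.

(** Continuity is the closed graph argument, and surjectivity holds because the image is
closed and invariant while every cell meets the orbit of the base point. *)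
Theorem free_or_factors : topologically_free a \/ factors_onto a b.
Proof.
have [|nfree] := pselect (topologically_free a); [by left|right].
have [x0 x0z0] := attached_base nfree.
have [f fP] := choice (attached_exists x0z0).
have fE x z : attached x z -> f x = z by exact: attached_unique.
have fequi g x : f (a g x) = b g (f x) by apply/fE/attached_act.
have fc : continuous f.
  move=> x U /= nU.
  pose V := U°.
  have H z : exists W, ~ V z -> [/\ open W, W z & ~ comm_fix b a (~` W) x].
    have [Vz|nVz] := pselect (V z); first by exists set0.
    have xz : ~ attached x z.
      by move=> /fE e; apply: nVz; rewrite -e; exact: nU.
    move: xz => /existsNP[W /not_implyP[oW /not_implyP[Wz nW]]].
    by exists W.
  have [W WP] := choice H.
  have [V1|/set0P/negP] := pselect ((~` V) !=set0); last first.
    rewrite negbK => /eqP V0; apply: nearW => y.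
    suff : V (f y) by exact: interior_subset.
    by apply: contrapT => nV; have : (~` V) (f y) := nV; rewrite V0.
  have [|||n [s Hs]] := @compact_finite_cover Z (~` V) {z | ~ V z}
    (fun z => W (sval z)) _ V1.
  - by apply: subclosed_compact cZ _ => //; apply: open_closedC; exact: open_interior.
  - by move=> [z nVz] /=; have [] := WP z nVz.
  - by move=> z nVz; exists (exist _ z nVz) => /=; have [] := WP z nVz.
  have : \forall y \near x, forall k, k \in iota 0 n ->
      ~ comm_fix b a (~` W (sval (s k))) y.
    apply: near_seq => k _; have [oW _ nW] := WP _ (svalP (s k)).
    apply: open_nbhs_nbhs; split => //.
    by apply: closed_openC; exact: comm_fix_closed.
  apply: filterS => y Ny; apply: contrapT => nUy.
  have [|k kn Wk] := Hs (f y); first by move=> /interior_subset.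
  apply: (Ny k); first by rewrite mem_iota.
  by apply: (fP y) => //; have [] := WP _ (svalP (s k)).
exists f; split => // z.
have cf : closed (range f).
  apply: compact_closed => //; apply: continuous_compact => //.
  exact: continuous_subspaceT.
apply: contrapT => nz.
have [||W cW sub] := cell_base B (U := ~` range f).
- exact: closed_openC.
- by exists z => -[x _ e]; apply: nz; exists x.
have [g Wg] := orb cW; apply: (sub _ Wg); exists (a g x0) => //.
by rewrite fequi (fE _ _ x0z0).
Qed.

End Factor.

(** * The Cantor set and swaps of cylinders *)

Section CantorTopology.
Implicit Types (x y : cantor_space) (w z : seq bool) (U : set cantor_space).

Definition agree n x y := forall i, (i < n)%N -> x i = y i.

Lemma cylinder_mkseq x n : cylinder (mkseq x n) x.
Proof. by move=> i; rewrite size_mkseq => lt; rewrite nth_mkseq. Qed.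

Lemma cylinder_agree w x y : agree (size w) x y -> cylinder w x -> cylinder w y.
Proof. by move=> xy wx i iw; rewrite -xy// wx. Qed.

Lemma cylinder_mkseqE x n y : cylinder (mkseq x n) y <-> agree n x y.
Proof.
split=> [H i lt|H].
  by rewrite H ?size_mkseq// nth_mkseq.
by apply: (@cylinder_agree _ x); [rewrite size_mkseq|exact: cylinder_mkseq].
Qed.

Lemma cylinder_open w : open (cylinder w).
Proof.
rewrite openE => x wx; rewrite /interior /=.
have : \forall y \near x, forall i, i \in iota 0 (size w) -> y i = nth false w i.
  apply: near_seq => i; rewrite mem_iota => /wx <-.
  exact: (@proj_continuous nat (fun=> bool) i x _ (discrete_set1 (x i))).
by apply: filterS => y yw i iw; apply: yw; rewrite mem_iota.
Qed.

Lemma cylinder_closed w : closed (cylinder w).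
Proof.
move=> x clx i iw.
have [y [wy /= xy]] : cylinder w `&` cylinder (mkseq x (size w)) !=set0.
  apply: clx; apply: open_nbhs_nbhs; split; first exact: cylinder_open.
  exact: cylinder_mkseq.
by move/cylinder_mkseqE: xy => xy; rewrite xy// wy.
Qed.

(** The cylinders around a point, minus an open neighbourhood, form a decreasing family of
closed sets with empty intersection. *)
Lemma cylinder_nbhs x U : nbhs x U -> exists n, forall y, agree n x y -> U y.
Proof.
rewrite nbhsE => -[V [oV Vx] VU]; apply: contrapT => /forallNP H.
have [||||y Hy] := @compact_directed cantor_space nat setT
    (fun n => cylinder (mkseq x n) `&` ~` V) cantor_space_compact.
- by exists 0%N.
- move=> n _; apply: closedI; first exact: cylinder_closed.
  exact: open_closedC.
- move=> n _; have /existsNP[y /not_implyP[xy nU]] := H n; exists y.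
  by split; [exact/cylinder_mkseqE|move=> /VU].
- move=> m n _ _; exists (maxn m n) => // y [/cylinder_mkseqE xy nV].
  by split; split=> //; apply/cylinder_mkseqE => i lt; apply: xy;
    rewrite leq_max lt ?orbT.
have xy : x = y.
  apply/funext => i; have [/cylinder_mkseqE xy _] := Hy i.+1 I.
  exact: xy.
by have [_] := Hy 0%N I; rewrite -xy.
Qed.

Lemma cylinder_sub_open x U : open U -> U x ->
  exists n, cylinder (mkseq x n) `<=` U.
Proof.
move=> oU Ux; have [n xU] := cylinder_nbhs (open_nbhs_nbhs (conj oU Ux)).
by exists n => y /cylinder_mkseqE /xU.
Qed.

Lemma agree_continuous (f : cantor_space -> cantor_space) :
  (forall x n, exists m, forall y, agree m x y -> agree n (f x) (f y)) ->
  continuous f.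
Proof.
move=> H x U /cylinder_nbhs[n nU]; have [m mn] := H x n.
have : nbhs x (cylinder (mkseq x m)).
  by apply: open_nbhs_nbhs; split; [exact: cylinder_open|exact: cylinder_mkseq].
by apply: filterS => y /cylinder_mkseqE /mn /nU.
Qed.

Definition incomparable w z := ~~ prefix w z && ~~ prefix z w.

Lemma incomparableC w z : incomparable w z = incomparable z w.
Proof. by rewrite /incomparable andbC. Qed.

Lemma incomparable_disjoint w z x :
  incomparable w z -> cylinder w x -> cylinder z x -> False.
Proof.
by move=> /andP[/negbTE wz /negbTE zw] wx zx; have := cylinder_prefix wx zx; rewrite wz zw.
Qed.

Lemma size_incomparable w z : size w = size z -> w <> z -> incomparable w z.
Proof.
move=> e ne; rewrite /incomparable !prefixE e take_size -e take_size (eq_sym z).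
by rewrite andbb; apply/eqP.
Qed.

Lemma cylinder_word_cat w x : cylinder w (word_cat w x).
Proof. by apply/cylinderP; exists x. Qed.

Lemma incomparable_cat w z s t : incomparable w z -> incomparable (w ++ s) (z ++ t).
Proof.
move=> wz; apply/negPn/negP; rewrite negb_and !negbK => /orP[] /prefixP[r e].
  pose x := word_cat (z ++ t) (fun=> false).
  apply: (@incomparable_disjoint w z x) => //; rewrite /x; last first.
    by rewrite word_cat_cat; exact: cylinder_word_cat.
  by rewrite e -catA word_cat_cat; exact: cylinder_word_cat.
pose x := word_cat (w ++ s) (fun=> false).
apply: (@incomparable_disjoint w z x) => //; rewrite /x.
  by rewrite word_cat_cat; exact: cylinder_word_cat.
by rewrite e -catA word_cat_cat; exact: cylinder_word_cat.
Qed.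

Lemma incomparable_tail w s t : incomparable s t -> incomparable (w ++ s) (w ++ t).
Proof.
by rewrite /incomparable; elim: w => //= c w IH; rewrite eqxx.
Qed.

End CantorTopology.

Section Swap.
Implicit Types (x y : cantor_space) (w z : seq bool).

Definition swap_fun w z x : cantor_space :=
  if mkseq x (size w) == w then word_cat z (fun i => x (size w + i)%N)
  else if mkseq x (size z) == z then word_cat w (fun i => x (size z + i)%N)
  else x.

Lemma mkseq_cylinder w x : (mkseq x (size w) == w) = `[< cylinder w x >].
Proof.
apply/eqP/asboolP => [<-|wx]; first exact: cylinder_mkseq.
apply: (@eq_from_nth _ false); rewrite size_mkseq// => i iw.
by rewrite nth_mkseq// wx.
Qed.

Lemma word_cat_shift w x : (fun i => word_cat w x (size w + i)%N) = x.
Proof. by apply/funext => i; rewrite /word_cat ltnNge leq_addr /= addKn. Qed.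

Lemma word_catE w x : cylinder w x -> x = word_cat w (fun i => x (size w + i)%N).
Proof. by move=> /cylinderP[y ->]; rewrite word_cat_shift. Qed.

Lemma swap_funl w z x : swap_fun w z (word_cat w x) = word_cat z x.
Proof.
rewrite /swap_fun mkseq_cylinder asboolT ?word_cat_shift//.
exact: cylinder_word_cat.
Qed.

Lemma swap_fun_out w z x : ~ cylinder w x -> ~ cylinder z x -> swap_fun w z x = x.
Proof. by move=> wx zx; rewrite /swap_fun !mkseq_cylinder !asboolF. Qed.

Section SwapGroup.
Variables (w z : seq bool).
Hypothesis wz : incomparable w z.

Lemma swap_funr x : swap_fun w z (word_cat z x) = word_cat w x.
Proof.
have zx : cylinder z (word_cat z x) by exact: cylinder_word_cat.
rewrite /swap_fun !mkseq_cylinder asboolF ?asboolT ?word_cat_shift//.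
by move=> /(incomparable_disjoint wz); exact.
Qed.

Variant swap_cases x : cantor_space -> Prop :=
| SwapL y of x = word_cat w y : swap_cases x (word_cat z y)
| SwapR y of x = word_cat z y : swap_cases x (word_cat w y)
| SwapO of ~ cylinder w x & ~ cylinder z x : swap_cases x x.

Lemma swapP x : swap_cases x (swap_fun w z x).
Proof.
have [wx|nwx] := pselect (cylinder w x).
  by move/cylinderP: (wx) => [y xE]; rewrite xE swap_funl; exact: SwapL.
have [zx|nzx] := pselect (cylinder z x).
  by move/cylinderP: (zx) => [y xE]; rewrite xE swap_funr; exact: SwapR.
by rewrite swap_fun_out//; exact: SwapO.
Qed.

Lemma swap_funK : involutive (swap_fun w z).
Proof.
move=> x; case: (swapP x) => [y ->|y ->|nw nz].
- exact: swap_funr.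
- exact: swap_funl.
- exact: swap_fun_out.
Qed.

Lemma swap_fun_continuous : continuous (swap_fun w z).
Proof.
apply: agree_continuous => x n; exists (n + size w + size z)%N => y xy.
have agS u v : (size u <= size w + size z)%N ->
    agree n (word_cat v (fun i => x (size u + i)%N))
            (word_cat v (fun i => y (size u + i)%N)).
  move=> uwz i lt; rewrite /word_cat; case: ifP => // iv; apply: xy.
  lia.
have E u : (size u <= size w + size z)%N -> mkseq x (size u) = mkseq y (size u).
  move=> uwz; apply/eq_in_map => i; rewrite mem_iota => /andP[_ lt]; apply: xy.
  lia.
rewrite /swap_fun !E ?leq_addr ?leq_addl//.
case: ifP => _; first exact/agS/leq_addr.
case: ifP => _; first exact/agS/leq_addl.
by move=> i lt; apply: xy; rewrite -addnA ltn_addr.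
Qed.

Definition swap_homeo : homeo cantor_space :=
  Homeo swap_funK swap_funK swap_fun_continuous swap_fun_continuous.

End SwapGroup.

(** The domain is cut along all words of length [N]; bijectivity makes the image cylinders a
partition as well. *)
Lemma is_thompsonV_uniform (g : homeo cantor_space) N :
  (forall u, size u = N -> exists v, forall x, g (word_cat u x) = word_cat v x) ->
  is_thompsonV g.
Proof.
move=> H.
pose w (i : 'I_#|{: N.-tuple bool}|) : seq bool := enum_val i.
have wN i x : cylinder (w i) x -> mkseq x N = w i.
  move=> /asboolP; rewrite -mkseq_cylinder => /eqP; rewrite /w size_tuple.
  exact.
have wE i : exists v, forall x, g (word_cat (w i) x) = word_cat v x.
  by apply: H; rewrite size_tuple.
have [v vP] := choice wE; exists #|{: N.-tuple bool}|, w, v; split => //.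
  split.
    move=> i j _ _ [x [/= wi wj]]; apply/enum_val_inj/val_inj => /=.
    exact: etrans (esym (wN i x wi)) (wN j x wj).
  rewrite -subTset => x _.
  have sz : size (mkseq x N) == N by rewrite size_mkseq.
  exists (enum_rank (Tuple sz)) => //.
  by rewrite /w enum_rankK /=; exact: cylinder_mkseq.
have vw i x : cylinder (v i) (g x) -> cylinder (w i) x.
  move=> /cylinderP[y gx]; apply/cylinderP; exists y.
  by apply: (can_inj (homeo_funK g)); rewrite gx vP.
have cov x : exists i, cylinder (w i) x.
  have sz : size (mkseq x N) == N by rewrite size_mkseq.
  exists (enum_rank (Tuple sz)).
  by rewrite /w enum_rankK /=; exact: cylinder_mkseq.
split.
  move=> i j _ _ [x [/= wi wj]]; apply/enum_val_inj/val_inj => /=.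
  rewrite -(homeo_invK g x) in wi wj; move/vw: wi => wi; move/vw: wj => wj.
  exact: etrans (esym (wN i _ wi)) (wN j _ wj).
rewrite -subTset => x _; have [i] := cov (homeo_inv g x).
move=> /cylinderP[y e]; exists i => //; apply/cylinderP; exists y.
by rewrite -vP -e homeo_invK.
Qed.

Lemma swap_exists w z : incomparable w z ->
  exists g : thompsonV, forall x, g x = swap_fun w z x.
Proof.
move=> wz.
suff : is_thompsonV (swap_homeo wz).
  move=> /asboolP gV; have gV' : swap_homeo wz \in thompsonV_pred by exact: gV.
  by exists (ThompsonV gV').
apply: (@is_thompsonV_uniform _ (size w + size z)) => u su.
have [wu|nwu] := boolP (prefix w u).
  have /prefixP[t ->] := wu; exists (z ++ t) => x /=.
  by rewrite !word_cat_cat swap_funl.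
have [zu|nzu] := boolP (prefix z u).
  have /prefixP[t ->] := zu; exists (w ++ t) => x /=.
  by rewrite !word_cat_cat swap_funr.
have out v : (size v <= size u)%N -> ~~ prefix v u -> forall x, ~ cylinder v (word_cat u x).
  move=> vu nvu x vx; have := cylinder_prefix vx (@cylinder_word_cat u x).
  rewrite (negbTE nvu) /= => /prefixP[t e]; move: nvu; rewrite e.
  have : size t = 0%N by move: vu; rewrite e size_cat -{2}[size u]addn0 leq_add2l leqn0 => /eqP.
  by move/size0nil => ->; rewrite cats0 prefix_refl.
by exists u => x /=; apply: swap_fun_out; apply: out; rewrite // su ?leq_addr ?leq_addl.
Qed.

End Swap.

(** * The action of V on the Cantor set *)

Section ThompsonVGeometry.
Implicit Types (x y : cantor_space) (w z : seq bool).
Local Open Scope group_scope.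
Let b := cantor_action.

Lemma cantor_faithful : faithful cantor_action.
Proof. by move=> g g1; apply/val_inj/homeo_ext => x; exact: g1. Qed.

Definition cylinders : set (set cantor_space) := range cylinder.

(** An arbitrary filler, used to name a point of a given cylinder. *)
Definition zeros : cantor_space := fun=> false.

(** This is the standard generator of F acting on the cylinder of [w], written as a product of
two swaps. It contracts the left half towards its end and expands the right half. *)
Lemma contraction_exists w : exists u, [/\ rist b (cylinder w) u,
  forall x, b u (word_cat (w ++ [:: false]) x) = word_cat (w ++ [:: false; false]) x,
  forall x, b u (word_cat (w ++ [:: true; false]) x) = word_cat (w ++ [:: true]) x &
  forall x, b u (word_cat (w ++ [:: true; true]) x) = word_cat (w ++ [:: false; true]) x].
Proof.
have i1 : incomparable (w ++ [:: false]) (w ++ [:: true; false]).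
  exact: incomparable_tail.
have i2 : incomparable (w ++ [:: false]) (w ++ [:: true]).
  exact: incomparable_tail.
have [g gE] := swap_exists i1; have [h hE] := swap_exists i2.
have split1 c d x : word_cat (w ++ [:: c; d]) x = word_cat (w ++ [:: c]) (word_cat [:: d] x).
  by rewrite -word_cat_cat -catA.
exists (h * g); split.
- move=> x nx; rewrite actM /b /=.
  have out s : ~ cylinder (w ++ s) x by move=> /cylinder_cat.
  by rewrite gE swap_fun_out// hE swap_fun_out.
- by move=> x; rewrite actM /b /= gE swap_funl hE !split1 swap_funr.
- by move=> x; rewrite actM /b /= gE swap_funr// hE swap_funl.
- move=> x; rewrite actM /b /= gE swap_fun_out; first by rewrite hE !split1 swap_funr.
    move=> /incomparable_disjoint/(_ (@cylinder_word_cat _ _)); apply.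
    exact: incomparable_tail.
  move=> /incomparable_disjoint/(_ (@cylinder_word_cat _ _)); apply.
  exact: incomparable_tail.
Qed.

Lemma contraction_iter w u x n :
  (forall x, b u (word_cat (w ++ [:: false]) x) = word_cat (w ++ [:: false; false]) x) ->
  b (u ^+ n) (word_cat (w ++ [:: false]) x) = word_cat (w ++ nseq n.+1 false) x.
Proof.
move=> uE; elim: n => [|n IH]; first by rewrite act1.
rewrite expgS actM IH (catA w [:: false] (nseq n false)) word_cat_cat uE.
by rewrite -word_cat_cat -catA.
Qed.

Lemma cylinder_system : cell_system b setT cylinders.
Proof.
split => //.
- by move=> _ [w _ <-]; exact: cylinder_open.
- by move=> _ [w _ <-]; exists (word_cat w zeros); exact: cylinder_word_cat.
- move=> U oU [x Ux]; have [n sub] := cylinder_sub_open oU Ux.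
  by exists (cylinder (mkseq x n)) => //; exists (mkseq x n).
- move=> _ [w _ <-]; have [u [uw u0 u1 u2]] := contraction_exists w.
  exists u, (cylinder (w ++ [:: false; true])); split => //.
  + by exists (w ++ [:: false; true]).
  + exact: cylinder_cat.
  + move=> n _ /cylinderP[y ->].
    rewrite (catA w [:: false] [:: true]) word_cat_cat (contraction_iter _ _ u0).
    rewrite (catA w [:: false; false] (nseq n false)) word_cat_cat -catA.
    move=> /incomparable_disjoint/(_ (@cylinder_word_cat _ _)); apply.
    exact: incomparable_tail.
Qed.

(** The repelling fixed point of the contraction of the whole space. *)
Definition cantor_base : cantor_space := word_cat [:: true] zeros.

Lemma cantor_orbit W : cylinders W -> exists g, W (b g cantor_base).
Proof.
move=> [w _ <-]; pose p := mkseq cantor_base (size w).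
have [e|/eqP ne] := eqVneq p w.
  by exists 1; rewrite act1 -e; exact: cylinder_mkseq.
have [g gE] : exists g : thompsonV, forall x, g x = swap_fun p w x.
  by apply: swap_exists; apply: size_incomparable ne; rewrite size_mkseq.
exists g; rewrite /b /= gE (word_catE (@cylinder_mkseq cantor_base (size w))).
by rewrite -/p swap_funl; exact: cylinder_word_cat.
Qed.

(** Powers of the contraction push everything outside a neighbourhood of its repelling point
into the cylinder of 0, then into the cylinder of a long word of zeros, which a swap carries
into [W]. *)
Lemma cantor_compress U W : open U -> U cantor_base -> cylinders W ->
  exists g, forall x, ~ U x -> W (b g x).
Proof.
move=> oU U0 [w _ <-].
have [m sub] := cylinder_sub_open oU U0.
have {}sub : cylinder (true :: nseq m false) `<=` U.
  move=> x /cylinderP[y ->]; apply/sub/cylinder_mkseqE => i im.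
  rewrite /cantor_base /word_cat /= size_nseq (leq_trans im (leqnSn m)).
  by case: i im => [|i] _ //=; rewrite nth_nseq if_same.
have [u [_ u0 u1 u2]] := contraction_exists [::].
have cases x : [\/ exists y, x = word_cat [:: false] y,
    exists y, x = word_cat [:: true; false] y | exists y, x = word_cat [:: true; true] y].
  case x0: (x 0%N); last first.
    by constructor 1; apply/cylinderP => -[].
  case x1: (x 1%N); [constructor 3|constructor 2]; apply/cylinderP;
    by case=> [|[|]].
have um n x : ~ cylinder (true :: nseq n false) x -> cylinder [:: false] (b (u ^+ n) x).
  elim: n x => [|n IH] x nx.
    rewrite act1; case: (cases x) => -[y xE].
    - by rewrite xE; exact: cylinder_word_cat.
    - by case: nx; rewrite xE (word_cat_cat [:: true] [:: false]); exact: cylinder_word_cat.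
    - by case: nx; rewrite xE (word_cat_cat [:: true] [:: true]); exact: cylinder_word_cat.
  rewrite expgSr actM; apply: IH; case: (cases x) => -[y xE].
  - by rewrite xE u0 => /(_ 0%N isT).
  - rewrite xE u1 => /cylinderP[y']; rewrite (word_cat_cat [:: true] (nseq n false)).
    move=> /word_cat_inj yE; apply: nx; apply/cylinderP; exists y'.
    by rewrite xE yE -word_cat_cat.
  - by rewrite xE u2 => /(_ 0%N isT).
(* [nseq k false] and [w ++ [:: true]] have the same length and differ *)
pose k := (size w).+1.
have [g gE] : exists g : thompsonV, forall x, g x = swap_fun (nseq k false) (w ++ [:: true]) x.
  apply: swap_exists; apply: size_incomparable.
    by rewrite size_nseq size_cat addn1.
  move=> /(congr1 (fun s => nth false s (size w))).
  by rewrite nth_nseq leqnn nth_cat ltnn subnn.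
exists (g * u ^+ k * u ^+ m) => x nUx; rewrite !actM.
have /um/cylinderP[y ->] : ~ cylinder (true :: nseq m false) x by move=> /sub.
rewrite (contraction_iter (w := [::]) _ _ u0) cat0s.
have -> : nseq k.+1 false = nseq k false ++ [:: false] by rewrite -(nseqD k 1) addn1.
by rewrite word_cat_cat /b /= gE swap_funl word_cat_cat; exact: cylinder_word_cat.
Qed.

Lemma agreeW m n x y : (m <= n)%N -> agree n x y -> agree m x y.
Proof. by move=> mn xy i lt; apply: xy; exact: leq_trans mn. Qed.

Lemma separating_length x y : x <> y -> exists n, forall m, (n <= m)%N ->
  mkseq x m <> mkseq y m.
Proof.
move=> xy; apply: contrapT => /forallNP H; apply: xy; apply/funext => i.
have /existsNP[m /not_implyP[im /contrapT e]] := H i.+1.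
have : agree m x y by apply/cylinder_mkseqE; rewrite e; exact: cylinder_mkseq.
by apply.
Qed.

(** Near [x], the commutator of the exchange of [x] with [y] in [U] and of the exchange of [x]
with [z] sends [x] to [z], which the first exchange ignores, then back to [x] and on to [y]. *)
Lemma cantor_spread x x' U : x <> x' -> open U -> U !=set0 ->
  exists V g h, [/\ open V, V x', rist b (~` V) g, rist b (~` V) h &
    U (b [~ g, h] x)].
Proof.
move=> xx' oU [z0 Uz0]; have [k sub] := cylinder_sub_open oU Uz0.
have cC : cylinders (cylinder (mkseq z0 k)) by exists (mkseq z0 k).
have [y Cy yx] := cell_avoid cylinder_system [:: x; x'] cC.
have [z Cz zx] := cell_avoid cylinder_system [:: x; x'; y] cC.
have neq (s : seq cantor_space) u v : u \notin s -> v \in s -> u <> v.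
  by move=> us vs e; move: us; rewrite e vs.
have yx' : y <> x' by apply: neq yx _; rewrite !inE eqxx orbT.
have {}yx : y <> x by apply: neq yx _; rewrite !inE eqxx.
have zy : z <> y by apply: neq zx _; rewrite !inE eqxx !orbT.
have zx' : z <> x' by apply: neq zx _; rewrite !inE eqxx !orbT.
have {}zx : z <> x by apply: neq zx _; rewrite !inE eqxx.
have [n1 H1] := separating_length xx'.
have [n2 H2] := separating_length yx.
have [n3 H3] := separating_length yx'.
have [n4 H4] := separating_length zx.
have [n5 H5] := separating_length zx'.
have [n6 H6] := separating_length zy.
pose N := (k + n1 + n2 + n3 + n4 + n5 + n6)%N.
have inc s t : mkseq s N <> mkseq t N -> incomparable (mkseq s N) (mkseq t N).
  by apply: size_incomparable; rewrite !size_mkseq.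
have i1 : incomparable (mkseq x N) (mkseq x' N) by apply/inc/H1; rewrite /N; lia.
have i2 : incomparable (mkseq y N) (mkseq x N) by apply/inc/H2; rewrite /N; lia.
have i3 : incomparable (mkseq y N) (mkseq x' N) by apply/inc/H3; rewrite /N; lia.
have i4 : incomparable (mkseq z N) (mkseq x N) by apply/inc/H4; rewrite /N; lia.
have i5 : incomparable (mkseq z N) (mkseq x' N) by apply/inc/H5; rewrite /N; lia.
have i6 : incomparable (mkseq z N) (mkseq y N) by apply/inc/H6; rewrite /N; lia.
have i2' : incomparable (mkseq x N) (mkseq y N) by rewrite incomparableC.
have i4' : incomparable (mkseq x N) (mkseq z N) by rewrite incomparableC.
have i6' : incomparable (mkseq y N) (mkseq z N) by rewrite incomparableC.
have [g gE] := swap_exists i2'.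
have [h hE] := swap_exists i4'.
have supp u w' : incomparable u (mkseq x' N) -> incomparable w' (mkseq x' N) ->
    forall t, ~ (~` cylinder (mkseq x' N)) t -> swap_fun u w' t = t.
  move=> iu iw t /contrapT x't; apply: swap_fun_out => ct.
    exact: incomparable_disjoint iu ct x't.
  exact: incomparable_disjoint iw ct x't.
have gV : b g^-1 =1 b g.
  by move=> t; apply: (act_inj (a := b) (g := g)); rewrite actVK /b /= !gE swap_funK.
have hV : b h^-1 =1 b h.
  by move=> t; apply: (act_inj (a := b) (g := h)); rewrite actVK /b /= !hE swap_funK.
exists (cylinder (mkseq x' N)), g, h; split.
- exact: cylinder_open.
- exact: cylinder_mkseq.
- by move=> t nt; rewrite /b /= gE; exact: supp.
- by move=> t nt; rewrite /b /= hE; exact: supp.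
rewrite /commg conjgE !actM hV gV (word_catE (@cylinder_mkseq x N)).
set t := (fun i => _).
have -> : b h (word_cat (mkseq x N) t) = word_cat (mkseq z N) t.
  by rewrite /b /= hE swap_funl.
have -> : b g (word_cat (mkseq z N) t) = word_cat (mkseq z N) t.
  rewrite /b /= gE; apply: swap_fun_out.
    by move=> /incomparable_disjoint/(_ (@cylinder_word_cat _ _)); exact.
  by move=> /incomparable_disjoint/(_ (@cylinder_word_cat _ _)); exact.
have -> : b h (word_cat (mkseq z N) t) = word_cat (mkseq x N) t.
  by rewrite /b /= hE swap_funr.
have -> : b g (word_cat (mkseq x N) t) = word_cat (mkseq y N) t.
  by rewrite /b /= gE swap_funl.
apply: sub; move: (@cylinder_word_cat (mkseq y N) t) => /cylinder_mkseqE yt.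
apply: cylinder_agree Cy; apply: agreeW yt; rewrite size_mkseq /N; lia.
Qed.

End ThompsonVGeometry.

(** * Generation of V by swaps *)

Section CylinderLists.
Implicit Types (x y : cantor_space) (w z u v : seq bool) (ws : seq (seq bool)).

Definition in_cylinder x w := `[< cylinder w x >].

(** A partition into cylinders given by a list of words; counting makes the removal of two
siblings and the insertion of their parent a matter of arithmetic. *)
Definition cylinder_cover_once ws := forall x, count (in_cylinder x) ws = 1%N.

Lemma once_mem ws x : cylinder_cover_once ws -> exists2 w, w \in ws & cylinder w x.
Proof.
move=> /(_ x) c1; have : has (in_cylinder x) ws by rewrite has_count c1.
by move=> /hasP[w wws /asboolP]; exists w.
Qed.

Lemma once_inj ws u v x : cylinder_cover_once ws -> u \in ws -> v \in ws ->
  cylinder u x -> cylinder v x -> u = v.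
Proof.
move=> /(_ x) c1 uws vws ux vx; apply: contrapT => /eqP uv.
have := c1; rewrite (permP (perm_to_rem uws)) /= /in_cylinder asboolT//.
have : has (in_cylinder x) (rem u ws).
  apply/hasP; exists v; last exact/asboolP.
  move: vws; rewrite (perm_mem (perm_to_rem uws)) inE eq_sym.
  by rewrite (negbTE uv).
by rewrite has_count; case: count.
Qed.

Lemma once_incomparable ws u v : cylinder_cover_once ws -> u \in ws -> v \in ws ->
  u <> v -> incomparable u v.
Proof.
move=> c1 uws vws uv; apply/negPn/negP; rewrite negb_and !negbK => /orP[] /prefixP[t e].
  apply: uv; apply: (once_inj (x := word_cat v zeros) c1) => //.
    by rewrite e word_cat_cat; exact: cylinder_word_cat.
  exact: cylinder_word_cat.
apply: uv; apply: (once_inj (x := word_cat u zeros) c1) => //.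
  exact: cylinder_word_cat.
by rewrite e word_cat_cat; exact: cylinder_word_cat.
Qed.

Lemma word_cat_rcons w x :
  word_cat w x = word_cat (rcons w (x 0%N)) (fun i => x i.+1).
Proof.
rewrite -cats1 word_cat_cat; congr word_cat.
by apply/funext => -[|i]; rewrite /word_cat //= subn1.
Qed.

Lemma cut_cylinder u x : cylinder u x -> exists d y, x = word_cat (u ++ [:: d]) y.
Proof.
move=> /cylinderP[y ->]; exists (y 0%N), (fun i => y i.+1).
by rewrite cats1 -word_cat_rcons.
Qed.

Lemma max_size (ws : seq (seq bool)) : (0 < size ws)%N ->
  exists2 w, w \in ws & forall u, u \in ws -> (size u <= size w)%N.
Proof.
elim: ws => // w [|w' ws] IH _.
  by exists w; rewrite ?inE// => u; rewrite inE => /eqP->.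
have [//|m mws mmax] := IH; have [le|lt] := leqP (size w) (size m).
  exists m; first by rewrite inE mws orbT.
  by move=> u; rewrite inE => /predU1P[->//|]; exact: mmax.
exists w; first exact: mem_head.
move=> u; rewrite inE => /predU1P[->//|/mmax um].
exact: leq_trans um (ltnW lt).
Qed.

(** Take a word of maximal length and flip its last letter. A member of the list that meets the
cylinder of the new word is not longer, and if it were shorter it would contain the cylinder
of the first word. *)
Lemma siblings ws : cylinder_cover_once ws -> (1 < size ws)%N ->
  exists v, rcons v false \in ws /\ rcons v true \in ws.
Proof.
move=> c1 s2; have [|w wws wmax] := max_size (ws := ws); first exact: ltnW.
case/lastP: w wws wmax => [|v c] wws wmax.
  have : all (in_cylinder zeros) ws.
    by apply/allP => u /wmax; rewrite leqn0 => /nilP ->; apply/asboolP.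
  by rewrite all_count (c1 zeros) => /eqP e; rewrite -e in s2.
suff : rcons v (~~ c) \in ws.
  by exists v; case: (c) wws H => /= ? ?.
have [u uws ux] := once_mem (word_cat (rcons v (~~ c)) zeros) c1.
have us := wmax u uws; rewrite size_rcons in us.
have eqs t : prefix u t || prefix t u -> size t = size u -> u = t.
  by move=> + e; rewrite !prefixE e take_size -{1}e take_size => /orP[] /eqP.
have := cylinder_prefix ux (@cylinder_word_cat _ _).
move=> pre; case: (ltngtP (size u) (size v).+1) us => // [lt|e] _.
  have uv : prefix u v.
    move: pre => /orP[]; last by move/size_prefix; rewrite size_rcons leqNgt lt.
    by rewrite prefixE -cats1 takel_cat// -prefixE.
  have uw : u = rcons v c.
    apply: (once_inj (x := word_cat (rcons v c) zeros) c1) => //.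
      move/prefixP: uv => [t ->]; rewrite -cats1 -catA word_cat_cat.
      exact: cylinder_word_cat.
    exact: cylinder_word_cat.
  by move: lt; rewrite uw size_rcons ltnn.
by rewrite -(eqs _ pre)// size_rcons.
Qed.

End CylinderLists.

Lemma word_cat0 x : word_cat [::] x = x.
Proof. by apply/funext => i; rewrite /word_cat /= subn0. Qed.

Lemma swap_fun_catl w z u x : swap_fun w z (word_cat (w ++ u) x) = word_cat (z ++ u) x.
Proof. by rewrite !word_cat_cat swap_funl. Qed.

Lemma swap_fun_catr w z u x : incomparable w z ->
  swap_fun w z (word_cat (z ++ u) x) = word_cat (w ++ u) x.
Proof. by move=> wz; rewrite !word_cat_cat swap_funr. Qed.

Section ThompsonVPerfect.
Local Open Scope group_scope.
Let b := cantor_action.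
Variable S : set thompsonV.
Hypotheses (SM : forall g h, S g -> S h -> S (g * h)).
Hypotheses (SV : forall g, S g -> S g^-1).
Hypothesis SR : forall U, open U -> U !=set0 -> forall g h,
  rist b (~` U) g -> rist b (~` U) h -> S [~ g, h].
Implicit Types (g h : thompsonV) (x y : cantor_space) (w z u v : seq bool).

Lemma thompsonV_one_in : S 1.
Proof.
rewrite -(commg1 (1 : thompsonV)); apply: (@SR setT); first exact: openT.
- by exists zeros.
- exact: rist1.
- exact: rist1.
Qed.

Definition is_swap g w z := forall x, g x = swap_fun w z x.

(** Let [s] exchange the left halves of the two cylinders, and let [c] exchange the halves of
each of them. Then [c] conjugates [s] to the exchange of the right halves, so the commutator
of [s] and [c] exchanges the cylinders. All elements involved are trivial on the third
cylinder. *)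
Lemma small_swap_in g w z o : incomparable w z -> incomparable w o ->
  incomparable z o -> is_swap g w z -> S g.
Proof.
move=> wz wo zo gE.
have i0 : incomparable (w ++ [:: false]) (z ++ [:: false]) by exact: incomparable_cat.
have i1 : incomparable (w ++ [:: false]) (w ++ [:: true]) by exact: incomparable_tail.
have i2 : incomparable (z ++ [:: false]) (z ++ [:: true]) by exact: incomparable_tail.
have [s sE] := swap_exists i0; have [c1 c1E] := swap_exists i1.
have [c2 c2E] := swap_exists i2.
have off u v t y : incomparable t u -> incomparable t v ->
    swap_fun u v (word_cat t y) = word_cat t y.
  by move=> tu tv; apply: swap_fun_out => ty;
    [apply: incomparable_disjoint tu _ ty|apply: incomparable_disjoint tv _ ty];
    exact: cylinder_word_cat.
have wz' d e : incomparable (w ++ d) (z ++ e) by exact: incomparable_cat.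
have zw' d e : incomparable (z ++ d) (w ++ e) by rewrite incomparableC.
pose c := c1 * c2.
have cw d y : b c (word_cat (w ++ [:: d]) y) = word_cat (w ++ [:: ~~ d]) y.
  rewrite /c actM /b /= c2E off// c1E.
  by case: d => /=; [rewrite swap_funr|rewrite swap_funl].
have cz d y : b c (word_cat (z ++ [:: d]) y) = word_cat (z ++ [:: ~~ d]) y.
  rewrite /c actM /b /= c2E.
  by case: d => /=; [rewrite swap_funr|rewrite swap_funl]; rewrite // c1E off.
have ncat u d x : ~ cylinder u x -> ~ cylinder (u ++ d) x by move=> nu /cylinder_cat.
have cout x : ~ cylinder w x -> ~ cylinder z x -> b c x = x.
  move=> nw nz; rewrite /c actM /b /= c2E swap_fun_out; try exact: ncat.
  by rewrite c1E swap_fun_out; try exact: ncat.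
clearbody c; have cK x : b c^-1 x = b c x.
  apply: (act_inj (a := b) (g := c)); rewrite actVK.
  have [/cut_cylinder[d [y ->]]|nw] := pselect (cylinder w x); first by rewrite !cw negbK.
  have [/cut_cylinder[d [y ->]]|nz] := pselect (cylinder z x); first by rewrite !cz negbK.
  by rewrite !cout.
have sK x : b s^-1 x = b s x.
  by apply: (act_inj (a := b) (g := s)); rewrite actVK /b /= !sE swap_funK.
have sw1 y : b s (word_cat (w ++ [:: true]) y) = word_cat (w ++ [:: true]) y.
  by rewrite /b /= sE off// incomparable_tail.
have sz1 y : b s (word_cat (z ++ [:: true]) y) = word_cat (z ++ [:: true]) y.
  by rewrite /b /= sE off// incomparable_tail.
have sw0 y : b s (word_cat (w ++ [:: false]) y) = word_cat (z ++ [:: false]) y.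
  by rewrite /b /= sE swap_funl.
have sz0 y : b s (word_cat (z ++ [:: false]) y) = word_cat (w ++ [:: false]) y.
  by rewrite /b /= sE swap_funr.
have sout x : ~ cylinder w x -> ~ cylinder z x -> b s x = x.
  by move=> nw nz; rewrite /b /= sE swap_fun_out; try exact: ncat.
have -> : g = [~ s, c].
  apply: (faithful_inj cantor_faithful) => x.
  rewrite /commg conjgE !actM cK sK [LHS]gE -/b.
  have [/cut_cylinder[[] [y ->]]|nw] := pselect (cylinder w x).
  - by rewrite swap_fun_catl (cw true) sw0 (cz false) sz1.
  - by rewrite swap_fun_catl (cw false) sw1 (cw true) sw0.
  have [/cut_cylinder[[] [y ->]]|nz] := pselect (cylinder z x).
  - by rewrite swap_fun_catr// (cz true) sz0 (cw false) sw1.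
  - by rewrite swap_fun_catr// (cz false) sz1 (cz true) sz0.
  by rewrite swap_fun_out// cout// sout// cout// sout.
apply: (@SR (cylinder o)); first exact: cylinder_open.
- by exists (word_cat o zeros); exact: cylinder_word_cat.
- move=> x /contrapT ox; apply: sout => tx.
    exact: incomparable_disjoint wo tx ox.
  exact: incomparable_disjoint zo tx ox.
- move=> x /contrapT ox; apply: cout => tx.
    exact: incomparable_disjoint wo tx ox.
  exact: incomparable_disjoint zo tx ox.
Qed.

(** Two cylinders that cover the space leave no room for a third one, but their halves do. *)
Lemma swap_in g w z : incomparable w z -> is_swap g w z -> S g.
Proof.
move=> wz gE.
have wz' d e : incomparable (w ++ d) (z ++ e) by exact: incomparable_cat.
have zw' d e : incomparable (z ++ d) (w ++ e) by rewrite incomparableC.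
have [s0 s0E] := swap_exists (wz' [:: false] [:: false]).
have [s1 s1E] := swap_exists (wz' [:: true] [:: true]).
have Ss0 : S s0.
  by apply: (@small_swap_in s0 _ _ (w ++ [:: true]) _ _ _ s0E) => //; exact: incomparable_tail.
have Ss1 : S s1.
  by apply: (@small_swap_in s1 _ _ (w ++ [:: false]) _ _ _ s1E) => //; exact: incomparable_tail.
suff -> : g = s1 * s0 by exact: SM.
apply: (faithful_inj cantor_faithful) => x; rewrite actM /= gE s1E s0E.
have off u v t y : incomparable t u -> incomparable t v ->
    swap_fun u v (word_cat t y) = word_cat t y.
  by move=> tu tv; apply: swap_fun_out => ty;
    [apply: incomparable_disjoint tu _ ty|apply: incomparable_disjoint tv _ ty];
    exact: cylinder_word_cat.
have [/cut_cylinder[d [y ->]]|nw] := pselect (cylinder w x).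
  rewrite swap_fun_catl; case: d.
    by rewrite (off (w ++ [:: false])) ?swap_funl// incomparable_tail.
  by rewrite swap_funl off// incomparable_tail.
have [/cut_cylinder[d [y ->]]|nz] := pselect (cylinder z x).
  rewrite swap_fun_catr//; case: d.
    by rewrite (off (w ++ [:: false])) ?swap_funr// incomparable_tail.
  by rewrite (swap_funr (wz' _ _)) off// incomparable_tail.
have ncat u d : ~ cylinder u x -> ~ cylinder (u ++ d) x by move=> nu /cylinder_cat.
by do 3?[rewrite swap_fun_out]; try exact: ncat.
Qed.

(** Both the domain and the image partition contain two siblings. After composition with at
most two swaps the siblings of the domain go, in order, to those of the image; merging them
shortens the table. *)
Lemma table_in n ws (f : seq bool -> seq bool) g : size ws = n ->
  cylinder_cover_once ws ->
  (forall w, w \in ws -> forall x, g (word_cat w x) = word_cat (f w) x) -> S g.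
Proof.
elim: n ws f g => [|n IH] ws f g sz c1 gE.
  by move/size0nil: sz c1 => -> /(_ zeros).
have [n0|n0] := posnP n.
  have [w wsE] : exists w, ws = [:: w].
    by case: ws sz {c1 gE} => [|w [|]] //; [exists w|rewrite n0].
  have gw := gE w; rewrite wsE mem_head in gw.
  have nil_of u : (forall x, cylinder u x) -> u = [::].
    case: u => // c u /(_ (fun=> ~~ c)) /(_ 0%N isT) /= /esym.
    by case: (c).
  have w0 : w = [::].
    apply: nil_of => x; have [u + ux] := once_mem x c1.
    by rewrite wsE inE => /eqP <-.
  have fw0 : f w = [::].
    apply: nil_of => x; have := gw isT (homeo_inv g x).
    rewrite w0 word_cat0 homeo_invK -w0 => ->; exact: cylinder_word_cat.
  suff -> : g = 1 by exact: thompsonV_one_in.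
  apply: (faithful_inj cantor_faithful) => x.
  by rewrite act1 /=; have := gw isT x; rewrite fw0 w0 word_cat0.
have image_once (h : thompsonV) (k : seq bool -> seq bool) :
    (forall w, w \in ws -> forall x, h (word_cat w x) = word_cat (k w) x) ->
    cylinder_cover_once (map k ws).
  move=> hE x; rewrite -[x](homeo_invK h) count_map -[RHS](c1 (homeo_inv h x)).
  apply: eq_in_count => w wws /=; apply/asbool_equiv_eq; split=> /cylinderP[y e].
    apply/cylinderP; exists y; apply: (can_inj (homeo_funK h)).
    by rewrite e hE.
  by rewrite e -/(h _) hE//; exact: cylinder_word_cat.
have image_inj (h : thompsonV) (k : seq bool -> seq bool) :
    (forall w, w \in ws -> forall x, h (word_cat w x) = word_cat (k w) x) ->
    {in ws &, injective k}.
  move=> hE u v uws vws kuv.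
  have e : word_cat u zeros = word_cat v zeros.
    by apply: (can_inj (homeo_funK h)); rewrite -!/(h _) !hE// kuv.
  apply: (once_inj (x := word_cat u zeros) c1) => //; first exact: cylinder_word_cat.
  by rewrite e; exact: cylinder_word_cat.
(* a swap makes [u] go where [v] went *)
have fix_up (h : thompsonV) (k : seq bool -> seq bool) u v :
    (forall w, w \in ws -> forall x, h (word_cat w x) = word_cat (k w) x) ->
    u \in ws -> v \in ws -> exists s k', [/\ S s,
      forall w, w \in ws -> forall x, (s * h : thompsonV) (word_cat w x) = word_cat (k' w) x,
      k' u = k v, (forall w, w <> u -> w <> v -> k' w = k w) & k' v = k u].
  move=> hE uws vws; have [<-|/eqP uv] := eqVneq u v.
    by exists 1, k; split => //; exact: thompsonV_one_in.
  have kc1 := image_once h k hE; have kI := image_inj h k hE.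
  have inc : incomparable (k u) (k v).
    apply: (once_incomparable kc1); try exact: map_f.
    by move/kI => /(_ uws vws).
  have [s sE] := swap_exists inc.
  exists s, (fun w => if w == u then k v else if w == v then k u else k w); split.
  - exact: swap_in inc sE.
  - move=> w wws x; rewrite -[LHS]/(s (h _)) hE// sE.
    case: eqP => [->|wu]; first exact: swap_funl.
    case: eqP => [->|wv]; first exact: swap_funr.
    have kwu : k w <> k u by move=> e; apply: wu; exact: kI.
    have kwv : k w <> k v by move=> e; apply: wv; exact: kI.
    have kwx := @cylinder_word_cat (k w) x; have kwm := map_f k wws.
    apply: swap_fun_out => kx; [apply: kwu|apply: kwv].
      exact: once_inj kc1 kwm (map_f k uws) kwx kx.
    exact: once_inj kc1 kwm (map_f k vws) kwx kx.
  - by rewrite eqxx.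
  - by move=> w /eqP/negbTE -> /eqP/negbTE ->.
  - by case: eqP => [e|_]; rewrite ?eqxx // -e.
have [|v [v0 v1]] := siblings c1; first by rewrite sz ltnS.
have [|t [t0 t1]] := siblings (image_once g f gE).
  by rewrite size_map sz ltnS.
have [c cws ct] := mapP t0; have [d dws dt] := mapP t1.
have neq01 u : rcons u false <> rcons u true by move=> /rcons_inj[].
have [s [k [Ss kE kv0 kother kc]]] := fix_up g f _ _ gE v0 cws.
have [d' d'ws kd'] : exists2 d', d' \in ws & k d' = rcons t true.
  have [dv|/eqP dv] := eqVneq d (rcons v false); first by exists c; rewrite // kc -dv -dt.
  exists d => //; rewrite kother// ?dt//.
  by move=> dc; apply: (neq01 t); rewrite dt ct dc.
have kI := image_inj _ k kE.
have [s' [l [Ss' lE lv1 lother _]]] := fix_up _ k _ _ kE v1 d'ws.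
have lv0 : l (rcons v false) = rcons t false.
  rewrite lother ?kv0 ?ct//.
  by move=> e; apply: (neq01 t); rewrite ct -kv0 e kd'.
have {}lv1 : l (rcons v true) = rcons t true by rewrite lv1.
pose ws' := rem (rcons v true) (rem (rcons v false) ws).
have v1' : rcons v true \in rem (rcons v false) ws.
  move: v1; rewrite (perm_mem (perm_to_rem v0)) inE => /orP[/eqP e|//].
  by case: (neq01 v).
have pws : perm_eq ws [:: rcons v false, rcons v true & ws'].
  by rewrite (perm_trans (perm_to_rem v0))// perm_cons; exact: perm_to_rem.
have vE x c' : in_cylinder x (rcons v c') = in_cylinder x v && (x (size v) == c').
  apply/idP/andP => [/asboolP vx|[/asboolP vx /eqP xc]].
    split; first by apply/asboolP; rewrite -cats1 in vx; exact: cylinder_cat vx.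
    by rewrite vx ?size_rcons// nth_rcons ltnn eqxx.
  apply/asboolP => i; rewrite size_rcons ltnS leq_eqVlt nth_rcons.
  by move=> /predU1P[->|iv]; rewrite ?ltnn ?eqxx// iv vx.
have vws' : v \notin ws'.
  apply/negP => vws'; have vws : v \in ws.
    by rewrite (perm_mem pws) !inE vws' !orbT.
  have : v = rcons v false.
    apply: (once_inj (x := word_cat (rcons v false) zeros) c1) => //.
      by rewrite -cats1; exact/cylinder_cat/cylinder_word_cat.
    exact: cylinder_word_cat.
  by move/(congr1 size); rewrite size_rcons; lia.
have Sg : S (s' * (s * g)).
  apply: (IH (v :: ws') (fun u => if u == v then t else l u)).
  - by have := perm_size pws; rewrite sz /= => -[->].
  - move=> x; rewrite -[RHS](c1 x) (permP pws) /= !vE addnA; congr addn.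
    by case: in_cylinder; case: (x _).
  - move=> w; rewrite inE => /predU1P[->|wws'] x.
      rewrite eqxx !(word_cat_rcons _ x).
      case: (x 0%N); [rewrite -lv1|rewrite -lv0]; exact: lE.
    case: eqP => [e|_]; first by move: vws'; rewrite -e wws'.
    by apply: lE; rewrite (perm_mem pws) !inE wws' !orbT.
have -> : g = s^-1 * (s'^-1 * (s' * (s * g))) by rewrite !mulKg.
by apply: SM; [exact: SV|apply: SM; [exact: SV|]].
Qed.

Lemma thompsonV_in g : S g.
Proof.
have /asboolP[n [w [z [[tw cw] _ gE]]]] : thompsonV_val g \in thompsonV_pred := valP g.
have E u : exists v, forall i, w i = u -> forall x, g (word_cat u x) = word_cat v x.
  have [[i <-]|ni] := pselect (exists i, w i = u).
    by exists (z i) => j _ x; exact: gE.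
  by exists [::] => i wi; case: ni; exists i.
have [f fE] := choice E.
apply: (@table_in _ [seq w i | i <- enum 'I_n] f g erefl).
  move=> x; rewrite count_map.
  have : [set: cantor_space] x by []. rewrite -cw => -[i0 _ xi0].
  rewrite (@eq_count _ _ (pred1 i0)) ?count_uniq_mem ?enum_uniq ?mem_enum//.
  move=> i; apply/asboolP/eqP => [xi|->//]; apply: tw => //; by exists x.
by move=> _ /mapP[i _ ->] x; apply: (fE _ i).
Qed.

End ThompsonVPerfect.

Theorem thompsonV_perfect : locally_perfect cantor_action.
Proof. by move=> S SM SV _ SR; exact: thompsonV_in. Qed.

Local Open Scope ring_scope.

(** * Dyadic piecewise linear maps *)

Section Dyadic.
Variable R : realType.
Implicit Types (x y : R) (k : int).
Local Notation dyadic := (@dyadic R).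

Lemma dyadic_int (m : int) : dyadic m%:~R.
Proof. by exists m, 0%N; rewrite expr0 divr1. Qed.

Lemma dyadicD x y : dyadic x -> dyadic y -> dyadic (x + y).
Proof.
move=> [m [n ->]] [m' [n' ->]].
exists (m * 2 ^+ n' + m' * 2 ^+ n), (n + n')%N.
rewrite exprD rmorphD !rmorphM !rmorphXn /=; field.
by rewrite !expf_neq0// pnatr_eq0.
Qed.

Lemma dyadicN x : dyadic x -> dyadic (- x).
Proof. by move=> [m [n ->]]; exists (- m), n; rewrite mulrNz mulNr. Qed.

Lemma dyadicB x y : dyadic x -> dyadic y -> dyadic (x - y).
Proof. by move=> dx dy; apply: dyadicD => //; exact: dyadicN. Qed.

Lemma dyadicM x y : dyadic x -> dyadic y -> dyadic (x * y).
Proof.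
move=> [m [n ->]] [m' [n' ->]]; exists (m * m'), (n + n')%N.
by rewrite exprD rmorphM invfM mulrACA.
Qed.

Lemma dyadic_exp k : dyadic (2 ^ k).
Proof.
case: k => n; first by exists (2 ^+ n), 0%N; rewrite rmorphXn expr0 divr1.
by exists 1, n.+1; rewrite NegzE mul1r.
Qed.

Lemma exp2_gt0 k : 0 < 2 ^ k :> R. Proof. exact: exprz_gt0. Qed.

Lemma dyadic_affine k x y : dyadic x -> dyadic y -> dyadic (2 ^ k * x + y).
Proof. by move=> dx dy; apply: dyadicD => //; apply: dyadicM => //; exact: dyadic_exp. Qed.

Lemma exp2D k l : 2 ^ (k + l) = 2 ^ k * 2 ^ l :> R.
Proof. by rewrite expfzDr// pnatr_eq0. Qed.

Lemma exp2_half k : 2 ^ k = 2 ^ (k - 1) + 2 ^ (k - 1) :> R.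
Proof. by rewrite -[in LHS](subrK 1 k) (exp2D (k - 1)) expr1z; ring. Qed.

Lemma exp2_small (e : R) : 0 < e -> exists n : nat, 2 ^ (- n%:Z) < e.
Proof.
move=> e0; exists (Num.bound e^-1); set n := Num.bound _.
have : e^-1 < 2 ^ n%:Z.
  apply: lt_le_trans (archi_boundP _) _; first by rewrite invr_ge0 ltW.
  by rewrite -exprnP -natrX ler_nat ltnW// ltn_expl.
by rewrite -invr_expz => h; rewrite -[ltRHS]invrK ltf_pV2// posrE ?exp2_gt0// invr_gt0.
Qed.

Lemma dyadic_dense x y : x < y -> exists2 z, dyadic z & x < z < y.
Proof.
move=> xy; have [n nxy] := exp2_small (e := y - x) (ltac:(by rewrite subr_gt0)).
have p2 : 0 < 2 ^ n%:Z :> R by exact: exp2_gt0.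
have := floor_itv (x * 2 ^ n%:Z); set m := Num.floor _ => /andP[mx xm].
exists ((m + 1)%:~R / 2 ^ n%:Z); first by exists (m + 1), n.
rewrite ltr_pdivlMr// xm /= ltr_pdivrMr//.
apply: (@le_lt_trans _ _ (x * 2 ^ n%:Z + 1)); first by rewrite rmorphD /= lerD2r.
rewrite -ltrBrDl -mulrBl.
by move: nxy; rewrite -(ltr_pM2r p2) -exp2D addNr expr0z.
Qed.

Lemma dyadic_common x y : dyadic x -> dyadic y -> 0 < x -> 0 < y ->
  exists (k : int) (m n : nat), x = m.+1%:R * 2 ^ k /\ y = n.+1%:R * 2 ^ k.
Proof.
have pos (m : int) n : 0 < m%:~R / 2 ^+ n :> R -> exists j : nat, m = j.+1%:Z.
  rewrite pmulr_lgt0 ?invr_gt0 ?exprn_gt0// ltr0z.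
  by case: m => // -[|j] // _; exists j.
move=> [m [n ->]] [m' [n' ->]] /pos[j ->] /pos[j' ->].
exists (- (n + n')%:Z), (j.+1 * 2 ^ n' - 1)%N, (j'.+1 * 2 ^ n - 1)%N.
rewrite !subn1 !prednK ?muln_gt0 ?expn_gt0// !natrM !natrX -!exprnN exprD.
by split; rewrite -?pmulrn; field; rewrite !expf_neq0 ?pnatr_eq0.
Qed.

(** Piecewise affine maps with slopes powers of two and dyadic breakpoints. Building them by
concatenation avoids lists of breakpoints. *)
Inductive pl (f : R -> R) : R -> R -> Prop :=
| pl_affine a b k c of a < b & dyadic a & dyadic b & dyadic c &
    (forall x, a <= x <= b -> f x = 2 ^ k * x + c) : pl f a b
| pl_cat a b c of pl f a b & pl f b c : pl f a c.

Lemma pl_lt f a b : pl f a b -> a < b.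
Proof. by elim=> // {}a {}b c _ ab _; exact: lt_trans. Qed.

Lemma pl_dyadic f a b : pl f a b -> dyadic a /\ dyadic b.
Proof. by elim=> // {}a {}b c _ [? _] _ []. Qed.

Lemma pl_homo f a b : pl f a b -> forall x y, a <= x -> x < y -> y <= b -> f x < f y.
Proof.
elim=> [{}a {}b k c _ _ _ _ fE|{}a {}b c pab IH1 pbc IH2] x y ax xy yb.
  rewrite !fE ?ax ?yb ?(ltW (lt_le_trans xy _)) ?(le_trans ax (ltW xy))//.
  by rewrite ltrD2r ltr_pM2l ?exp2_gt0.
have [yb'|by'] := leP y b; first exact: IH1.
have [bx|xb] := leP b x; first exact: IH2.
apply: (@lt_trans _ _ (f b)); first exact: IH1.
exact: IH2.
Qed.

Lemma pl_surj f a b : pl f a b -> forall y, f a <= y <= f b ->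
  exists2 x, a <= x <= b & f x = y.
Proof.
elim=> [{}a {}b k c ab _ _ _ fE|{}a {}b c pab IH1 pbc IH2] y.
  rewrite !fE ?lexx ?(ltW ab)// => /andP[ay yb].
  have ab' : a <= (y - c) / 2 ^ k <= b.
    rewrite ler_pdivlMr ?exp2_gt0// ler_pdivrMr ?exp2_gt0// ![_ * 2 ^ k]mulrC.
    by rewrite lerBrDr lerBlDr ay yb.
  exists ((y - c) / 2 ^ k) => //; rewrite fE// mulrC divfK ?subrK//.
  by rewrite gt_eqF ?exp2_gt0.
move=> /andP[ay yc]; have [yb|by'] := leP y (f b).
  have [|x /andP[ax xb] <-] := IH1 y; first by rewrite ay.
  by exists x => //; rewrite ax (le_trans xb)// ltW// (pl_lt pbc).
have [|x /andP[bx xc] <-] := IH2 y; first by rewrite yc ltW.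
by exists x => //; rewrite xc (le_trans _ bx)// ltW// (pl_lt pab).
Qed.

Lemma pl_dyadicE f a b : pl f a b -> forall x, a <= x <= b ->
  dyadic (f x) <-> dyadic x.
Proof.
elim=> [{}a {}b k c ab _ _ dc fE|{}a {}b c pab IH1 pbc IH2] x /andP[ax xb].
  rewrite fE ?ax//; split=> [H|dx]; last exact: dyadic_affine.
  rewrite (_ : x = 2 ^ (- k) * (2 ^ k * x + c) + - (2 ^ (- k) * c)).
    by apply: dyadic_affine => //; apply/dyadicN/dyadicM => //; exact: dyadic_exp.
  by rewrite mulrDr addrK mulrA -exp2D addNr expr0z mul1r.
have [xb'|bx] := leP x b; first by apply: IH1; rewrite ax.
by apply: IH2; rewrite xb ltW.
Qed.

Lemma pl_eq f g a b : pl f a b -> (forall x, a <= x <= b -> f x = g x) -> pl g a b.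
Proof.
elim=> [{}a {}b k c ab da db dc fE fg|{}a {}b c pab IH1 pbc IH2 fg].
  by apply: (pl_affine (k := k) ab da db dc) => x xab; rewrite -fg// fE.
apply: (pl_cat (b := b)); [apply: IH1|apply: IH2] => x /andP[l r]; apply: fg.
  by rewrite l (le_trans r)// ltW// (pl_lt pbc).
by rewrite r (le_trans _ l)// ltW// (pl_lt pab).
Qed.

Lemma pl_glue f g a b c : pl f a b -> pl g b c -> f b = g b ->
  exists h, [/\ pl h a c, forall x, a <= x <= b -> h x = f x &
    forall x, b <= x <= c -> h x = g x].
Proof.
move=> pf pg fg; exists (fun x => if x <= b then f x else g x).
have hf x : a <= x <= b -> (if x <= b then f x else g x) = f x.
  by move=> /andP[_ ->].
have hg x : b <= x <= c -> (if x <= b then f x else g x) = g x.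
  move=> /andP[bx _]; case: ifP => // xb.
  by have -> : x = b by apply/le_anti; rewrite xb bx.
split=> //; apply: (pl_cat (b := b)).
  by apply: pl_eq pf _ => x /hf.
by apply: pl_eq pg _ => x /hg.
Qed.

(** The list [s] contains the interior breakpoints; this is the link with the description of
elements of T by an exceptional set. *)
Lemma pl_off f a b : pl f a b -> exists s : seq R, (forall x, x \in s -> dyadic x) /\
  forall u v, u < v -> a <= u -> v <= b -> (forall x, x \in s -> ~ (u < x < v)) ->
    exists k c, forall x, u <= x <= v -> f x = 2 ^ k * x + c.
Proof.
elim=> [{}a {}b k c ab da db dc fE|{}a {}b c pab [s [sd sP]] pbc [t [td tP]]].
  exists [::]; split => // u v uv au vb _; exists k, c => x /andP[ux xv].
  by rewrite fE// (le_trans au ux) (le_trans xv vb).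
exists (b :: s ++ t); split.
  move=> x; rewrite inE mem_cat => /predU1P[->|/orP[/sd|/td]//].
  by have [] := pl_dyadic pab.
move=> u v uv au vc H.
have [vb|bv] := leP v b.
  by apply: sP => // x xs; apply: H; rewrite inE mem_cat xs orbT.
have [bu|ub] := leP b u.
  by apply: tP => // x xs; apply: H; rewrite inE mem_cat xs !orbT.
by have := H b (mem_head _ _); rewrite ub bv => /(_ isT).
Qed.

Definition pl_ends a b c d := exists f, [/\ pl f a b, f a = c & f b = d].

Lemma pl_ends_cat a b c a' b' c' :
  pl_ends a b a' b' -> pl_ends b c b' c' -> pl_ends a c a' c'.
Proof.
move=> [f [pf fa fb]] [g [pg gb gc]].
have [|h [ph hf hg]] := pl_glue pf pg; first by rewrite fb gb.
exists h; split=> //; first by rewrite hf// lexx ltW// (pl_lt pf).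
by rewrite hg// lexx ltW// (pl_lt pg).
Qed.

Lemma pl_ends_affine k a l c : 0 < l -> dyadic a -> dyadic l -> dyadic c ->
  pl_ends a (a + l) c (c + 2 ^ k * l).
Proof.
move=> l0 da dl dc; exists (fun x => 2 ^ k * x + (c - 2 ^ k * a)).
split; [|ring|ring].
apply: (pl_affine (k := k) (c := c - 2 ^ k * a)) => //.
- by rewrite ltrDl.
- exact: dyadicD.
- by apply: dyadicB => //; apply: dyadicM => //; exact: dyadic_exp.
Qed.

(** The source is halved repeatedly, and each new piece is stretched onto one interval of
length [2 ^ e]. *)
Lemma pl_ends_expand (e : int) j k a c : dyadic a -> dyadic c ->
  pl_ends a (a + 2 ^ k) c (c + j.+1%:R * 2 ^ e).
Proof.
move=> da dc; elim: j k a c da dc => [|j IH] k a c da dc.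
  have := @pl_ends_affine (e - k) a (2 ^ k) c; rewrite -exp2D subrK mul1r.
  by apply=> //; [exact: exp2_gt0|exact: dyadic_exp].
rewrite (exp2_half k) addrA -[j.+2]addn1 natrD mulrDl addrA.
apply: pl_ends_cat (IH (k - 1) _ _ da dc) _.
have := @pl_ends_affine (e - (k - 1)) (a + 2 ^ (k - 1)) (2 ^ (k - 1))
  (c + j.+1%:R * 2 ^ e).
rewrite -exp2D subrK mul1r; apply; first exact: exp2_gt0.
- by apply: dyadicD => //; exact: dyadic_exp.
- exact: dyadic_exp.
- by apply: dyadicD => //; apply: dyadicM; [exact: (dyadic_int j.+1)|exact: dyadic_exp].
Qed.

Lemma pl_ends_shrink (e : int) j k a c : dyadic a -> dyadic c ->
  pl_ends a (a + j.+1%:R * 2 ^ e) c (c + 2 ^ k).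
Proof.
move=> da dc; elim: j k a c da dc => [|j IH] k a c da dc.
  have := @pl_ends_affine (k - e) a (2 ^ e) c; rewrite -exp2D subrK mul1r.
  by apply=> //; [exact: exp2_gt0|exact: dyadic_exp].
rewrite (exp2_half k) addrA -[j.+2]addn1 natrD mulrDl addrA.
apply: pl_ends_cat (IH (k - 1) _ _ da dc) _.
have := @pl_ends_affine (k - 1 - e) (a + j.+1%:R * 2 ^ e) (2 ^ e) (c + 2 ^ (k - 1)).
rewrite -exp2D subrK mul1r; apply; first exact: exp2_gt0.
- by apply: dyadicD => //; apply: dyadicM; [exact: (dyadic_int j.+1)|exact: dyadic_exp].
- exact: dyadic_exp.
- by apply: dyadicD => //; exact: dyadic_exp.
Qed.

(** Both lengths are multiples of the same power of two. Halving the first piece of the side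
that has fewer pieces makes the numbers of pieces equal. *)
Lemma pl_ends_exists a b c d : dyadic a -> dyadic b -> dyadic c -> dyadic d ->
  a < b -> c < d -> pl_ends a b c d.
Proof.
move=> da db dc dd ab cd.
have [e [m [n [abE cdE]]]] : exists (k : int) (m n : nat),
    b - a = m.+1%:R * 2 ^ k /\ d - c = n.+1%:R * 2 ^ k.
  by apply: dyadic_common; rewrite ?subr_gt0//; exact: dyadicB.
have -> : b = a + m.+1%:R * 2 ^ e by rewrite -abE addrC subrK.
have -> : d = c + n.+1%:R * 2 ^ e by rewrite -cdE addrC subrK.
have step j : dyadic (j%:R * 2 ^ e).
  by apply: dyadicM; [exact: (dyadic_int j)|exact: dyadic_exp].
have shift j a' c' : dyadic a' -> dyadic c' ->
    pl_ends a' (a' + j.+1%:R * 2 ^ e) c' (c' + j.+1%:R * 2 ^ e).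
  move=> da' dc'; rewrite -[in X in pl_ends _ _ _ X](mul1r (j.+1%:R * 2 ^ e)).
  apply: (@pl_ends_affine 0) => //.
  by rewrite mulr_gt0 ?exp2_gt0.
have e1 i : i.+2%:R = 1 + i.+1%:R :> R by rewrite nat1r.
have e2 i j : (i.+1 + j).+1%:R = j.+1%:R + i.+1%:R :> R by rewrite -natrD; congr _%:R; lia.
have [mn|/ltnW nm] := leqP m n.
  rewrite -(subnKC mn); case: m {mn abE} => [|m].
    by rewrite add0n mul1r; exact: pl_ends_expand.
  rewrite e2 (e1 m) !mulrDl mul1r !addrA.
  apply: pl_ends_cat (pl_ends_expand _ _ _ da dc) _.
  by apply: shift; apply: dyadicD => //; exact: dyadic_exp.
rewrite -(subnKC nm); case: n {nm cdE} => [|n].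
  by rewrite add0n mul1r; exact: pl_ends_shrink.
rewrite e2 (e1 n) !mulrDl mul1r !addrA.
apply: pl_ends_cat (pl_ends_shrink _ _ _ da dc) _.
by apply: shift; apply: dyadicD => //; exact: dyadic_exp.
Qed.

End Dyadic.

(** * The circle and the construction of elements of T *)

Section CircleTopology.
Variable R : realType.
Implicit Types (x y p q : R).
Local Notation tc := (@to_circle R).

Lemma to_circle_continuous : continuous tc.
Proof. exact: pi_continuous. Qed.

Lemma to_circle_shift x (m : int) : tc (x + m%:~R) = tc x.
Proof. by apply/to_circle_eq; rewrite addrC addKr; exact: intr_int. Qed.

Lemma to_circle_eqP x y : tc x = tc y <-> exists m : int, y = x + m%:~R.
Proof.
split=> [/esym/to_circle_eq/intrP[m e]|[m ->]]; last by rewrite to_circle_shift.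
by exists m; rewrite -e addrC subrK.
Qed.

Lemma floor_window p x : p <= x - (Num.floor (x - p))%:~R < p + 1.
Proof.
have /andP[l r] := floor_itv (x - p); rewrite rmorphD /= in r.
by apply/andP; split; lra.
Qed.

Lemma to_circle_window p (z : circle R) : exists2 x, p <= x < p + 1 & tc x = z.
Proof.
have [x <-] := to_circle_surj z.
exists (x - (Num.floor (x - p))%:~R); first exact: floor_window.
by rewrite -rmorphN to_circle_shift.
Qed.

Lemma to_circle_inj x y : `|x - y| < 1 -> tc x = tc y -> x = y.
Proof.
move=> + /to_circle_eqP[m ym]; rewrite ym opprD addNKr normrN -intr_norm.
rewrite -[ltRHS]/(1%:~R) ltr_int ltr_norml => /andP[m1 m2].
have m0 : m = 0 by lia.
by rewrite m0 mulr0z addr0.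
Qed.

Lemma to_circle_open (A : set R) : open A -> open (tc @` A).
Proof.
move=> oA.
have E : tc @^-1` (tc @` A) = \bigcup_(m in [set: int]) (fun x => x + m%:~R) @^-1` A.
  apply/seteqP; split=> [x [y Ay /esym/to_circle_eqP[m e]]|x [m _ Am]].
    by exists m => //=; rewrite -e.
  by exists (x + m%:~R) => //; rewrite to_circle_shift.
suff : open (tc @^-1` (tc @` A)) by [].
rewrite E; apply: bigcup_open => m _; apply: open_comp => // x _.
by apply: cvgD; [exact: cvg_id|exact: cvg_cst].
Qed.

(** An open arc, meaningful when [q <= p + 1]; the arc with [q = p + 1] is the circle minus a
point. *)
Definition oarc p q : set (circle R) := tc @` `]p, q[%classic.

Lemma oarc_open p q : open (oarc p q).
Proof. by apply: to_circle_open; exact: interval_open. Qed.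

Lemma circle_nbhs (U : set (circle R)) x : open U -> U (tc x) ->
  exists2 e, 0 < e & forall y, x - e < y < x + e -> U (tc y).
Proof.
move=> oU Ux; have := @to_circle_continuous x U (open_nbhs_nbhs (conj oU Ux)).
move=> /nbhs_ballP[e /= e0 eU].
exists e => // y yx; apply: eU; rewrite /ball /= distrC ltr_norml.
by move: yx; lra.
Qed.

Lemma circle_compact : compact [set: circle R].
Proof.
have -> : [set: circle R] = tc @` `[0, 1]%classic.
  apply/seteqP; split=> // z _; have [x /andP[x0 x1] <-] := to_circle_window 0 z.
  by exists x => //=; rewrite in_itv /= x0 ltW// -[1]add0r.
apply: continuous_compact; last exact: segment_compact.
exact/continuous_subspaceT/to_circle_continuous.
Qed.

Lemma circle_hausdorff : hausdorff_space (circle R).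
Proof.
rewrite open_hausdorff => z w zw.
have [x _ xz] := to_circle_window 0 z; have [y /andP[xy yx] yw] := to_circle_window x w.
have {}xy : x < y.
  by rewrite lt_neqAle xy andbT; apply: contraNneq zw => e; rewrite -xz -yw e.
pose d := Num.min (y - x) (x + 1 - y) / 2.
have d0 : 0 < d by rewrite divr_gt0// lt_min !subr_gt0 xy yx.
have d1 : 2 * d <= y - x by rewrite mulrC divfK// ge_min lexx.
have d2 : 2 * d <= x + 1 - y by rewrite mulrC divfK// ge_min lexx orbT.
exists (oarc (x - d) (x + d), oarc (y - d) (y + d)) => /=.
  split; rewrite inE; [exists x|exists y] => //=; rewrite in_itv /=; lra.
split; [exact: oarc_open|exact: oarc_open|].
apply/eqP/seteqP; split=> // _ [[s + <-] [t + /esym/to_circle_eqP[m e]]].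
rewrite /= !in_itv /= e => sx ty.
have [m0|m0] := leP m 0.
  have : m%:~R <= 0 :> R by rewrite -[0]/(0%:~R) ler_int.
  by move: sx ty; lra.
have : 1 <= m%:~R :> R by rewrite -[1]/(1%:~R) ler_int; lia.
by move: sx ty; lra.
Qed.

Lemma circle_faithful : faithful (circle_action R).
Proof. by move=> g g1; apply/val_inj/homeo_ext => x; exact: g1. Qed.

End CircleTopology.

Section GlueCircleMap.
Variable R : realType.
Implicit Types (x y p q : R).
Local Notation tc := (@to_circle R).
Local Notation dyadic := (@dyadic R).

(** An increasing surjection has no jumps. *)
Lemma increasing_surj_continuous (F : R -> R) : {homo F : x y / x < y} ->
  (forall y, exists x, F x = y) -> continuous F.
Proof.
move=> Fi Fs x; apply/cvgrPdist_lt => e e0.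
have Fm := increasing_le Fi.
have [u uE] := Fs (F x - e); have [v vE] := Fs (F x + e).
have ux : u < x by rewrite ltNge -Fm uE -ltNge ltrBlDr ltrDl.
have xv : x < v by rewrite ltNge -Fm vE -ltNge ltrDl.
have xin : x \in `]u, v[ by rewrite in_itv /= ux xv.
near=> z.
have : z \in `]u, v[ by near: z; exact: near_in_itvoo.
rewrite in_itv /= => /andP[/Fi uz /Fi zv]; rewrite distrC ltr_distl -uE -vE uz zv //.
Unshelve. all: by end_near. Qed.

Section Lift.
Variable F : R -> R.
Hypotheses (Fi : {homo F : x y / x < y}) (F1 : forall x, F (x + 1) = F x + 1).
Hypothesis Fs : forall y, exists x, F x = y.

Lemma lift_shift x (m : int) : F (x + m%:~R) = F x + m%:~R.
Proof.
have Fn y (n : nat) : F (y + n%:R) = F y + n%:R.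
  by elim: n => [|n IH]; rewrite ?addr0// -addn1 natrD !addrA F1 IH.
case: m => n; first by rewrite -!pmulrn Fn.
rewrite NegzE mulrNz -!pmulrn; apply/eqP.
by rewrite eq_sym subr_eq -Fn subrK.
Qed.

Definition circle_map (z : circle R) : circle R :=
  tc (F (repr (z : quotient_topology (Quotient.quot (@integer R))))).

Lemma circle_mapE x : circle_map (tc x) = tc (F x).
Proof.
rewrite /circle_map; set y := repr _.
have /to_circle_eqP[m ->] : tc y = tc x by exact: reprK.
by rewrite lift_shift to_circle_shift.
Qed.

Lemma circle_map_continuous : continuous circle_map.
Proof.
apply/quotient_continuous.
have -> : circle_map \o \pi_(quotient_topology (Quotient.quot (@integer R)))%qT = tc \o F.
  by apply/funext => x; exact: circle_mapE.
move=> x; apply: continuous_comp; last exact: to_circle_continuous.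
exact: increasing_surj_continuous.
Qed.

End Lift.

Lemma circle_homeo (F : R -> R) : {homo F : x y / x < y} ->
  (forall x, F (x + 1) = F x + 1) -> (forall y, exists x, F x = y) ->
  exists g : homeo (circle R), forall x, g (tc x) = tc (F x).
Proof.
move=> Fi F1 Fs; have [H HK] := choice Fs.
have Fm := increasing_le Fi.
have FI : injective F by move=> x y /eqP; rewrite eq_le !Fm -eq_le => /eqP.
have Hm x y : (H x <= H y) = (x <= y) by rewrite -Fm !HK.
have Hi : {homo H : x y / x < y} by move=> x y; rewrite !ltNge Hm.
have H1 x : H (x + 1) = H x + 1 by apply: FI; rewrite HK F1 HK.
have FK : cancel F H by move=> x; apply: FI; rewrite HK.
have Hs y : exists x, H x = y by exists (F y).
have K1 : cancel (circle_map F) (circle_map H).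
  by move=> z; have [x <-] := to_circle_surj z; rewrite !circle_mapE// FK.
have K2 : cancel (circle_map H) (circle_map F).
  by move=> z; have [x <-] := to_circle_surj z; rewrite !circle_mapE// HK.
exists (Homeo K1 K2 (circle_map_continuous Fi F1 Fs) (circle_map_continuous Hi H1 Hs)).
by move=> x /=; rewrite circle_mapE.
Qed.

(** Extend the map to the line by equivariance under the integers. The image of [p] is added to
the exceptional set, since the slope may change where the period closes up. *)
Lemma thompsonT_of_pl p (f : R -> R) : pl f p (p + 1) -> f (p + 1) = f p + 1 ->
  exists g : thompsonT R, forall x, p <= x <= p + 1 -> g (tc x) = tc (f x).
Proof.
move=> pf fp; pose m x : int := Num.floor (x - p).
have mP x : p <= x - (m x)%:~R < p + 1 by exact: floor_window.
have m1 x : m (x + 1) = m x + 1.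
  by rewrite /m addrAC floorDrz ?floor1 //; exact: (intr_int _ 1).
pose F x := f (x - (m x)%:~R) + (m x)%:~R.
have F1 x : F (x + 1) = F x + 1.
  rewrite /F m1 rmorphD /= addrA; congr (f _ + _ + _).
  by rewrite opprD addrACA subrr addr0.
have fh := pl_homo pf.
have p1 : p < p + 1 by rewrite ltrDl.
have frange x : p <= x < p + 1 -> f p <= f x < f p + 1.
  move=> /andP[px xp]; rewrite -fp fh// andbT.
  by move: px; rewrite le_eqVlt => /predU1P[->//|px]; rewrite ltW// fh// ltW.
have Fi : {homo F : x y / x < y}.
  move=> x y xy; have mxy : m x <= m y by apply: le_floor; rewrite lerD2r ltW.
  have /andP[x1 x2] := mP x; have /andP[y1 y2] := mP y.
  move: mxy; rewrite le_eqVlt => /predU1P[e|lt].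
    by rewrite /F e ltrD2r; apply: fh; rewrite -?e// ?ltrD2r// ltW// e.
  have /andP[_ fx] := frange _ (mP x); have /andP[fy _] := frange _ (mP y).
  have : (m x)%:~R + 1 <= (m y)%:~R :> R.
    by rewrite -[1]/(1%:~R) -intrD ler_int; lia.
  by rewrite /F; move: fx fy; lra.
have FE x : p <= x <= p + 1 -> F x = f x.
  move=> /andP[px]; rewrite le_eqVlt => /predU1P[->|xp].
    rewrite F1 fp /F; have -> : m p = 0 by rewrite /m subrr floor0.
    by rewrite mulr0z subr0 addr0.
  have mx : m x = 0.
    by apply: floor_def; rewrite add0r mulr0z subr_ge0 px ltrBlDl.
  by rewrite /F mx mulr0z subr0 addr0.
have Fshift := lift_shift F1.
have Fs y : exists x, F x = y.
  pose k := Num.floor (y - f p).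
  have /andP[yl yr] := floor_window (f p) y.
  have [|x xp fx] := pl_surj pf (y := y - k%:~R); first by rewrite fp yl ltW.
  by exists (x + k%:~R); rewrite Fshift FE// fx subrK.
have [g gE] := circle_homeo Fi F1 Fs.
have Fd x : dyadic (F x) <-> dyadic x.
  have xE := mP x.
  have fd : dyadic (f (x - (m x)%:~R)) <-> dyadic (x - (m x)%:~R).
    by apply: pl_dyadicE pf _ _; move: xE => /andP[-> /ltW].
  have di := dyadic_int R (m x).
  split=> d.
    by rewrite -[x](subrK (m x)%:~R); apply: dyadicD => //; apply/fd;
       rewrite -[f _](addrK (m x)%:~R); exact: dyadicB.
  by apply: dyadicD => //; apply/fd; exact: dyadicB.
have [s [sd sP]] := pl_off pf.
have gT : is_thompsonT g.
  exists F, (tc @` [set` p :: s]); split.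
  - by split => //; exact: increasing_surj_continuous.
  - exact/finite_image/finite_seq.
  - move=> _ [x /= xs <-]; exists x => //; move: xs; rewrite inE => /predU1P[->|/sd//].
    by have [] := pl_dyadic pf.
  - move=> a b ab H; have /andP[ap pa] := mP a; set k := m a in ap pa.
    have notB x y (j : int) : x \in p :: s -> y = x + j%:~R -> ~ (a < y < b).
      move=> xs -> ayb; apply: (H _ ayb); exists x => //.
      by rewrite to_circle_shift.
    have bp : b - k%:~R <= p + 1.
      rewrite leNgt; apply/negP => bp.
      apply: (notB p (p + (1 + k)%:~R) (1 + k)) => //; first exact: mem_head.
      by rewrite rmorphD /=; lra.
    have [||||k' [c E]] := sP (a - k%:~R) (b - k%:~R) => //.
    + by rewrite ltrD2r.
    + move=> x xs xab; apply: (notB x (x + k%:~R) k) => //.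
        by rewrite inE xs orbT.
      by move: xab; lra.
    exists k', (c + k%:~R - 2 ^ k' * k%:~R) => x xab.
    rewrite -[x in LHS](subrK k%:~R) Fshift FE; last by move: xab; lra.
    by rewrite E; [ring|move: xab; lra].
  - apply/seteqP; split=> [_ [_ [x xd <-] <-]|_ [y yd <-]].
      by rewrite gE; exists (F x) => //; exact/Fd.
    have [x xy] := Fs y; exists (tc x); last by rewrite gE xy.
    by exists x => //; apply/Fd; rewrite xy.
have gT' : g \in @thompsonT_pred R by exact/asboolP.
by exists (ThompsonT gT') => x xp; rewrite -FE// -gE.
Qed.

End GlueCircleMap.

(** * Moving intervals of the circle *)

Section Movers.
Variable R : realType.
Implicit Types (x y p q : R).
Local Notation tc := (@to_circle R).
Local Notation dyadic := (@dyadic R).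
Let b := circle_action R.

Lemma exp2_dyadic_small (e : R) : 0 < e -> exists n : int, 0 < (2 ^ n : R) < e.
Proof. by move=> /exp2_small[n ne]; exists (- n%:Z); rewrite exp2_gt0 ne. Qed.

(** An affine map on the middle interval [c, d], completed on both sides. *)
Lemma pl_mover p q c d c' (k : int) : dyadic p -> dyadic q -> dyadic c -> dyadic d ->
  dyadic c' -> p < c -> c < d -> d < q -> p < c' -> c' + 2 ^ k * (d - c) < q ->
  exists f, [/\ pl f p q, f p = p, f q = q &
    forall x, c <= x <= d -> f x = c' + 2 ^ k * (x - c)].
Proof.
move=> dp dq dc dd dc' pc cd dltq pc' d'q.
have dd' : dyadic (c' + 2 ^ k * (d - c)).
  by rewrite addrC; apply: dyadic_affine => //; exact: dyadicB.
have [f1 [pf1 f1p f1c]] := pl_ends_exists dp dc dp dc' pc pc'.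
have pf2 : pl (fun x => 2 ^ k * x + (c' - 2 ^ k * c)) c d.
  apply: (pl_affine (k := k) (c := c' - 2 ^ k * c)) => //.
  by apply: dyadicB => //; apply: dyadicM => //; exact: dyadic_exp.
have [f3 [pf3 f3d f3q]] := pl_ends_exists dd dq dd' dq dltq d'q.
have [|f12 [pf12 f12p f12c]] := pl_glue pf1 pf2; first by rewrite f1c; ring.
have [|f [pf fp fq]] := pl_glue pf12 pf3.
  by rewrite f3d f12c ?lexx ?(ltW cd)//; ring.
exists f; split => //.
- by rewrite fp ?f12p ?f1p// lexx ltW// (lt_trans pc).
- by rewrite fq// lexx ltW.
- move=> x /andP[cx xd]; rewrite fp; last by rewrite xd (le_trans (ltW pc)).
  by rewrite f12c ?cx//; ring.
Qed.

(** Completion by the identity. A whole turn must be treated apart, as nothing is left to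
complete. *)
Lemma thompsonT_arc p q (f : R -> R) : pl f p q -> f p = p -> f q = q -> q <= p + 1 ->
  exists g, rist b (oarc p q) g /\ forall x, p <= x <= q -> g (tc x) = tc (f x).
Proof.
move=> pf fp fq; rewrite le_eqVlt => /predU1P[qE|qp].
  rewrite qE in pf fq *; have [|g gE] := thompsonT_of_pl pf; first by rewrite fq fp.
  exists g; split => // z nz; have [x /andP[px xp] xz] := to_circle_window p z.
  rewrite -xz /b /= gE ?px ?(ltW xp)//; move: px; rewrite le_eqVlt => /predU1P[<-|px].
    by rewrite fp.
  by case: nz; exists x => //=; rewrite in_itv /= px xp.
have [dp dq] := pl_dyadic pf.
have pid : pl id q (p + 1).
  apply: (pl_affine (k := 0) (c := 0)) => //.
  - by apply: dyadicD => //; exact: (dyadic_int R 1).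
  - exact: (dyadic_int R 0).
  - by move=> x _; rewrite expr0z mul1r addr0.
have [//|h [ph hf hg]] := pl_glue pf pid.
have pq := pl_lt pf.
have [|g gE] := thompsonT_of_pl ph.
  by rewrite hg ?hf ?fp// ?lexx ltW.
exists g; split=> [z nz|x /andP[px xq]]; last first.
  by rewrite gE ?hf ?px ?xq//= (le_trans xq)// ltW.
have [x /andP[px xp] xz] := to_circle_window p z.
rewrite -xz /b /= gE ?px ?(ltW xp)//; have [xq|qx] := ltP x q.
  move: px; rewrite le_eqVlt => /predU1P[<-|px]; first by rewrite hf ?fp// lexx ltW.
  by case: nz; exists x => //=; rewrite in_itv /= px xq.
by rewrite hg// qx ltW.
Qed.

Lemma mover p q c d c' (k : int) : dyadic p -> dyadic q -> dyadic c -> dyadic d ->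
  dyadic c' -> p < c -> c < d -> d < q -> p < c' -> c' + 2 ^ k * (d - c) < q ->
  q <= p + 1 ->
  exists g, rist b (oarc p q) g /\
    forall x, c <= x <= d -> g (tc x) = tc (c' + 2 ^ k * (x - c)).
Proof.
move=> dp dq dc dd dc' pc cd dltq pc' d'q qp.
have [f [pf fp fq fE]] := pl_mover dp dq dc dd dc' pc cd dltq pc' d'q.
have [g [gR gE]] := thompsonT_arc pf fp fq qp; exists g; split => // x /andP[cx xd].
by rewrite gE ?fE ?cx// (le_trans (ltW pc))//= (le_trans xd)// ltW.
Qed.

Lemma squeeze_into p q c d u v : dyadic p -> dyadic q -> dyadic c -> dyadic d ->
  p < c -> c < d -> d < q -> p <= u -> u < v -> v <= q -> q <= p + 1 ->
  exists g, rist b (oarc p q) g /\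
    forall x, c <= x <= d -> exists2 y, u < y < v & g (tc x) = tc y.
Proof.
move=> dp dq dc dd pc cd dltq pu uv vq qp.
have [c' dc' /andP[uc' c'v]] := dyadic_dense uv.
have [|k /andP[k0 kl]] := @exp2_dyadic_small ((v - c') / (d - c)).
  by rewrite divr_gt0 ?subr_gt0.
rewrite ltr_pdivlMr ?subr_gt0// in kl.
have [|||g [gR gE]] := mover (k := k) dp dq dc dd dc' pc cd dltq; try lra.
exists g; split => // x /andP[cx xd]; exists (c' + 2 ^ k * (x - c)).
  have : 0 <= 2 ^ k * (x - c) by rewrite mulr_ge0 ?subr_ge0// ltW.
  have : 2 ^ k * (x - c) <= 2 ^ k * (d - c) by rewrite ler_pM2l// lerD2r.
  by move: kl uc' c'v; lra.
by rewrite gE ?cx.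
Qed.

Lemma move_into p q x u v : dyadic p -> dyadic q -> p < x < q ->
  p <= u -> u < v -> v <= q -> q <= p + 1 ->
  exists g, rist b (oarc p q) g /\ exists2 y, u < y < v & g (tc x) = tc y.
Proof.
move=> dp dq /andP[px xq] pu uv vq qp.
have [c dc /andP[pc cx]] := dyadic_dense px.
have [d dd /andP[xd dltq]] := dyadic_dense xq.
have [g [gR gE]] := squeeze_into dp dq dc dd pc (lt_trans cx xd) dltq pu uv vq qp.
by exists g; split => //; apply: gE; rewrite !ltW.
Qed.

(** The second quarter of the arc is translated onto the third one. Monotonicity keeps all later
images in the second half, so they never come back. *)
Lemma arc_shift p q : dyadic p -> dyadic q -> p < q -> q <= p + 1 ->
  exists u c d, [/\ rist b (oarc p q) u, dyadic c /\ dyadic d, p < c /\ c < d, d < q &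
    forall n z, oarc c d z -> ~ oarc c d (b (u ^+ n.+1)%g z)].
Proof.
move=> dp dq pq qp.
have half x : dyadic x -> dyadic (x / 2).
  move=> dx; apply: dyadicM => //; exact: (dyadic_exp R (-1)).
pose l := (q - p) / 2; pose m := l / 2.
have dl : dyadic l by apply/half/dyadicB.
have dm : dyadic m by exact: half.
have m0 : 0 < m by rewrite !divr_gt0// subr_gt0.
have lE : l = 2 * m by rewrite /m; field.
have qE : q = p + 4 * m by rewrite /m /l; field.
clearbody l m.
have [[h1 h2 h3] h4] : [/\ p < p + m, p + m < p + l & p + l < q] /\ p < p + l.
  by rewrite lE qE; split; [split|]; lra.
have h5 : p + l + 2 ^ 0 * (p + l - (p + m)) < q by rewrite expr0z lE qE; lra.
have [f [pf fp fq fE]] := pl_mover dp dq (dyadicD dp dm) (dyadicD dp dl)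
  (dyadicD dp dl) h1 h2 h3 h4 h5.
have [u [uR uE]] := thompsonT_arc pf fp fq qp.
exists u, (p + m), (p + l); split => //; first by split; exact: dyadicD.
have fh := pl_homo pf.
have fpl : f (p + l) = p + l + m.
  by rewrite fE ?expr0z ?lE; lra.
have step y : p + l <= y < q -> p + l <= f y < q.
  move=> /andP[ly yq]; have fyq : f y < f q.
    by apply: fh => //; exact: le_trans (ltW h4) ly.
  rewrite fq in fyq; rewrite fyq andbT.
  move: ly; rewrite le_eqVlt => /predU1P[<-|ly]; first by rewrite fpl; lra.
  by have := fh _ _ (ltW h4) ly (ltW yq); rewrite fpl; lra.
have iter n x : p + m < x < p + l -> exists2 y, p + l <= y < q & b (u ^+ n.+1)%g (tc x) = tc y.
  move=> /andP[mx xl]; elim: n => [|n [y ylq IH]].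
    exists (f x); last by rewrite expg1 /b /= uE//; lra.
    by rewrite fE ?expr0z ?(ltW mx) ?(ltW xl)//; move: mx xl; rewrite lE qE; lra.
  exists (f y); first exact: step.
  by rewrite expgS actM IH /b /= uE//; move: ylq => /andP[? ?]; lra.
move=> n _ [x /= + <-]; rewrite in_itv /= => /(iter n)[y ylq e] [t /=].
rewrite in_itv /= => tx tE; have {e}tE : tc t = tc y := etrans tE e.
have ty : t = y.
  by apply: to_circle_inj tE; rewrite ltr_norml; move: ylq tx; rewrite lE qE; lra.
by move: ylq tx; rewrite ty; lra.
Qed.

End Movers.

(** * The action of T on the circle *)

Section ThompsonTGeometry.
Variable R : realType.
Implicit Types (x y p q : R).
Local Notation tc := (@to_circle R).
Local Notation dyadic := (@dyadic R).
Let b := circle_action R.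

Lemma oarc_in p q x : p < x < q -> oarc p q (tc x).
Proof. by move=> xpq; exists x => //=; rewrite in_itv. Qed.

Lemma circle_nbhs_arc (U : set (circle R)) p : open U -> U !=set0 ->
  exists u v, [/\ p <= u, u < v, v <= p + 1 & forall x, u < x < v -> U (tc x)].
Proof.
move=> oU [z Uz]; have [x /andP[px xp] xz] := to_circle_window p z.
rewrite -xz in Uz; have [e e0 eU] := circle_nbhs oU Uz.
exists x, (Num.min (x + e) (p + 1)); split => //.
- by rewrite lt_min ltrDl e0.
- by rewrite ge_min lexx orbT.
- by move=> y /andP[xy]; rewrite lt_min => /andP[ye _]; apply: eU; lra.
Qed.

Definition dyadic_arcs : set (set (circle R)) :=
  [set W | exists p q, [/\ dyadic p, dyadic q, p < q, q <= p + 1 & W = oarc p q]].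

Lemma dyadic_arcs_system : cell_system b setT dyadic_arcs.
Proof.
split => //.
- by move=> _ [p [q [_ _ _ _ ->]]]; exact: oarc_open.
- move=> _ [p [q [_ _ pq _ ->]]]; exists (tc ((p + q) / 2)); apply: oarc_in; lra.
- move=> U oU U0; have [u [v [u0 uv v1 uvU]]] := circle_nbhs_arc 0 oU U0.
  have [p dp /andP[up pv]] := dyadic_dense uv.
  have [q dq /andP[pq qv]] := dyadic_dense pv.
  exists (oarc p q); first by exists p, q; split => //; lra.
  by move=> _ [x /= + <-]; rewrite in_itv /= => xpq; apply: uvU; lra.
- move=> _ [p [q [dp dq pq qp ->]]].
  have [u [c [d [uR [dc dd] [pc cd] dltq sh]]]] := arc_shift dp dq pq qp.
  exists u, (oarc c d); split => //; first by exists c, d; split => //; lra.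
  by move=> _ [x /= + <-]; rewrite in_itv /= => xcd; apply: oarc_in; lra.
Qed.

Lemma circle_orbit W : dyadic_arcs W -> exists g, W (b g (tc 0)).
Proof.
move=> [p [q [_ _ pq _ ->]]]; have [c dc pcq] := dyadic_dense pq.
have d0 := dyadic_int R 0; have d1 := dyadic_int R 1.
have pf : pl (fun x => x + c) 0 (0 + 1).
  apply: (pl_affine (k := 0) (c := c)) => //; first exact: dyadicD.
  by move=> x _; rewrite expr0z mul1r.
have [|g gE] := thompsonT_of_pl pf; first by rewrite addrAC.
exists g; rewrite /b /= gE ?lexx ?add0r ?ler01//; exact: oarc_in.
Qed.

(** The complement [t, 1 - t] of a small neighbourhood of 0 is mapped onto an interval inside
[W], and that neighbourhood, [1 - t, 1 + t], is stretched over the rest of the circle. *)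
Lemma circle_compress U W : open U -> U (tc 0) -> dyadic_arcs W ->
  exists g, forall z, ~ U z -> W (b g z).
Proof.
move=> oU U0 [r [s [_ _ rs sr ->]]].
have [e e0 eU] := circle_nbhs oU U0.
have [|k /andP[k0 ke]] := @exp2_dyadic_small R (Num.min e 4^-1).
  by rewrite lt_min e0; lra.
move: ke; rewrite lt_min => /andP[ke k4]; set t := (2 ^ k : R) in k0 ke k4.
have dt : dyadic t by exact: dyadic_exp.
have d1 := dyadic_int R 1.
have [r' dr' /andP[rr' r's]] := dyadic_dense rs.
have [s' ds' /andP[rs' s's]] := dyadic_dense r's.
have [f1 [pf1 f1a f1b]] := pl_ends_exists dt (dyadicB d1 dt) dr' ds'
  (ltac:(lra)) rs'.
have [f2 [pf2 f2a f2b]] := pl_ends_exists (dyadicB d1 dt) (dyadicD dt d1) ds'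
  (dyadicD dr' d1) (ltac:(lra)) (ltac:(lra)).
have [|f [pf ff1 ff2]] := pl_glue pf1 pf2; first by rewrite f1b.
have [|g gE] := thompsonT_of_pl pf.
  rewrite ff2; last by rewrite lexx andbT; lra.
  by rewrite ff1 ?f1a ?f2b// lexx /=; lra.
exists g => z nUz; have [x /andP[tx xt] xz] := to_circle_window t z.
have [x1|x1] := leP x (1 - t).
  rewrite -xz /b /= gE ?tx ?(ltW xt)//; apply: oarc_in.
  have fh := pl_homo pf1; rewrite ff1 ?tx//.
  have l : r' <= f1 x.
    by rewrite -f1a; move: tx; rewrite le_eqVlt => /predU1P[->//|tx]; rewrite ltW// fh.
  have u : f1 x <= s'.
    by rewrite -f1b; move: x1; rewrite le_eqVlt => /predU1P[->//|x1]; rewrite ltW// fh.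
  lra.
case: nUz; rewrite -xz -(to_circle_shift _ (-1)); apply: eU.
by rewrite rmorphN /=; lra.
Qed.

(** Choose [g] and [h] trivial near [z'], with [g] moving [z] into [U] and [h] moving [z] to a
place where [g] is trivial. Then the commutator acts on [z] as [g] does. *)
Lemma circle_spread z z' U : z <> z' -> open U -> U !=set0 ->
  exists V g h, [/\ open V, V z', rist b (~` V) g, rist b (~` V) h &
    U (b [~ g, h]%g z)].
Proof.
move=> zz' oU U0; have [x' xz'] := to_circle_surj z'.
have [x /andP[x'x xx'] xz] := to_circle_window x' z.
have {}x'x : x' < x.
  by rewrite lt_neqAle x'x andbT; apply/eqP => e; apply: zz'; rewrite -xz -xz' e.
have [u [v [x'u uv vx' uvU]]] := circle_nbhs_arc x' oU U0.
have [u' du' /andP[uu' u'v]] := dyadic_dense uv.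
have [v' dv' /andP[u'v' v'v]] := dyadic_dense u'v.
have [|p dp /andP[x'p]] := @dyadic_dense R x' (Num.min x u').
  by rewrite lt_min x'x; lra.
rewrite lt_min => /andP[px pu'].
have [|q dq /andP[+ qx']] := @dyadic_dense R (Num.max x v') (x' + 1).
  by rewrite gt_max xx'; lra.
rewrite gt_max => /andP[xq v'q].
have [|p1 dp1 /andP[pp1]] := @dyadic_dense R p (Num.min x u').
  by rewrite lt_min px.
rewrite lt_min => /andP[p1x p1u'].
have [|||||g [gR [y yuv gy]]] := @move_into R p1 q x u' v' dp1 dq _ _ _ _ _;
  [by apply/andP; split|lra|lra|lra|lra|].
have [|||||h [hR [w wp hw]]] := @move_into R p q x p p1 dp dq _ _ _ _ _;
  [by apply/andP; split|lra|lra|lra|lra|].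
have disj r : p <= r -> oarc r q `<=` ~` oarc (q - 1) p.
  move=> pr _ [s /= + <-] [t /=]; rewrite !in_itv /= => srq tp /to_circle_inj ts.
  have := ts (ltac:(rewrite ltr_norml; move: srq tp; lra)).
  by move: srq tp; lra.
exists (oarc (q - 1) p), g^-1%g, h; split.
- exact: oarc_open.
- by rewrite -xz'; apply: oarc_in; lra.
- apply/ristV; apply: rist_sub gR; apply: disj; lra.
- by apply: rist_sub hR; apply: disj; lra.
have gw : b g (tc w) = tc w.
  apply: gR => -[s /= + e]; rewrite in_itv /= => sp; have sw : s = w.
    by apply: to_circle_inj e; rewrite ltr_norml; lra.
  by move: sp wp; rewrite sw; lra.
rewrite /commg conjgE invgK !actM -xz.
have -> : b h (tc x) = tc w by [].
have -> : b g^-1%g (tc w) = tc w by exact: actV_fix.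
have -> : b h^-1%g (tc w) = tc x.
  by rewrite -[tc w]/(tc w) -[tc w]hw; exact: (actK b h (tc x)).
by rewrite -[b g _]/(g _) gy; apply: uvU; lra.
Qed.

End ThompsonTGeometry.

(** * The action of F on the interval *)

Section ThompsonFGeometry.
Variable R : realType.
Implicit Types (x y p q : R).
Local Notation tc := (@to_circle R).
Local Notation dyadic := (@dyadic R).
Let bT := circle_action R.

Definition interval_action : action (thompsonF R) (circle R) :=
  @Action (thompsonF R) (circle R) (fun g => bT (thompsonF_val g))
    (fun=> erefl) (fun _ _ _ => erefl) (fun g => @act_continuous _ _ bT (thompsonF_val g)).
Let b := interval_action.

Lemma interval_faithful : faithful b.
Proof. by move=> g g1; apply/val_inj/(@circle_faithful R). Qed.

Lemma thompsonF_fix (g : thompsonF R) : b g (tc 0) = tc 0.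
Proof. exact/eqP/(valP g). Qed.

(** Elements of F are produced as elements of T supported in an arc that avoids 0. *)
Lemma thompsonF_of (g : thompsonT R) (I : set (circle R)) :
  rist bT I g -> ~ I (tc 0) -> exists2 h : thompsonF R, rist b I h & forall z, b h z = g z.
Proof.
move=> gI nI; have gF : g \in @thompsonF_pred R by apply/eqP; exact: gI.
by exists (ThompsonF gF).
Qed.

Lemma oarc_not0 p q : 0 <= p -> q <= 1 -> ~ oarc p q (tc 0).
Proof.
move=> p0 q1 [x /= + e]; rewrite in_itv /= => xpq.
have x0 : x = 0 by apply: to_circle_inj e; rewrite ltr_norml; lra.
by move: xpq; rewrite x0; lra.
Qed.

Definition interior_arcs : set (set (circle R)) :=
  [set W | exists p q, [/\ dyadic p, dyadic q, 0 < p /\ p < q, q < 1 & W = oarc p q]].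

Lemma interval_squeeze p q c d u v : dyadic p -> dyadic q -> dyadic c -> dyadic d ->
  0 <= p -> p < c -> c < d -> d < q -> q <= 1 -> p <= u -> u < v -> v <= q ->
  exists g : thompsonF R, forall x, c <= x <= d -> oarc u v (b g (tc x)).
Proof.
move=> dp dq dc dd p0 pc cd dltq q1 pu uv vq.
have [|g [gR gE]] := squeeze_into dp dq dc dd pc cd dltq pu uv vq; first by lra.
have [h _ hE] := thompsonF_of gR (oarc_not0 p0 q1).
by exists h => x /gE[y yuv gy]; rewrite hE gy; exact: oarc_in.
Qed.

Lemma interior_arcs_system : cell_system b (~` [set tc 0]) interior_arcs.
Proof.
split.
- by move=> _ [p [q [_ _ _ _ ->]]]; exact: oarc_open.
- move=> _ [p [q [_ _ [p0 _] q1 ->]]] z zpq z0; move: zpq; rewrite z0.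
  by apply: oarc_not0; exact: ltW.
- move=> _ [p [q [_ _ [_ pq] _ ->]]]; exists (tc ((p + q) / 2)); apply: oarc_in; lra.
- move=> U oU U0; have [u [v [u0 uv v1 uvU]]] := circle_nbhs_arc 0 oU U0.
  have [p dp /andP[up pv]] := dyadic_dense uv.
  have [q dq /andP[pq qv]] := dyadic_dense pv.
  exists (oarc p q); first by exists p, q; split => //; [split; lra|lra].
  by move=> _ [x /= + <-]; rewrite in_itv /= => xpq; apply: uvU; lra.
- move=> g z z0 gz; apply: z0; apply: (act_inj (a := b) (g := g)).
  by rewrite gz thompsonF_fix.
- move=> _ [p [q [dp dq [p0 pq] q1 ->]]].
  have [|u [c [d [uR [dc dd] [pc cd] dltq sh]]]] := arc_shift dp dq pq.
    by lra.
  have [h hR hE] := thompsonF_of uR (oarc_not0 (ltW p0) (ltW q1)).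
  exists h, (oarc c d); split => //.
  + by exists c, d; split => //; [split; lra|lra].
  + by move=> _ [x /= + <-]; rewrite in_itv /= => xcd; apply: oarc_in; lra.
  + move=> n z zcd; have -> : b (h ^+ n.+1)%g z = bT (u ^+ n.+1)%g z.
      elim: n => [|n IH]; first by rewrite !expg1; exact: hE.
      by rewrite expgS actM IH [in RHS]expgS [in RHS]actM; exact: hE.
    exact: sh.
Qed.

(** Away from 0, finitely many points lie in a compact dyadic interval [c, d], and the interval
can be squeezed as a whole. *)
Lemma interval_squeezing : squeezing b (~` [set tc 0]) interior_arcs.
Proof.
move=> S _ [r [s [_ _ [r0 rs] s1 ->]]] S0.
have [c [d [[dc dd] [c0 cd] d1 cdS]]] : exists c d, [/\ dyadic c /\ dyadic d,
    0 < c /\ c < d, d < 1 & forall z, z \in S -> exists2 x, c <= x <= d & tc x = z].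
  elim: S S0 => [|z S IH] S0.
    have [|c dc c01] := @dyadic_dense R 0 1; first by lra.
    have [|d dd d01] := @dyadic_dense R c 1; first by lra.
    by exists c, d; split => //; [split; lra|lra].
  have [|c [d [[dc dd] [c0 cd] d1 cdS]]] := IH.
    by move=> w wS; apply: S0; rewrite inE wS orbT.
  have [x /andP[x0 x1] xz] := to_circle_window 0 z.
  have {}x0 : 0 < x.
    rewrite lt_neqAle x0 andbT; apply/eqP => e.
    by apply: (S0 z (mem_head _ _)); rewrite -xz -e.
  have [|c' dc' /andP[c'0]] := @dyadic_dense R 0 (Num.min x c); first by rewrite lt_min x0.
  have [|d' dd' /andP[+ d'1]] := @dyadic_dense R (Num.max x d) 1.
    by rewrite gt_max d1 andbT; lra.
  rewrite gt_max lt_min => /andP[xd' dd1] /andP[c'x c'c].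
  exists c', d'; split => //; [by split; lra|].
  move=> w; rewrite inE => /predU1P[->|/cdS[y ycd yw]]; [exists x => //|exists y => //]; lra.
have [|||g gE] := interval_squeeze (u := r) (v := s) (dyadic_int R 0) (dyadic_int R 1) dc dd
  (lexx _) c0 cd d1 (lexx _); try by rewrite ?(ltW r0) ?(ltW s1).
by exists g => z /cdS[x xcd <-]; exact: gE.
Qed.

(** Arcs inside (0, 1) are equivalent under F, directed, and permuted up to inclusion. *)
Lemma thompsonF_free (X : topologicalType) (a : action (thompsonF R) X) :
  compact [set: X] -> hausdorff_space X -> faithful a -> minimal a -> topologically_free a.
Proof.
move=> cX hX; apply: (minimal_faithful_free interval_faithful (@circle_hausdorff R)
  interior_arcs_system interval_squeezing cX hX).
- move=> _ _ [p [q [dp dq [p0 pq] q1 ->]]] [r [s [dr ds [r0 rs] s1 ->]]].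
  have [|||g gE] := interval_squeeze (u := p) (v := q) (dyadic_int R 0) (dyadic_int R 1) dr ds
    (lexx _) r0 rs s1 (lexx _); try by rewrite ?(ltW p0) ?(ltW q1).
  by exists g => _ [x /= + <-]; rewrite in_itv /= => xrs; apply: gE; lra.
- move=> _ _ [p [q [dp dq [p0 pq] q1 ->]]] [r [s [dr ds [r0 rs] s1 ->]]].
  have minD x y : dyadic x -> dyadic y -> dyadic (Num.min x y).
    by move=> dx dy; rewrite minEle; case: ifP.
  have maxD x y : dyadic x -> dyadic y -> dyadic (Num.max x y).
    by move=> dx dy; rewrite maxEle; case: ifP.
  exists (oarc (Num.min p r) (Num.max q s)).
    exists (Num.min p r), (Num.max q s); split; [exact: minD|exact: maxD| | |by []].
      by split; rewrite ?lt_min ?p0 ?r0// gt_min lt_max pq.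
    by rewrite gt_max q1 s1.
  by move=> _ [] [x /= + <-]; rewrite in_itv /= => /andP[l u]; apply: oarc_in;
    rewrite gt_min lt_max l u ?orbT.
- move=> g _ [p [q [dp dq [p0 pq] q1 ->]]].
  pose N := b g @^-1` (~` (tc @` `[p, q]%classic)).
  have oN : open N.
    apply: act_open; apply: closed_openC; apply: compact_closed; first exact: circle_hausdorff.
    apply: continuous_compact; last exact: segment_compact.
    exact/continuous_subspaceT/to_circle_continuous.
  have N0 : N (tc 0).
    move=> [x /=]; rewrite in_itv /= => xpq /esym.
    move=> /(etrans (esym (thompsonF_fix g)))/esym e.
    have x0 : x = 0 by apply: to_circle_inj e; rewrite ltr_norml; lra.
    by move: xpq; rewrite x0; lra.
  have [e e0 eN] := circle_nbhs oN N0.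
  have [|c dc /andP[c0]] := @dyadic_dense R 0 (Num.min e 2^-1).
    by rewrite lt_min e0; lra.
  rewrite lt_min => /andP[ce c2].
  exists (oarc c (1 - c)).
    exists c, (1 - c); split => //; [exact: dyadicB (dyadic_int R 1) dc|by split; lra|lra].
  move=> z gz; have nN : ~ N z.
    apply; case: gz => x /= + <-; rewrite in_itv /= => xpq.
    by exists x => //=; rewrite in_itv /=; lra.
  have [x /andP[x0 x1] xz] := to_circle_window 0 z.
  have xN y : tc y = z -> ~ (- e < y < e).
    by move=> yz ye; apply: nN; rewrite -yz; apply: eN; rewrite sub0r add0r.
  rewrite -xz; apply: oarc_in; have := xN x xz.
  have /xN : tc (x - 1) = z by rewrite -xz -(to_circle_shift x (-1)) rmorphN.
  move=> /negP; rewrite negb_and -!leNgt => /orP[] h /negP; rewrite negb_and -!leNgt => /orP[] h'; lra.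
Qed.

End ThompsonFGeometry.

(** * Trees, dyadic subdivisions and rotations *)

(** Finite binary trees, as codes for dyadic subdivisions of an interval. *)
Inductive tree := Leaf | Node of tree & tree.

Fixpoint carets (t : tree) : nat :=
  if t is Node l r then (carets l + carets r).+1 else 0%N.

(** The normal form of trees under rotation: every left child is a leaf. *)
Fixpoint vine (n : nat) : tree := if n is m.+1 then Node Leaf (vine m) else Leaf.

Section TreeIntervals.
Variable R : realType.
Implicit Types (p l x : R) (u v : R * R) (s : seq (R * R)) (t : tree).
Local Notation tc := (@to_circle R).
Local Notation dyadic := (@dyadic R).
Let b := circle_action R.

(** The intervals, as pairs (left end, length), obtained by halving along the tree. *)
Fixpoint leaves t p l : seq (R * R) :=
  if t is Node t1 t2 then leaves t1 p (l / 2) ++ leaves t2 (p + l / 2) (l / 2)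
  else [:: (p, l)].

Lemma size_leaves t p l : size (leaves t p l) = (carets t).+1.
Proof.
by elim: t p l => //= t1 IH1 t2 IH2 p l; rewrite size_cat IH1 IH2; lia.
Qed.

Definition carries (g : thompsonT R) u v :=
  forall x, 0 <= x <= 1 -> g (tc (u.1 + u.2 * x)) = tc (v.1 + v.2 * x).

Fixpoint carries_all g s1 s2 : Prop :=
  match s1, s2 with
  | [::], [::] => True
  | u :: s1', v :: s2' => carries g u v /\ carries_all g s1' s2'
  | _, _ => False
  end.

Lemma carries_all_cat g s1 s2 s1' s2' : carries_all g s1 s1' ->
  carries_all g s2 s2' -> carries_all g (s1 ++ s2) (s1' ++ s2').
Proof. by elim: s1 s1' => [|u s1 IH] [|v s1'] //= [uv H] H2; split => //; exact: IH. Qed.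

Lemma carries_all_split g s1 s2 s1' s2' : size s1 = size s1' ->
  carries_all g (s1 ++ s2) (s1' ++ s2') -> carries_all g s1 s1' /\ carries_all g s2 s2'.
Proof.
elim: s1 s1' => [|u s1 IH] [|v s1'] //= [e] [uv H].
by have [H1 H2] := IH _ e H.
Qed.

Lemma carries_all_comp g h s1 s2 s3 : carries_all g s1 s2 -> carries_all h s2 s3 ->
  carries_all (h * g)%g s1 s3.
Proof.
elim: s1 s2 s3 => [|u s1 IH] [|v s2] [|w s3] //= [uv H1] [vw H2]; split.
  by move=> x x01; rewrite -[LHS]/(h (g _)) uv// vw.
exact: IH H1 H2.
Qed.

Lemma carries_all_inv g s1 s2 : carries_all g s1 s2 -> carries_all g^-1%g s2 s1.
Proof.
elim: s1 s2 => [|u s1 IH] [|v s2] //= [uv H]; split; last exact: IH.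
move=> x x01; rewrite -uv//; exact: (actK b g).
Qed.

Lemma carries_sub g u v x y : carries g u v -> 0 <= x -> 0 <= y -> x + y <= 1 ->
  carries g (u.1 + u.2 * x, u.2 * y) (v.1 + v.2 * x, v.2 * y).
Proof.
move=> uv x0 y0 xy z /andP[z0 z1] /=.
have : 0 <= y * z by exact: mulr_ge0.
have : y * z <= y by rewrite -[leRHS]mulr1 ler_wpM2l.
move=> h1 h2; have := uv (x + y * z); rewrite !mulrDr !addrA !mulrA; apply.
by lra.
Qed.

Lemma carries_leaves g t u v : carries g u v ->
  carries_all g (leaves t u.1 u.2) (leaves t v.1 v.2).
Proof.
elim: t u v => [|t1 IH1 t2 IH2] u v uv; first by split => // x x01; exact: uv.
apply: carries_all_cat.
  apply: (IH1 (u.1, u.2 / 2) (v.1, v.2 / 2)).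
  have := carries_sub uv (lexx 0) (_ : 0 <= 2^-1) _; rewrite !mulr0 !addr0; apply; lra.
apply: (IH2 (u.1 + u.2 / 2, u.2 / 2) (v.1 + v.2 / 2, v.2 / 2)).
by apply: carries_sub uv _ _ _; lra.
Qed.

Lemma carries_leaves_id g t p l : 0 < l -> carries_all g (leaves t p l) (leaves t p l) ->
  forall x, p <= x <= p + l -> g (tc x) = tc x.
Proof.
elim: t p l => [|t1 IH1 t2 IH2] p l l0 /=.
  move=> [H _] x /andP[px xpl]; have := H ((x - p) / l) => /=.
  rewrite (mulrC l) divfK ?gt_eqF// (addrC p) subrK; apply.
  by rewrite ler_pdivlMr// ler_pdivrMr//; lra.
move=> /carries_all_split; rewrite !size_leaves => -[//|H1 H2] x xpl.
have [xl|lx] := leP x (p + l / 2); first by apply: (IH1 p (l / 2)) => //; lra.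
by apply: (IH2 (p + l / 2) (l / 2)) => //; lra.
Qed.

(** A tree pair determines its element; this is how all relations between elements of T are
proved below. *)
Lemma tree_pair_unique g h t1 t2 p l : 0 < l -> l <= 1 ->
  rist b (oarc p (p + l)) g -> rist b (oarc p (p + l)) h ->
  carries_all g (leaves t1 p l) (leaves t2 p l) ->
  carries_all h (leaves t1 p l) (leaves t2 p l) -> g = h.
Proof.
move=> l0 l1 gR hR cg ch; apply: (faithful_inj (@circle_faithful R)) => z.
have id := carries_leaves_id l0 (carries_all_comp ch (carries_all_inv cg)).
have [zpl|nz] := pselect (oarc p (p + l) z); last by rewrite [LHS]gR ?[RHS]hR.
case: zpl => x /=; rewrite in_itv /= => xpl <-.
have xid : (g^-1 * h)%g (tc x) = tc x by apply: id; lra.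
exact: etrans (esym (congr1 (b g) xid)) (actVK b g _).
Qed.

(** The tree rotation at the vertex of [p, p + l], a copy of the standard generator of F. *)
Definition rotates g p l := rist b (oarc p (p + l)) g /\
  carries_all g (leaves (Node (Node Leaf Leaf) Leaf) p l)
                (leaves (Node Leaf (Node Leaf Leaf)) p l).

(** Rotations may be applied to larger trees, as they are affine on their three pieces. *)
Lemma rotates_leaves g t1 t2 t3 p l : rotates g p l ->
  carries_all g (leaves (Node (Node t1 t2) t3) p l) (leaves (Node t1 (Node t2 t3)) p l).
Proof.
move=> [_ [c1 [c2 [c3 _]]]]; rewrite /= -catA.
apply: carries_all_cat; first exact: carries_leaves c1.
apply: carries_all_cat; first exact: carries_leaves c2.
exact: carries_leaves c3.
Qed.

Lemma exp2N1 : (2 : R) ^ (-1) = 2^-1. Proof. by []. Qed.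

Lemma rotation_exists p l : dyadic p -> dyadic l -> 0 < l -> l <= 1 ->
  exists g, rotates g p l.
Proof.
move=> dp dl l0 l1.
have half y : dyadic y -> dyadic (y / 2).
  move=> dy; apply: dyadicM => //; exact: (dyadic_exp R (-1)).
pose m := l / 2 / 2; have dm : dyadic m by exact/half/half.
have lE : l = 4 * m by rewrite /m; field.
have m0 : 0 < m by rewrite !divr_gt0.
have l2 : l / 2 = 2 * m by rewrite lE; field.
have d2 : dyadic (l / 2) by exact: half.
clearbody m.
have d n : dyadic (n%:R * m) by apply: dyadicM => //; exact: (dyadic_int R n).
have pl1 : pl (fun y => 2 ^ 1 * y + (- p)) p (p + m).
  apply: (pl_affine (k := 1) (c := - p)) => //; [lra|exact: dyadicD|exact: dyadicN].
have pl2 : pl (fun y => 2 ^ 0 * y + m) (p + m) (p + 2 * m).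
  by apply: (pl_affine (k := 0) (c := m)) => //; [lra|exact: dyadicD|exact/dyadicD/(d 2)].
have pl3 : pl (fun y => 2 ^ (-1) * y + (p / 2 + 2 * m)) (p + 2 * m) (p + 4 * m).
  apply: (pl_affine (k := -1) (c := p / 2 + 2 * m)) => //; first lra.
  - exact/dyadicD/(d 2).
  - exact/dyadicD/(d 4).
  - by apply: dyadicD; [exact: half|exact: (d 2)].
have [|f12 [pf12 f1 f2]] := pl_glue pl1 pl2; first by rewrite expr1z expr0z; ring.
have [|f [pf ff1 ff2]] := pl_glue pf12 pl3.
  rewrite f2; last by lra.
  by rewrite exp2N1 expr0z; field.
have E1 y : p <= y <= p + m -> f y = 2 * y - p.
  by move=> yp; rewrite ff1 ?f1 ?expr1z//; lra.
have E2 y : p + m <= y <= p + 2 * m -> f y = y + m.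
  by move=> yp; rewrite ff1 ?f2 ?expr0z; lra.
have E3 y : p + 2 * m <= y <= p + 4 * m -> f y = y / 2 + (p / 2 + 2 * m).
  by move=> yp; rewrite ff2 ?exp2N1//; lra.
have [|||g [gR gE]] := thompsonT_arc pf.
- by rewrite E1; lra.
- by rewrite E3; lra.
- lra.
exists g; split; first by rewrite lE.
have carry u v : p <= u.1 -> 0 <= u.2 -> u.1 + u.2 <= p + 4 * m ->
    (forall x, 0 <= x <= 1 -> f (u.1 + u.2 * x) = v.1 + v.2 * x) -> carries g u v.
  move=> pu u0 up H x /andP[x0 x1].
  have h1 : 0 <= u.2 * x by exact: mulr_ge0.
  have h2 : u.2 * x <= u.2 by rewrite -[leRHS]mulr1 ler_wpM2l.
  by rewrite gE ?H ?x0//; lra.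
have mx x : 0 <= x <= 1 -> 0 <= m * x <= m.
  move=> /andP[x0 x1]; rewrite mulr_ge0 ?(ltW m0)//=.
  by rewrite -[leRHS]mulr1 ler_wpM2l// ltW.
have m4 : l / 2 / 2 = m by rewrite l2; field.
rewrite /= l2 (_ : 2 * m / 2 = m); last by field.
split; [|split; [|split]] => //; apply: carry => /=; try lra; move=> x x01;
  have := mx x x01 => mx'; [rewrite E1|rewrite E2|rewrite E3]; rewrite -?mulrA; lra.
Qed.

End TreeIntervals.

(** * Rotations and the normal subgroups of T *)

Section Tilings.
Variable R : realType.
Implicit Types (p q l : R) (u v : R * R) (s : seq (R * R)) (t : tree) (g h : thompsonT R).
Local Notation tc := (@to_circle R).

Lemma rist_carries p q g u : rist (circle_action R) (oarc p q) g -> 0 <= u.2 ->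
  q <= u.1 /\ u.1 + u.2 <= p + 1 \/ q - 1 <= u.1 /\ u.1 + u.2 <= p -> carries g u u.
Proof.
move=> gR u0 H x /andP[x0 x1]; apply: gR => -[y /= + e]; rewrite in_itv /= => ypq.
have h1 : 0 <= u.2 * x by exact: mulr_ge0.
have h2 : u.2 * x <= u.2 by rewrite -[leRHS]mulr1 ler_wpM2l.
have yE : y = u.1 + u.2 * x.
  by apply: to_circle_inj e; rewrite ltr_norml; case: H; lra.
by move: ypq; rewrite yE; case: H; lra.
Qed.

(** Adjacent intervals listed from left to right; this forgets the tree of a subdivision. *)
Fixpoint chain p s q : Prop :=
  if s is u :: s' then [/\ u.1 = p, 0 < u.2 & chain (p + u.2) s' q] else p = q.

Lemma chain_cat p q r s1 s2 : chain p s1 q -> chain q s2 r -> chain p (s1 ++ s2) r.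
Proof.
by elim: s1 p => [|u s1 IH] p /= => [->//|[-> u0 H] H2]; split => //; exact: IH.
Qed.

Lemma chain_leaves t p l : 0 < l -> chain p (leaves t p l) (p + l).
Proof.
elim: t p l => [|t1 IH1 t2 IH2] p l l0 //=.
apply: chain_cat (IH1 p (l / 2) _) _; first by rewrite divr_gt0.
have -> : p + l = p + l / 2 + l / 2 by field.
by apply: IH2; rewrite divr_gt0.
Qed.

Lemma chain_le p s q : chain p s q -> p <= q.
Proof.
elim: s p => [|u s IH] p /= => [->//|[_ u0 /IH]]; lra.
Qed.

Lemma chain_mem p s q u : chain p s q -> u \in s -> [/\ p <= u.1, 0 < u.2 & u.1 + u.2 <= q].
Proof.
elim: s p => //= v s IH p [vp v0 H]; rewrite inE => /predU1P[->|us].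
  by have := chain_le H; split => //; lra.
by have [h1 h2 h3] := IH _ H us; split => //; lra.
Qed.

Lemma chain_short p s q u : chain p s q -> (1 < size s)%N -> u \in s -> u.2 < q - p.
Proof.
case: s => // v [|w s] //= [vp v0 [wp w0 H]] _; rewrite inE => /predU1P[->|us].
  by have := chain_le H; lra.
have : chain (p + v.2) (w :: s) q by [].
by move=> /chain_mem/(_ us)[]; lra.
Qed.

Lemma chain_split p s q r : chain p s q -> p <= r -> r <= q ->
  (forall u, u \in s -> ~ (u.1 < r < u.1 + u.2)) ->
  exists s1 s2, [/\ s = s1 ++ s2, chain p s1 r & chain r s2 q].
Proof.
elim: s p => [|u s IH] p /=.
  by move=> pq pr rq _; exists [::], [::]; split => //=; lra.
move=> [up u0 H]; rewrite le_eqVlt => /predU1P[pr|pr] rq nr.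
  by exists [::], (u :: s); split => //=; rewrite -?pr.
have ur : p + u.2 <= r.
  rewrite leNgt; apply/negP => ru; apply: (nr u (mem_head _ _)).
  by rewrite up pr.
have [|s1 [s2 [-> c1 c2]]] := IH _ H ur rq.
  by move=> v vs; apply: nr; rewrite inE vs orbT.
by exists (u :: s1), s2.
Qed.

(** A list of adjacent standard dyadic intervals with more than one member consists of
intervals shorter than the whole. The midpoint of the whole is then not in the interior of
any of them, so the list splits there. *)
Lemma chain_tree n s : (size s <= n)%N -> forall p l, 0 < l -> chain p s (p + l) ->
  (forall u, u \in s -> exists e j : int, u.2 = l * 2 ^ e /\ u.1 = p + j%:~R * u.2) ->
  exists t, leaves t p l = s.
Proof.
elim: n s => [|n IH] s.
  rewrite leqn0 => /nilP -> p l l0 /= pE; exfalso; lra.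
move=> sn p l l0 ch st.
case sE : s => [|u [|v s']].
- by exfalso; move: ch; rewrite sE /=; lra.
- exists Leaf => /=; move: ch; rewrite sE /= => -[u1 u0 u2].
  by rewrite (surjective_pairing u) u1; congr [:: (_, _)]; lra.
rewrite -sE; have s2 : (1 < size s)%N by rewrite sE.
have short u' : u' \in s -> exists k : nat, exists j : int,
    u'.2 = l / 2 * 2 ^ (- k%:Z) /\ u'.1 = p + j%:~R * u'.2.
  move=> us; have [e [j [eE jE]]] := st u' us; have := chain_short ch s2 us.
  rewrite (addrC p) addrK eE -[ltRHS]mulr1 ltr_pM2l// -[ltRHS](expr0z (2 : R)).
  rewrite ltr_eXz2l ?ltr1n// => e0.
  have [k eK] : exists k : nat, e = - 1 + - k%:Z by exists (absz e).-1; lia.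
  exists k, j; split; last by rewrite -eE.
  by rewrite eK exp2D mulrA.
have nr u' : u' \in s -> ~ (u'.1 < p + l / 2 < u'.1 + u'.2).
  move=> us; have [k [j [kE jE]]] := short u' us.
  have m0 : 0 < u'.2 by have [] := chain_mem ch us.
  have lE : l / 2 = (2 ^ k%:Z) * u'.2.
    by rewrite kE mulrCA -exp2D subrr expr0z mulr1.
  have kz : (2 ^ k%:Z : R) = (2 ^+ k : int)%:~R by rewrite rmorphXn.
  rewrite jE lE kz -addrA -[X in _ + X]mulr1.
  have e : forall j : int, j%:~R * u'.2 + u'.2 = (j + 1)%:~R * u'.2.
    by move=> j'; rewrite rmorphD /= mulrDl mul1r.
  rewrite mulr1 e !ltrD2l !ltr_pM2r// !ltr_int; lia.
have [||s1 [s2' [sE' c1 c2]]] := chain_split ch _ _ nr; try lra.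
have sz : (size s = size s1 + size s2')%N by rewrite sE' size_cat.
have s10 : (0 < size s1)%N.
  by rewrite lt0n size_eq0; apply/eqP => e; move: c1; rewrite e /=; lra.
have s20 : (0 < size s2')%N.
  by rewrite lt0n size_eq0; apply/eqP => e; move: c2; rewrite e /=; lra.
have l20 : 0 < l / 2 by lra.
have [||t1 t1E] := IH s1 _ p (l / 2) l20 c1; first by lia.
  move=> u' us; have [|k [j [kE jE]]] := short u'; first by rewrite sE' mem_cat us.
  by exists (- k%:Z), j.
have lE : p + l = p + l / 2 + l / 2 by field.
rewrite lE in c2.
have [||t2 t2E] := IH s2' _ (p + l / 2) (l / 2) l20 c2; first by lia.
  move=> u' us; have [|k [j [kE jE]]] := short u'; first by rewrite sE' mem_cat us orbT.
  exists (- k%:Z), (j - 2 ^+ k); split => //; rewrite {1}jE rmorphB rmorphXn /=.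
  have -> : l / 2 = 2 ^+ k * u'.2.
    by rewrite kE mulrCA -[2 ^+ k]/(2 ^ k%:Z) -exp2D subrr expr0z mulr1.
  by ring.
by exists (Node t1 t2); rewrite /= t1E t2E sE'.
Qed.

End Tilings.

Section ThompsonTPerfect.
Variable R : realType.
Implicit Types (p q l : R) (u v : R * R) (t : tree) (g h : thompsonT R).
Local Notation tc := (@to_circle R).
Local Notation dyadic := (@dyadic R).
Let b := circle_action R.
Variable S : set (thompsonT R).
Hypotheses (SM : forall g h, S g -> S h -> S (g * h)%g).
Hypotheses (SV : forall g, S g -> S g^-1%g) (SJ : forall g h, S g -> S (g ^ h)%g).
Hypothesis SR : forall U, open U -> U !=set0 -> forall g h,
  rist b (~` U) g -> rist b (~` U) h -> S [~ g, h]%g.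

Lemma thompsonT_one_in : S 1%g.
Proof.
rewrite -(commg1 (1 : thompsonT R))%g; apply: (@SR setT); first exact: openT.
- by exists (tc 0).
- exact: rist1.
- exact: rist1.
Qed.

Lemma oarc_sub p q r s : r <= p -> q <= s -> oarc p q `<=` oarc r s.
Proof.
move=> rp qs _ [x /= + <-]; rewrite in_itv /= => xpq.
by apply: oarc_in; lra.
Qed.

(** Elements supported in an arc are trivial on the complementary one. *)
Lemma commutator_in p q g h : p < q -> q < p + 1 ->
  rist b (oarc p q) g -> rist b (oarc p q) h -> S [~ g, h]%g.
Proof.
move=> pq qp gR hR.
have sub : oarc p q `<=` ~` oarc q (p + 1).
  move=> _ [x /= + <-] [y /=]; rewrite !in_itv /= => xpq yqp e.
  have yx : y = x by apply: to_circle_inj e; rewrite ltr_norml; lra.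
  by move: xpq yqp; rewrite yx; lra.
apply: (@SR (oarc q (p + 1))); first exact: oarc_open.
- by exists (tc ((q + (p + 1)) / 2)); apply: oarc_in; lra.
- exact: rist_sub sub _ gR.
- exact: rist_sub sub _ hR.
Qed.

(** An element supported in the arc (0, 7/8) carries the first interval affinely onto the second,
hence conjugates one rotation to the other. The quotient is then a commutator of elements that
are trivial on the arc (7/8, 1). *)
Lemma rotations_equivalent (x y : thompsonT R) p (i : int) p' (i' : int) : dyadic p -> dyadic p' ->
  0 < p -> p + 2 ^ i < 7 / 8 -> 0 < p' -> p' + 2 ^ i' < 7 / 8 ->
  rotates x p (2 ^ i) -> rotates y p' (2 ^ i') -> S (y * x^-1)%g.
Proof.
move=> dp dp' p0 p1 p'0 p'1 xr yr.
have l0 := exp2_gt0 R i; have l0' := exp2_gt0 R i'.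
have d78 : dyadic (7 / 8) by exists 7, 3%N; rewrite -natrX.
have e : 2 ^ (i' - i) * (2 ^ i) = 2 ^ i' :> R by rewrite -exp2D subrK.
have d0 := dyadic_int R 0.
have dl : dyadic (p + 2 ^ i) by apply: dyadicD => //; exact: dyadic_exp.
have [||||||h [hR hE]] := @mover R 0 (7 / 8) p (p + 2 ^ i) p' (i' - i) d0 d78 dp dl dp';
  rewrite ?[p + _]addrC ?addrK ?e //; try lra.
have hc : carries h (p, 2 ^ i) (p', 2 ^ i').
  move=> z /andP[z0 z1] /=.
  have h1 : 0 <= 2 ^ i * z by rewrite mulr_ge0// ltW.
  have h2 : 2 ^ i * z <= 2 ^ i by rewrite -[leRHS]mulr1 ler_wpM2l// ltW.
  rewrite hE; last by lra.
  by congr tc; rewrite -e; ring.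
have -> : y = (h * x * h^-1)%g.
  apply: (tree_pair_unique (p := p') (l := 2 ^ i')) yr.1 _ yr.2 _ => //; first lra.
  - have -> : (h * x * h^-1 = x ^ h^-1)%g by rewrite conjgE invgK mulgA.
    apply: ristJ xr.1 _ => z [w /=]; rewrite in_itv /= => wp e'.
    have -> : z = b h (tc w) by rewrite e' (actVK b h).
    pose w' := (w - p) / 2 ^ i.
    have wE : w = p + 2 ^ i * w' by rewrite /w' mulrC divfK ?gt_eqF// addrC subrK.
    have w'01 : 0 < w' < 1.
      by rewrite /w' ltr_pdivlMr// ltr_pdivrMr//; lra.
    have -> : b h (tc w) = tc (p' + 2 ^ i' * w').
      rewrite wE; apply: (hc w'); lra.
    apply: oarc_in; move: w'01 => /andP[w0 w1].
    have h1 : 0 < 2 ^ i' * w' by rewrite mulr_gt0.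
    have h2 : 2 ^ i' * w' < 2 ^ i' by rewrite -[ltRHS]mulr1 ltr_pM2l.
    by lra.
  - have := carries_all_inv (carries_leaves (Node (Node Leaf Leaf) Leaf) hc).
    move=> /carries_all_comp/(_ xr.2)/carries_all_comp.
    move=> /(_ _ _ (carries_leaves (Node Leaf (Node Leaf Leaf)) hc)).
    by rewrite mulgA.
have -> : (h * x * h^-1 * x^-1 = [~ h^-1, x^-1])%g.
  by rewrite /commg conjgE !invgK !mulgA.
apply: (@commutator_in 0 (7 / 8)); [lra|lra|exact: ristV|].
apply/ristV; apply: rist_sub xr.1; apply: oarc_sub; lra.
Qed.

(** Let [y] and [z] be the rotations at the two children of the vertex. Both sides of the
pentagon relation [x * x = z * x * y] turn the left comb with three carets into the right
comb. Modulo [S] the three rotations agree, so the relation reads [x ^ 2 = x ^ 3]. *)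
Lemma rotation_in (x : thompsonT R) p (i : int) : dyadic p -> 0 < p -> p + 2 ^ i < 7 / 8 ->
  rotates x p (2 ^ i) -> S x.
Proof.
move=> dp p0 p1 xr.
have l0 := exp2_gt0 R (i - 1).
have half k : 2 ^ k / 2 = 2 ^ (k - 1) :> R by rewrite exp2D.
have lE := exp2_half R i.
have dl k : dyadic (2 ^ k) by exact: dyadic_exp.
have [|y yr] := rotation_exists dp (dl (i - 1)) l0; first by lra.
have [|z zr] := rotation_exists (dyadicD dp (dl (i - 1))) (dl (i - 1)) l0; first by lra.
have Sy : S (y * x^-1)%g by apply: rotations_equivalent xr yr => //; lra.
have Sz : S (z * x^-1)%g.
  by apply: rotations_equivalent xr zr => //; [exact: dyadicD|lra|lra].
have pent : (x * x = z * x * y)%g.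
  apply: (tree_pair_unique (p := p) (l := 2 ^ i)
    (t1 := Node (Node (Node Leaf Leaf) Leaf) Leaf)
    (t2 := Node Leaf (Node Leaf (Node Leaf Leaf)))).
  - exact: exp2_gt0.
  - lra.
  - by apply: ristM; exact: xr.1.
  - apply: ristM; first apply: ristM; last first.
    + by apply: rist_sub yr.1; apply: oarc_sub; lra.
    + exact: xr.1.
    + by apply: rist_sub zr.1; apply: oarc_sub; lra.
  - exact: carries_all_comp (rotates_leaves (Node Leaf Leaf) Leaf Leaf xr)
      (rotates_leaves Leaf Leaf (Node Leaf Leaf) xr).
  - rewrite -mulgA; apply: carries_all_comp (carries_all_comp _
      (rotates_leaves Leaf (Node Leaf Leaf) Leaf xr)) _.
    + apply: carries_all_cat; first by rewrite half; exact: yr.2.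
      split => //; apply: (rist_carries yr.1) => /=; rewrite ?half; first lra.
      by left; lra.
    + apply: (carries_all_cat (s1 := [:: _]) (s1' := [:: _])).
        split => //; apply: (rist_carries zr.1) => /=; rewrite ?half; first lra.
        by right; lra.
      by rewrite half; exact: zr.2.
have -> : x = ((y * x^-1)^-1 * (z * x^-1)^-1 ^ (x * x))%g.
  have e : ((z * x^-1)^-1 ^ (x * x) = y)%g.
    rewrite conjgE !invgM !invgK.
    by rewrite pent !mulgA !mulgVK mulVg mul1g.
  by rewrite e invgM invgK mulgVK.
by apply: SM; [exact: SV|exact/SJ/SV].
Qed.

(** Rotations at the root move carets from the left subtree to the right one until the left
child is a leaf; the right subtree has fewer carets. *)
Lemma tree_to_vine n t : (carets t <= n)%N -> forall p (i : int), dyadic p -> 0 < p ->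
  p + 2 ^ i < 7 / 8 -> exists x, [/\ S x, rist b (oarc p (p + 2 ^ i)) x &
    carries_all x (leaves t p (2 ^ i)) (leaves (vine (carets t)) p (2 ^ i))].
Proof.
have half k : 2 ^ k / 2 = 2 ^ (k - 1) :> R by rewrite exp2D.
have dl k : dyadic (2 ^ k) by exact: dyadic_exp.
elim: n t => [|n IHn] t.
  case: t => // _ p i _ _ _; exists 1%g; split; [exact: thompsonT_one_in|exact: rist1|].
  by split.
case: t => [|t1 t2].
  move=> _ p i _ _ _; exists 1%g; split; [exact: thompsonT_one_in|exact: rist1|].
  by split.
elim: t1 t2 => [|t1 IH1 t2 _] t3 cn p i dp p0 p1.
  have lE := exp2_half R i; have l0 := exp2_gt0 R (i - 1).
  have [||||x [Sx xR xc]] := IHn t3 _ (p + 2 ^ (i - 1)) (i - 1).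
  - by move: cn => /=; rewrite add0n.
  - exact: dyadicD.
  - lra.
  - lra.
  exists x; split => //; first by apply: rist_sub xR; apply: oarc_sub; lra.
  rewrite /= add0n; apply: (carries_all_cat (s1 := [:: _]) (s1' := [:: _])).
    split => //; apply: (rist_carries xR) => /=; rewrite ?half; first lra.
    by right; lra.
  by rewrite half.
have [|x xr] := rotation_exists dp (dl i) (exp2_gt0 R i); first lra.
have [||||y [Sy yR yc]] := IH1 (Node t2 t3) _ p i => //.
  by move: cn => /=; lia.
exists (y * x)%g; split.
- by apply: SM => //; exact: rotation_in xr.
- by apply: ristM => //; exact: xr.1.
- have -> : carets (Node (Node t1 t2) t3) = carets (Node t1 (Node t2 t3)) by rewrite /=; lia.
  exact: carries_all_comp (rotates_leaves _ _ _ xr) yc.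
Qed.

End ThompsonTPerfect.

(** * Tree pairs of elements of T *)

Section TreePairs.
Variable R : realType.
Implicit Types (p q l : R) (u v : R * R) (s : seq (R * R)) (t : tree) (g h : thompsonT R).
Local Notation tc := (@to_circle R).
Local Notation dyadic := (@dyadic R).
Let b := circle_action R.

Lemma dyadic_grid (B : set (circle R)) : finite_set B -> B `<=` @dyadic_circle R ->
  exists n : nat, forall x, B (tc x) -> exists m : int, x = m%:~R * 2 ^ (- n%:Z).
Proof.
move=> /finite_seqP[s ->]; elim: s => [|z s IH] Bd; first by exists 0%N.
have [|n nP] := IH; first by move=> w ws; apply: Bd; exact: (@mem_behead _ (z :: s)).
have [y [m [k yE]] yz] := Bd z (mem_head _ _).
have up (i : int) (j j' : nat) : i%:~R * 2 ^ (- j%:Z) = (i * 2 ^+ j')%:~R * 2 ^ (- (j + j')%N%:Z) :> R.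
  rewrite rmorphM rmorphXn /= -mulrA -[_ ^+ j']/(2 ^ j'%:Z) -exp2D.
  by congr (_ * 2 ^ _); lia.
exists (n + k)%N => x xs; have : tc x \in z :: s by [].
rewrite in_cons => /predU1P[xz|/nP[i ->]]; last first.
  by exists (i * 2 ^+ k); exact: up.
have /to_circle_eqP[i ->] : tc y = tc x by rewrite yz xz.
exists ((m + i * 2 ^+ k) * 2 ^+ n); rewrite addnC -up yE.
rewrite rmorphD rmorphM rmorphXn /= mulrDl -exprnN; congr (_ + _).
by rewrite mulfK// expf_neq0// pnatr_eq0.
Qed.

Section Lift.
Variable f : R -> R.

(** The interval has a subdivision such that [f] is affine on each piece and maps it to an
interval whose left end is, relatively to 1/4, a multiple of its length. In the application,
1/4 is the left end of the interval that is subdivided on both sides. *)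
Definition good p l := exists t, forall u, u \in leaves t p l -> exists k e j : int,
  [/\ u.2 = 2 ^ e, forall x, u.1 <= x <= u.1 + u.2 -> f x = f u.1 + 2 ^ k * (x - u.1) &
    f u.1 = 4^-1 + j%:~R * 2 ^ (k + e)].

Lemma good_node p l : good p (l / 2) -> good (p + l / 2) (l / 2) -> good p l.
Proof.
move=> [t1 H1] [t2 H2]; exists (Node t1 t2) => u.
by rewrite /= mem_cat => /orP[/H1|/H2].
Qed.

Lemma exp2_div2 k : 2 ^ k / 2 = 2 ^ (k - 1) :> R. Proof. by rewrite exp2D. Qed.

(** Where [f] is affine, halving a piece halves the length of its image, which improves the
alignment of the left end by one binary digit. *)
Lemma good_affine (M : nat) (k e j : int) p :
  (forall x, p <= x <= p + 2 ^ e -> f x = f p + 2 ^ k * (x - p)) ->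
  f p = 4^-1 + j%:~R * 2 ^ (k + e - M%:Z) -> good p (2 ^ e).
Proof.
elim: M e j p => [|M IH] e j p fE fp.
  exists Leaf => u; rewrite inE => /eqP->; exists k, e, j; split => //=.
  by rewrite fp subr0.
have e2 := exp2_half R e; have e0 := exp2_gt0 R (e - 1).
have left x : p <= x <= p + 2 ^ (e - 1) -> p <= x <= p + 2 ^ e by clear fp; lra.
have right x : p + 2 ^ (e - 1) <= x <= p + 2 ^ (e - 1) + 2 ^ (e - 1) ->
  p <= x <= p + 2 ^ e by clear fp; lra.
have mid : p <= p + 2 ^ (e - 1) <= p + 2 ^ e by clear fp; lra.
have E : k + e - M.+1%:Z = k + (e - 1) - M%:Z by lia.
apply: good_node; rewrite exp2_div2.
  apply: (IH _ j) => [x xp|]; last by rewrite fp E.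
  by apply: fE; exact: left.
have fm : f (p + 2 ^ (e - 1)) = f p + 2 ^ (k + (e - 1)).
  by rewrite fE// (exp2D R k) (addrC p) addrK.
apply: (IH _ (j + 2 ^+ M)) => [x xp|].
  by rewrite fm fE ?right// (exp2D R k) opprD; move: (2 ^ (e - 1)) => L; ring.
rewrite fm fp E rmorphD rmorphXn /= mulrDl [RHS]addrA; congr (_ + _).
by rewrite -[_ ^+ M]/(2 ^ M%:Z) -exp2D; congr (2 ^ _); lia.
Qed.

Hypothesis fd : forall x, dyadic x -> dyadic (f x).
Hypothesis fi : {homo f : x y / x < y}.
Variable B : set (circle R).
Hypothesis faff : dyadic_affine_off B f.
Variable n : nat.
Hypothesis grid : forall x, B (tc x) -> exists m : int, x = m%:~R * 2 ^ (- n%:Z).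

(** Descend from the given standard interval to the grid containing all breakpoints, where
[f] is affine. *)
Lemma good_grid (d : nat) (m e : int) : e = - n%:Z + d%:Z -> good (m%:~R * 2 ^ e) (2 ^ e).
Proof.
elim: d m e => [|d IH] m e eE.
  have l0 := exp2_gt0 R e; rewrite addr0 in eE.
  have [||k [c E]] := faff (a := m%:~R * 2 ^ e) (b := m%:~R * 2 ^ e + 2 ^ e).
  - by rewrite ltrDl.
  - move=> x + /grid[m' xE]; rewrite xE -eE -[X in _ + X]mul1r -mulrDl.
    by rewrite !ltr_pM2r// -intrD1 !ltr_int; lia.
  set p := m%:~R * 2 ^ e.
  have fE x : p <= x <= p + 2 ^ e -> f x = f p + 2 ^ k * (x - p).
    by move=> xp; rewrite !E ?lexx ?lerDl ?(ltW l0)//; ring.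
  have dp : dyadic p by apply: dyadicM; [exact: dyadic_int|exact: dyadic_exp].
  have d4 : dyadic 4^-1 by exists 1, 2%N; rewrite mul1r -natrX.
  have [j [D jE]] := dyadicB (fd dp) d4.
  have fp : f p = 4^-1 + j%:~R * 2 ^ (- D%:Z).
    by rewrite -exprnN -jE addrC subrK.
  pose M := (absz (k + e)%R + D)%N.
  have [r rE] : exists r : nat, - D%:Z = r%:Z + (k + e - M%:Z).
    by exists (absz ((absz (k + e)%R)%:Z - (k + e))%R); rewrite /M; lia.
  apply: (@good_affine M k e (j * 2 ^+ r)) => //.
  by rewrite fp rE exp2D rmorphM rmorphXn mulrA.
have e1 : e - 1 = - n%:Z + d%:Z by lia.
have h := exp2_half R e.
apply: good_node; rewrite exp2_div2.
  have -> : m%:~R * 2 ^ e = (m * 2)%:~R * 2 ^ (e - 1) :> R by rewrite h rmorphM /=; ring.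
  exact: IH.
have -> : m%:~R * 2 ^ e + 2 ^ (e - 1) = (m * 2 + 1)%:~R * 2 ^ (e - 1) :> R.
  by rewrite h rmorphD rmorphM /=; ring.
exact: IH.
Qed.

End Lift.
(** The lift can be normalized at one point, by adding an integer. *)
Lemma thompsonT_lift g x0 y0 : g (tc x0) = tc y0 -> exists f B n,
  [/\ [/\ {homo f : x y / x < y}, forall x, f (x + 1) = f x + 1 & f x0 = y0],
    forall x, g (tc x) = tc (f x),
    forall x, dyadic x -> dyadic (f x), dyadic_affine_off B f &
    forall x, B (tc x) -> exists m : int, x = m%:~R * 2 ^ (- n%:Z)].
Proof.
have /asboolP[f [B [[fc fi f1 fg] finB Bd faff gd]]] : thompsonT_val g \in @thompsonT_pred R.
  exact: valP g.
rewrite fg => /to_circle_eqP[m y0E].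
have [n grid] := dyadic_grid finB Bd.
exists (fun x => f x + m%:~R), B, n; split => //.
- by split => // [x y xy|x]; [rewrite ltrD2r; exact: fi|rewrite f1 addrAC].
- by move=> x; rewrite to_circle_shift.
- move=> x dx; apply: dyadicD; last exact: dyadic_int.
  have : dyadic_circle (g (tc x)) by rewrite -gd; exists (tc x) => //; exists x.
  rewrite fg => -[y dy /to_circle_eqP[i ->]].
  by apply: dyadicD => //; exact: dyadic_int.
- move=> u v uv H; have [k [c E]] := faff u v uv H; exists k, (c + m%:~R) => x xuv.
  by rewrite E// addrA.
Qed.

Lemma exp2N2 : 2 ^ (-2) = 4^-1 :> R.
Proof. by rewrite -[-2]/(- 2%:Z) -exprnN -natrX. Qed.

Definition image_interval (f : R -> R) u : R * R := (f u.1, f (u.1 + u.2) - f u.1).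

Lemma chain_image (f : R -> R) p s q : {homo f : x y / x < y} ->
  chain p s q -> chain (f p) (map (image_interval f) s) (f q).
Proof.
move=> fi; elim: s p => [|u s IH] p /= => [->//|[up u0 H]]; split.
- by rewrite up.
- by rewrite subr_gt0; apply: fi; rewrite ltrDl.
- by rewrite up addrC subrK; exact: IH.
Qed.

(** Subdivide the source until the images of the pieces are standard intervals; these images
are adjacent, so they are the leaves of a second tree. *)
Lemma tree_pair_exists g : rist b (oarc 4^-1 2^-1) g -> exists t1 t2,
  carries_all g (leaves t1 4^-1 4^-1) (leaves t2 4^-1 4^-1).
Proof.
move=> gR.
have fixq x : 0 <= x <= 4^-1 \/ 2^-1 <= x <= 1 -> g (tc x) = tc x.
  move=> xE; apply: gR => -[y /= + e]; rewrite in_itv /= => yE.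
  have yx : y = x by apply: to_circle_inj e; rewrite ltr_norml; case: xE; lra.
  by move: yE; rewrite yx; case: xE; lra.
have [|f [B [n [[fi f1 f4] fg fd faff grid]]]] := @thompsonT_lift g 4^-1 4^-1.
  by apply: fixq; left; lra.
have f2 : f 2^-1 = 2^-1.
  have e : tc (f 2^-1) = tc 2^-1 by rewrite -(fg 2^-1) fixq//; right; lra.
  have lo : 4^-1 < f 2^-1 by rewrite -f4; apply: fi; lra.
  have hi : f 2^-1 < 4^-1 + 1 by rewrite -f4 -f1; apply: fi; lra.
  by apply: to_circle_inj e; rewrite ltr_norml; lra.
have grid2 x : B (tc x) -> exists m : int, x = m%:~R * 2 ^ (- (n + 2)%N%:Z).
  move=> /grid[m ->]; exists (m * 4); rewrite PoszD opprD exp2D rmorphM /=.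
  by rewrite -[2%:Z]/(2 : int) exp2N2; field.
have [|t1 t1P] := @good_grid f fd B faff _ grid2 n 1 (-2).
  by lia.
rewrite mul1r exp2N2 in t1P.
have l4 : 0 < 4^-1 :> R by lra.
have half : 4^-1 + 4^-1 = 2^-1 :> R by lra.
have ch := chain_leaves t1 4^-1 l4.
have ch2 := chain_image fi ch; rewrite half f2 f4 -half in ch2.
have imgE u : u \in leaves t1 4^-1 4^-1 -> exists k e j : int,
    [/\ u.2 = 2 ^ e, (image_interval f u).2 = 2 ^ (k + e),
      (image_interval f u).1 = 4^-1 + j%:~R * 2 ^ (k + e) &
      forall x, 0 <= x <= 1 -> f (u.1 + u.2 * x) = f u.1 + 2 ^ (k + e) * x].
  move=> ut; have [k [e [j [uE fE fj]]]] := t1P u ut; exists k, e, j.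
  have u0 : 0 < u.2 by rewrite uE exp2_gt0.
  split=> //=.
    by rewrite fE ?lexx ?lerDl ?(ltW u0)// (addrC u.1) addrK addrAC subrr add0r uE exp2D.
  move=> x /andP[x0 x1]; rewrite fE.
    by rewrite (addrC u.1) addrK uE exp2D mulrA.
  rewrite lerDl mulr_ge0 ?(ltW u0)//= lerD2l.
  by rewrite -[leRHS]mulr1 ler_wpM2l// ltW.
have [|t2 t2E] := chain_tree (leqnn _) l4 ch2.
  move=> _ /mapP[u ut ->]; have [k [e [j [uE i2 i1 _]]]] := imgE u ut.
  exists (k + e + 2), j; rewrite i2 -exp2N2 -exp2D; split; last by rewrite i1 -exp2N2.
  by congr (2 ^ _); lia.
exists t1, t2; rewrite t2E.
have sub u : u \in leaves t1 4^-1 4^-1 -> carries g u (image_interval f u).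
  move=> ut x x01; have [k [e [j [_ i2 _ H]]]] := imgE u ut.
  by rewrite fg H// i2.
elim: (leaves t1 4^-1 4^-1) sub => //= u s IH sub; split; first exact/sub/mem_head.
by apply: IH => v vs; apply: sub; rewrite inE vs orbT.
Qed.

End TreePairs.

(** * Generation of T by elements fixing an arc *)

Section Fragmentation.
Variable R : realType.
Implicit Types (p q : R) (t : tree) (g h : thompsonT R).
Local Notation tc := (@to_circle R).
Local Notation dyadic := (@dyadic R).
Let b := circle_action R.
Variable S : set (thompsonT R).
Hypotheses (SM : forall g h, S g -> S h -> S (g * h)%g).
Hypotheses (SV : forall g, S g -> S g^-1%g) (SJ : forall g h, S g -> S (g ^ h)%g).
Hypothesis SR : forall U, open U -> U !=set0 -> forall g h,
  rist b (~` U) g -> rist b (~` U) h -> S [~ g, h]%g.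

Lemma carries_all_size g s1 s2 : carries_all g s1 s2 -> size s1 = size s2.
Proof. by elim: s1 s2 => [|u s1 IH] [|v s2] //= [_ /IH ->]. Qed.

(** Reducing both trees of a tree pair to the vine by elements of [S] leaves a vine to vine
pair, which is the identity. *)
Lemma quarter_in g : rist b (oarc 4^-1 2^-1) g -> S g.
Proof.
move=> gR; have [t1 [t2 gt]] := tree_pair_exists gR.
have := carries_all_size gt; rewrite !size_leaves => -[c12].
have d4 : dyadic 4^-1 by rewrite -exp2N2; exact: dyadic_exp.
have vineS t : exists x, [/\ S x, rist b (oarc 4^-1 (4^-1 + 4^-1)) x &
    carries_all x (leaves t 4^-1 4^-1) (leaves (vine (carets t)) 4^-1 4^-1)].
  have := @tree_to_vine R S SM SV SJ SR _ t (leqnn _) 4^-1 (-2) d4.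
  by clear c12; rewrite exp2N2; apply; lra.
have [x1 [Sx1 x1R x1t]] := vineS t1; have [x2 [Sx2 x2R x2t]] := vineS t2.
have half : 2^-1 = 4^-1 + 4^-1 :> R by clear c12; lra.
have [l0 l1] : 0 < 4^-1 :> R /\ 4^-1 <= 1 :> R by clear c12; split; lra.
rewrite half in gR.
have -> : g = (x2^-1 * x1)%g.
  apply: (tree_pair_unique (p := 4^-1) (l := 4^-1)) gR _ gt _ => //.
    by apply: ristM => //; exact: ristV.
  by apply: carries_all_comp x1t _; rewrite c12; exact: carries_all_inv.
by apply: SM => //; exact: SV.
Qed.

(** Conjugation compresses the complement of the arc into (1/4, 1/2). *)
Lemma fixing_arc_in p q g : dyadic p -> dyadic q -> p < q -> q <= p + 1 ->
  rist b (~` oarc p q) g -> S g.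
Proof.
move=> dp dq pq qp gR.
have [k0 k0pq] : exists g, oarc p q (b g (tc 0)).
  by apply: circle_orbit; exists p, q.
have d k : dyadic (2 ^ k) by exact: dyadic_exp.
have [||k kP] := @circle_compress R (b k0 @^-1` oarc p q) (oarc 4^-1 2^-1) _ k0pq.
- by apply: act_open; exact: oarc_open.
- exists 4^-1, 2^-1; split => //; [|exact: (d (-1))|lra|lra].
  by rewrite -exp2N2.
rewrite -[g](conjgK (k0 * k^-1)%g); apply: SJ; apply: quarter_in.
by apply: ristJ gR _ => z; rewrite actM => /kP; rewrite actVK.
Qed.

(** Some element [h] that fixes an arc coincides with [g] on a short interval [0, d], where [g]
is affine. Then [h^-1 * g] fixes the arc (0, d). *)
Lemma thompsonT_in g : S g.
Proof.
have [c /andP[c0 c1] cE] := to_circle_window 0 (g (tc 0)); rewrite add0r in c1.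
have [f [B [n [[fi f1 f0] fg fd faff grid]]]] := thompsonT_lift (esym cE).
have d0 := dyadic_int R 0; have d1 := dyadic_int R 1.
have dc : dyadic c by rewrite -f0; apply: fd.
have [||k [c' fE]] := faff 0 (2 ^ (- n%:Z)); first exact: exp2_gt0.
  move=> x + /grid[m xE]; rewrite xE => /andP[]; rewrite pmulr_lgt0 ?exp2_gt0// ltr0z => m0.
  by rewrite -[ltRHS]mul1r ltr_pM2r ?exp2_gt0// ltrz1; lia.
have c'E : c' = c.
  by rewrite -f0 fE ?mulr0 ?add0r// lexx ltW// exp2_gt0.
rewrite {}c'E in fE.
(* [h] is supported in the arc from [- e] to [1 - 2 * e], which must contain [0, d] as well as
   its image [c, c + 2 ^ k * d], and it fixes the arc from [1 - 2 * e] to [1 - e] *)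
have [|i /andP[]] := @exp2_dyadic_small R (Num.min ((1 - c) / 4) 4^-1).
  by rewrite lt_min; apply/andP; split; lra.
rewrite lt_min; have := dyadic_exp R i; move: (2 ^ i : R) => e de e0 /andP[e1 e4].
have k0 := exp2_gt0 R k; have n0 := exp2_gt0 R (- n%:Z).
have [|j /andP[]] := @exp2_dyadic_small R (Num.min (e / 2 ^ k) (Num.min e (2 ^ (- n%:Z)))).
  by rewrite !lt_min e0 n0 divr_gt0.
rewrite !lt_min ltr_pdivlMr// (mulrC _ (2 ^ k)).
have := dyadic_exp R j; move: (2 ^ j : R) => d dd dgt0 /and3P[dk de' dn].
have d2 : dyadic (1 - 2 * e).
  by apply: dyadicB => //; apply: dyadicM => //; exact: (dyadic_int R 2).
have [||||||h [hR hE]] := @mover R (- e) (1 - 2 * e) 0 d c k (dyadicN de) d2 d0 dd dc;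
  rewrite ?subr0; try lra.
have Sh : S h.
  apply: (@fixing_arc_in (1 - 2 * e) (1 - e)) => //; [exact: dyadicB|lra|lra|].
  apply: rist_sub hR => _ [x /= + <-] [y /=]; rewrite !in_itv /= => xe ye xy.
  have yx : y - 1 = x.
    apply: to_circle_inj; first by rewrite ltr_norml; lra.
    by rewrite -xy -(to_circle_shift y (-1)) rmorphN.
  lra.
rewrite -[g](mulVKg h); apply: SM => //.
apply: (@fixing_arc_in 0 d) => //; first lra.
move=> z /contrapT[x /= + <-]; rewrite in_itv /= => /andP[x0 xd].
have hg : h (tc x) = g (tc x).
  by rewrite fg fE ?hE ?subr0 1?addrC//; lra.
rewrite -[LHS]/(b h^-1%g (g (tc x))) -hg.
exact: (actK b h).
Qed.

End Fragmentation.

Theorem thompsonT_perfect (R : realType) : locally_perfect (circle_action R).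
Proof. by move=> S SM SV SJ SR; exact: thompsonT_in. Qed.

(** * The three groups *)

Theorem theorem1p8 (R : realType) :
  (forall (X : topologicalType) (a : action (thompsonF R) X),
    compact [set: X] -> hausdorff_space X ->
    faithful a -> minimal a -> topologically_free a) /\
  (forall (X : topologicalType) (a : action (thompsonT R) X),
    compact [set: X] -> hausdorff_space X ->
    nontrivial_action a -> minimal a ->
    topologically_free a \/ factors_onto a (circle_action R)) /\
  (forall (X : topologicalType) (a : action thompsonV X),
    compact [set: X] -> hausdorff_space X ->
    nontrivial_action a -> minimal a ->
    topologically_free a \/ factors_onto a cantor_action).
Proof.
split; [|split] => X a cX hX.
- exact: thompsonF_free.
- move=> nonta mina; exact: (free_or_factors (@circle_faithful R) (@circle_hausdorff R)
    (@circle_compact R) (@dyadic_arcs_system R) (@circle_orbit R) (@circle_compress R)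
    (@circle_spread R) (@thompsonT_perfect R) cX hX mina nonta).
- move=> nonta mina; exact: (free_or_factors cantor_faithful cantor_space_hausdorff
    cantor_space_compact cylinder_system cantor_orbit cantor_compress cantor_spread
    thompsonV_perfect cX hX mina nonta).
Qed.
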